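(* Let $n\ge1$ and let $F\in C^1((\overline{B}_1\setminus\{0\})\times\mathbb{R}\times\mathbb{R}^n\times\mathcal{S}^{n\times n})$ be such that the matrix $\left(\frac{\partial F}{\partial M_{ij}}(x,s,p,M)\right)$ is positive definite for all $(x,s,p,M)\in(\overline{B}_1\setminus\{0\})\times\mathbb{R}\times\mathbb{R}^n\times\mathcal{S}^{n\times n}$. Assume that for all $x\in B_1$ with $0<x_1<1$, all $\hat x_1$ with $-1<\hat x_1\le x_1$, $x_1+\hat x_1>0$ and $(\hat x_1,x_2,\dots,x_n)\neq0$, and all $s\in\mathbb{R}$, $p\in\mathbb{R}^n$, $M\in\mathcal{S}^{n\times n}$, $$F(\hat x_1,x_2,\dots,x_n,s,\hat p,\widehat M)\ge F(x_1,x_2,\dots,x_n,s,p,M).$$ Assume in addition that $F$ is symmetric under reflection in the plane $\{x_1=0\}$, i.e. $F(-x_1,x_2,\dots,x_n,s,\hat p,\widehat M)=F(x_1,x_2,\dots,x_n,s,p,M)$ for all $(x,s,p,M)$ in the domain of $F$. Assume that $u\in C^2(\overline{B}_1\setminus\{0\})$ satisfies, for some $0<\bar r\le1$: for every $V\in\mathbb{R}^n$, the function $w(x):=u(x)+V\cdot x$ satisfies $\inf_{B_r\setminus\{0\}}w=\min_{\partial B_r}w$ for all $0<r<\bar r$. Assume also $$F(x,u,\nabla u,\nabla^2u)=0,\quad u>0\qquad\text{in }B_1\setminus\{0\},$$ and $u=0$ on $\partial B_1$. Then $u$ is symmetric in $x_1$, i.e. $u(-x_1,x_2,\dots,x_n)=u(x_1,x_2,\dots,x_n)$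 for all $x\in\overline{B}_1\setminus\{0\}$.
   Context: $B_r$ is the open ball of radius $r$ centered at the origin of $\mathbb{R}^n$. $\mathcal{S}^{n\times n}$ is the set of real symmetric $n\times n$ matrices. For $p=(p_1,\dots,p_n)\in\mathbb{R}^n$ put $\hat p:=(-p_1,p_2,\dots,p_n)$. For $M=(M_{ij})\in\mathcal{S}^{n\times n}$, $\widehat M=(\widehat M_{ij})$ is given by $\widehat M_{1j}=-M_{1j}$ for $2\le j\le n$, $\widehat M_{i1}=-M_{i1}$ for $2\le i\le n$, $\widehat M_{11}=M_{11}$, and $\widehat M_{ij}=M_{ij}$ for $2\le i,j\le n$. *)

(* Defs.v *)
From mathcomp Require Import all_boot all_order all_algebra.
From mathcomp Require Import all_classical all_reals all_analysis.
Import Order.TTheory GRing.Theory Num.Theory.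
Import numFieldNormedType.Exports.

Set Implicit Arguments.
Unset Strict Implicit.
Unset Printing Implicit Defensive.

Local Open Scope classical_set_scope.
Local Open Scope ring_scope.

Section EuclideanSpace.
Context {R : realType} {n : nat}.

(* Row vectors of length n.+1 model R^N with N = n.+1 >= 1. The library norm
   `|x| on them is the sup norm, so the Euclidean one is defined here. *)
Definition dotp (x y : 'rV[R]_n.+1) : R := \sum_i x 0 i * y 0 i.
Definition enorm (x : 'rV[R]_n.+1) : R := Num.sqrt (dotp x x).

Definition oball (r : R) : set 'rV[R]_n.+1 := [set x | enorm x < r].
Definition cball (r : R) : set 'rV[R]_n.+1 := [set x | enorm x <= r].
Definition esphere (r : R) : set 'rV[R]_n.+1 := [set x | enorm x = r].

(* The coordinate x_1 of the mathematics is the entry of index ord0. *)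
Definition fstc (x : 'rV[R]_n.+1) : R := x 0 ord0.
Definition set_fstc (x : 'rV[R]_n.+1) (t : R) : 'rV[R]_n.+1 :=
  \row_i (if i == ord0 then t else x 0 i).
Definition hatv (p : 'rV[R]_n.+1) : 'rV[R]_n.+1 := set_fstc p (- fstc p).
Definition hatm (M : 'M[R]_n.+1) : 'M[R]_n.+1 :=
  \matrix_(i, j) (if (i == ord0) != (j == ord0) then - M i j else M i j).

Definition symm : set 'M[R]_n.+1 := [set M | M \is symmetricmx].

Definition posdefmx (A : 'M[R]_n.+1) : Prop :=
  forall v : 'rV[R]_n.+1, v != 0 -> 0 < (v *m A *m v^T) 0 0.

Definition gradient (u : 'rV[R]_n.+1 -> R) (x : 'rV[R]_n.+1) : 'rV[R]_n.+1 :=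
  \row_i 'D_(delta_mx 0 i) u x.
Definition hessian (u : 'rV[R]_n.+1 -> R) (x : 'rV[R]_n.+1) : 'M[R]_n.+1 :=
  \matrix_(i, j) 'D_(delta_mx 0 i) (fun y => 'D_(delta_mx 0 j) u y) x.

(* The matrix (dG / dM_ij) of a function G of a symmetric matrix: the symmetric
   matrix A such that dG(M)[N] = \sum_(i, j) A i j * N i j for N symmetric. For
   instance it is A for G(M) = \tr (A *m M) with A symmetric. The off-diagonal
   entries are derivatives along symmetric directions, so only the values of G
   on symmetric matrices matter. *)
Definition sym_gradient (G : 'M[R]_n.+1 -> R) (M : 'M[R]_n.+1) : 'M[R]_n.+1 :=
  \matrix_(i, j) 'D_(2^-1 *: (delta_mx i j + delta_mx j i)) G M.

End EuclideanSpace.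

(* f is of class C^k on D in the sense used for sets such as the closed ball:
   U is the interior of D relative to the affine space in which D lives, and W
   is the space of directions of that affine space. All derivatives of order
   at most k exist in U and extend continuously to D. The values of f
   outside D play no role. *)
Fixpoint classC {R : realType} {V : normedModType R} (W U D : set V)
    (k : nat) (f : V -> R) : Prop :=
  {within D, continuous f} /\
  if k is k'.+1 then
    forall v, W v -> exists g : V -> R,
      (forall x, U x -> is_derive x v f (g x)) /\ classC W U D k' g
  else True.

Definition is_min_on {R : realType} {T : Type} (A : set T) (w : T -> R)
    (m : R) : Prop :=
  (exists2 x, A x & w x = m) /\ (forall y, A y -> m <= w y).

(* The arguments (x, s, p, M) of F. The matrix component ranges over all square
   matrices; membership in the space of symmetric ones is imposed by the sets
   below. *)
Definition jet (R : realType) (n : nat) : normedModType R :=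
  ('rV[R]_n.+1 * R * 'rV[R]_n.+1 * 'M[R]_n.+1)%type.

Definition jets_over {R : realType} {n : nat} (A : set 'rV[R]_n.+1) :
    set (jet R n) :=
  [set z | A z.1.1.1 /\ symm z.2].

(* Main.v *)
(* Moving planes [x_1 = l], for [l] decreasing from 1 to 0: on [x_1 > l] the
   reflection of [u] is a supersolution of the equation of [u], so the gap
   between the two obeys maximum principles. They are all derived from the fact
   that a paraboloid with one large positive curvature cannot touch the gap from
   below. The reflection of [u] is singular at the pole [2 l e_1]; there the
   hypothesis on the infima of [u + V.x], with [V] read off the gradient of [u]
   at the pole, keeps the gap away from 0. *)

Require Import Defs.
From mathcomp Require Import all_boot all_order all_algebra.
From mathcomp Require Import all_classical all_reals all_analysis.
From mathcomp Require Import ring lra.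
Import Order.TTheory GRing.Theory Num.Theory.
Import numFieldNormedType.Exports.

Set Implicit Arguments.
Unset Strict Implicit.
Unset Printing Implicit Defensive.

Local Open Scope classical_set_scope.
Local Open Scope ring_scope.

(** The obstacle is that the reflection of [u] has no bounded jet near the pole, so the equation for
    the gap cannot be linearised there with controlled coefficients. A touching paraboloid avoids
    this. At a touching point the reflected Hessian dominates the Hessian of [u] plus a small
    explicit matrix. Monotonicity of [F] in the matrix absorbs the uncontrolled remainder, and
    ellipticity is used quantitatively only near jets of [u] itself. These vary continuously on the
    compact set of points of the closed ball with [x_1 >= a]. The resulting constant [tau] is
    therefore the same for all planes and is not affected by the pole, so one barrier serves both
    for Hopf's lemma and for the growth of the gap at the pole. At the pole the barriers are used in
    [e_1] and in both signs of the other axes, which suffices for linear growth after a tilt along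
    [e_1]. The moving planes give an inequality between [u] and its reflection; the same argument
    for the reflected solution gives the opposite one. *)

(** * Derivatives along lines *)

Section LineCalculus.
Context {R : realType} {V : normedModType R}.
Implicit Types (f g : V -> R) (x v w : V) (D U : set V).

Definition continuous_in D g x := forall e, 0 < e ->
  exists2 d, 0 < d & forall y, D y -> `|y - x| < d -> `|g y - g x| < e.

Lemma within_continuous_in D g :
  {within D, continuous g} -> forall x, D x -> continuous_in D g x.
Proof.
move=> cg x Dx e e0.
have /(_ _ Dx) := (subspace_continuousP D g).1 cg.
move=> /cvgrPdist_lt /(_ e e0); rewrite near_withinE => /nbhs_ballP [d d0 dP].
exists d => // y Dy yx; rewrite distrC; apply: (dP y) => //.
by rewrite -ball_normE /= distrC.
Qed.

Lemma continuous_in_within D g :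
  (forall x, D x -> continuous_in D g x) -> {within D, continuous g}.
Proof.
move=> cg; apply/subspace_continuousP => x Dx.
apply/cvgrPdist_lt => e e0; rewrite near_withinE.
have [d d0 dP] := cg x Dx e e0.
apply/nbhs_ballP; exists d => // y; rewrite -ball_normE /= => yx Dy.
by rewrite distrC; apply: dP => //; rewrite distrC.
Qed.

(** The estimate covers all small [h], zero included, so it passes through affine changes of
    variable without punctured filters. *)
Lemma is_deriveP f x v l :
  is_derive x v f l <->
  forall e, 0 < e -> exists2 d, 0 < d &
    forall h, `|h| < d -> `|f (x + h *: v) - f x - h * l| <= e * `|h|.
Proof.
split=> [[dfx fl] e e0|H].
  have : h^-1 *: ((f \o shift x) (h *: v) - f x) @[h --> 0^'] --> l.
    by rewrite -fl; exact: dfx.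
  move=> /cvgrPdist_lt /(_ e e0) /nbhs_ballP [d /= d0 dP].
  exists d => // h hd; have [->|h0] := eqVneq h 0.
    by rewrite scale0r addr0 subrr mul0r subrr !normr0 mulr0.
  have := dP h; rewrite -ball_normE /= sub0r normrN => /(_ hd h0) /ltW.
  have -> : l - h^-1 *: (f (h *: v + x) - f x) =
            - (f (x + h *: v) - f x - h * l) / h.
    by rewrite (addrC x) /GRing.scale /=; field.
  by rewrite normrM normrN normfV ler_pdivrMr ?normr_gt0.
have C : h^-1 *: ((f \o shift x) (h *: v) - f x) @[h --> 0^'] --> l.
  apply/cvgrPdist_le => e e0.
  have [d d0 dP] := H e e0.
  apply/nbhs_ballP; exists d => // h; rewrite -ball_normE /= sub0r normrN => hd h0.
  have -> : l - h^-1 *: (f (h *: v + x) - f x) =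
            - (f (x + h *: v) - f x - h * l) / h.
    by rewrite (addrC x) /GRing.scale /=; field.
  by rewrite normrM normrN normfV ler_pdivrMr ?normr_gt0 ?dP.
split; first by apply/cvg_ex; exists l.
exact: (cvg_lim _ C).
Qed.

Lemma is_derive_unique f x v l l' :
  is_derive x v f l -> is_derive x v f l' -> l = l'.
Proof. by move=> [_ <-] [_ <-]. Qed.

Lemma is_derive_line f x v t l :
  is_derive (x + t *: v) v f l <-> is_derive t 1 (fun s => f (x + s *: v)) l.
Proof.
have E : (fun h : R => h^-1 *: ((f \o shift (x + t *: v)) (h *: v) - f (x + t *: v)))
  = (fun h : R => h^-1 *: (((fun s => f (x + s *: v)) \o shift t) (h *: (1:R)) -
       f (x + t *: v))).
  apply/funext => h /=; congr (_ *: (f _ - _)).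
  by rewrite scalerDl addrCA /GRing.scale /= mulr1.
by split=> -[D0 D1]; split; move: D0 D1; rewrite /derivable /derive E.
Qed.

Lemma is_derive_scale f x v c l :
  is_derive x v f l -> is_derive x (c *: v) f (c * l).
Proof.
move=> /is_deriveP H; apply/is_deriveP => e e0.
have [d d0 dP] := H (e / (`|c| + 1)) ltac:(by rewrite divr_gt0 // ltr_wpDl).
exists (d / (`|c| + 1)); first by rewrite divr_gt0 // ltr_wpDl.
have c1 : 0 < `|c| + 1 by rewrite ltr_wpDl.
move=> h hd; rewrite scalerA mulrA.
have hc : `|h * c| <= `|h| * (`|c| + 1) by rewrite normrM ler_wpM2l // lerDl.
apply: (le_trans (dP (h * c) _)).
  by rewrite (le_lt_trans hc) // -ltr_pdivlMr.
by rewrite mulrAC ler_pdivrMr // -mulrA ler_pM2l.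
Qed.

Lemma line_mvt f g x v :
  (forall t : R, 0 <= t <= 1 -> is_derive (x + t *: v) v f (g (x + t *: v))) ->
  exists2 t : R, 0 <= t <= 1 & f (x + v) - f x = g (x + t *: v).
Proof.
move=> H; pose phi := fun s : R => f (x + s *: v).
have dphi (t : R) : 0 <= t <= 1 -> is_derive t 1 phi (g (x + t *: v)).
  by move=> t01; apply/is_derive_line; apply: H.
have [| |c] := @MVT_segment R phi (fun t => g (x + t *: v)) 0 1 ler01.
- by move=> t; rewrite in_itv /= => /andP[t0 t1]; apply: dphi; rewrite !ltW.
- apply/continuous_in_subspaceT => t; rewrite inE /= in_itv /= => t01.
  apply: differentiable_continuous; apply/derivable1_diffP.
  by case: (dphi t t01).
by rewrite in_itv /= /phi scale1r scale0r addr0 subr0 mulr1 => c01 E; exists c.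
Qed.

Lemma line_mvt_scale f g x v h :
  (forall t : R, 0 <= t <= 1 -> is_derive (x + (t * h) *: v) v f (g (x + (t * h) *: v))) ->
  exists2 t : R, 0 <= t <= 1 & f (x + h *: v) - f x = h * g (x + (t * h) *: v).
Proof.
move=> H.
have [|t t01 E] := @line_mvt f (fun y => h * g y) x (h *: v).
  by move=> t t01; rewrite scalerA; apply/is_derive_scale/H.
by exists t => //; rewrite E scalerA.
Qed.

(** Go from [x] along [v], then along [w]: differentiability at [x] handles the first step, the mean
    value theorem and the continuity of [gw] the second. *)
Lemma is_derive_add f gv gw D x v w (r : R) :
  0 < r ->
  (forall s t, `|s| < r -> `|t| < r -> D (x + s *: v + t *: w)) ->
  (forall y, D y -> is_derive y w f (gw y)) ->
  is_derive x v f (gv x) -> continuous_in D gw x ->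
  is_derive x (v + w) f (gv x + gw x).
Proof.
move=> r0 HD Hw /is_deriveP Hv cw; apply/is_deriveP => e e0.
have [d1 d10 H1] := Hv (e / 2) ltac:(by rewrite divr_gt0).
have [d2 d20 H2] := cw (e / 2) ltac:(by rewrite divr_gt0).
have M0 : 0 < `|v| + `|w| + 1 by rewrite ltr_wpDl // addr_ge0.
exists (Num.min r (Num.min d1 (d2 / (`|v| + `|w| + 1)))).
  by rewrite !lt_min r0 d10 divr_gt0.
move=> h; rewrite !lt_min => /and3P[hr hd1 hd2].
have [|t /andP[t0 t1] E] := @line_mvt_scale f gw (x + h *: v) w h.
  move=> t /andP[t0 t1]; apply: Hw; apply: HD => //.
  by rewrite normrM (ger0_norm t0) (le_lt_trans _ hr) // ler_piMl.
have -> : f (x + h *: (v + w)) - f x - h * (gv x + gw x) =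
  (f (x + h *: v) - f x - h * gv x) +
  h * (gw (x + h *: v + (t * h) *: w) - gw x).
  by rewrite mulrBr -E scalerDr addrA; ring.
apply: (le_trans (ler_normD _ _)).
have -> : e * `|h| = e / 2 * `|h| + `|h| * (e / 2) by field.
apply: lerD; first exact: H1.
rewrite normrM ler_wpM2l //; apply/ltW/H2.
  apply: HD => //; rewrite normrM (ger0_norm t0) (le_lt_trans _ hr) // ler_piMl //.
rewrite -(addrA x) (addrAC x) subrr add0r; apply: (le_lt_trans (ler_normD _ _)).
rewrite !normrZ ?normrM (ger0_norm t0).
apply: (@le_lt_trans _ _ (`|h| * (`|v| + `|w| + 1))); last by rewrite -ltr_pdivlMr.
rewrite -addrA !mulrDr lerD2l mulr1 -[leLHS]addr0 lerD //.
by rewrite ler_wpM2r // ler_piMl.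
Qed.

(* The derivative extends to a boundary point [x] of [U] along the directions
   that keep [U] invariant: pass to the limit in the mean value theorem. *)
Lemma is_derive_boundary f g U D x v :
  U `<=` D -> D x -> closure U x ->
  (forall y t, U y -> U (y + t *: v)) -> (forall y t, D y -> D (y + t *: v)) ->
  (forall y, U y -> is_derive y v f (g y)) ->
  (forall y, D y -> continuous_in D f y) -> continuous_in D g x ->
  is_derive x v f (g x).
Proof.
move=> UD Dx clx Uv Dv Hd cf cg; apply/is_deriveP => e e0.
have [d d0 H] := cg e e0.
have v1 : 0 < `|v| + 1 by rewrite ltr_wpDl.
exists (d / 2 / (`|v| + 1)); first by rewrite !divr_gt0.
move=> h; rewrite ltr_pdivlMr // => hd.
apply/ler_addgt0Pr => eta eta0.
have h1 : 0 < `|h| + 1 by rewrite ltr_wpDl.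
have [d1 d10 H1] := cf _ Dx (eta / 2) ltac:(by rewrite divr_gt0).
have [d2 d20 H2] := cf _ (Dv _ h Dx) (eta / 2) ltac:(by rewrite divr_gt0).
pose d3 := Num.min (d / 2) (Num.min d1 d2).
have d30 : 0 < d3 by rewrite !lt_min divr_gt0 // d10.
have [y [Uy]] := clx (ball x d3) (nbhsx_ballx x d3 d30).
rewrite -ball_normE /= distrC !lt_min => /and3P[yd y1 y2].
have [|t /andP[t0 t1] E] := @line_mvt_scale f g y v h.
  by move=> t _; apply: Hd; apply: Uv.
have -> : f (x + h *: v) - f x - h * g x =
  h * (g (y + (t * h) *: v) - g x)
  + ((f y - f x) - (f (y + h *: v) - f (x + h *: v))).
  by rewrite mulrBr -E; ring.
apply: (le_trans (ler_normD _ _)); apply: lerD.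
  rewrite normrM mulrC ler_wpM2r //; apply/ltW/H; first exact/UD/Uv.
  have -> : y + (t * h) *: v - x = (y - x) + (t * h) *: v by rewrite addrAC.
  apply: (le_lt_trans (ler_normD _ _)); rewrite (splitr d) ltr_leD //.
  rewrite normrZ ?normrM (ger0_norm t0); apply: (le_trans _ (ltW hd)).
  by apply: ler_pM; rewrite ?mulr_ge0 ?lerDl // ler_piMl.
apply: (le_trans (ler_normB _ _)); rewrite (splitr eta); apply/lerD; apply/ltW.
  exact/H1/y1/UD.
apply: H2; first exact/Dv/UD.
by rewrite opprD addrACA subrr addr0.
Qed.

Lemma is_derive_ext_near f g x v l (r : R) : 0 < r ->
  (forall t, `|t| < r -> f (x + t *: v) = g (x + t *: v)) ->
  is_derive x v f l -> is_derive x v g l.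
Proof.
move=> r0 fg /is_deriveP H; apply/is_deriveP => e e0.
have [d d0 dP] := H e e0.
exists (Num.min r d) => [|h]; first by rewrite lt_min r0.
rewrite lt_min => /andP[hr hd].
have := fg 0; rewrite normr0 scale0r addr0 => /(_ r0) <-.
by rewrite -fg //; apply: dP.
Qed.

End LineCalculus.

(** * Functions of class C^k: relative continuity, choice of derivatives, Schwarz's theorem *)

Section ClassC.
Context {R : realType} {V : normedModType R}.
Implicit Types (f g : V -> R) (x v w : V) (W D U : set V).

Lemma continuous_inD D f g x : continuous_in D f x -> continuous_in D g x ->
  continuous_in D (fun y => f y + g y) x.
Proof.
move=> cf cg e e0.
have [d1 d10 H1] := cf (e / 2) ltac:(by rewrite divr_gt0).
have [d2 d20 H2] := cg (e / 2) ltac:(by rewrite divr_gt0).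
exists (Num.min d1 d2) => [|y Dy]; first by rewrite lt_min d10.
rewrite lt_min => /andP[y1 y2]; rewrite opprD addrACA (splitr e).
by rewrite (le_lt_trans (ler_normD _ _)) // ltrD ?H1 ?H2.
Qed.

Lemma continuous_inZ D f x c : continuous_in D f x ->
  continuous_in D (fun y => c * f y) x.
Proof.
move=> cf e e0; have c1 : 0 < `|c| + 1 by rewrite ltr_wpDl.
have [d1 d10 H1] := cf (e / (`|c| + 1)) ltac:(by rewrite divr_gt0).
exists d1 => // y Dy yd; rewrite -mulrBr normrM.
have := H1 y Dy yd; rewrite ltr_pdivlMr // => H.
by apply: le_lt_trans H; rewrite mulrC ler_wpM2l // lerDl.
Qed.

Lemma continuous_in_eq U D f g x : U `<=` D -> closure U x ->
  continuous_in D f x -> continuous_in D g x -> {in U, f =1 g} -> f x = g x.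
Proof.
move=> UD clx cf cg fg; apply/eqP; rewrite -subr_eq0 -normr_le0.
apply/ler_addgt0Pr => e e0; rewrite add0r.
have [d1 d10 H1] := cf (e / 2) ltac:(by rewrite divr_gt0).
have [d2 d20 H2] := cg (e / 2) ltac:(by rewrite divr_gt0).
have d0 : 0 < Num.min d1 d2 by rewrite lt_min d10.
have [y [Uy]] := clx _ (nbhsx_ballx x _ d0).
rewrite -ball_normE /= distrC lt_min => /andP[y1 y2].
have Dy := UD _ Uy; have fgy := fg y (mem_set Uy).
have -> : f x - g x = (g y - g x) - (f y - f x) by rewrite fgy; ring.
rewrite (le_trans (ler_normB _ _)) // (splitr e) ltW // ltrD ?H1 ?H2 //.
Qed.

(** Choice turns the derivatives, given separately for each direction, into one function of
    direction and point; the value outside [W] is the default 0. *)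
Lemma classC1_deriv W U D f : classC W U D 1 f ->
  exists G : V -> V -> R, forall v, W v ->
    (forall x, U x -> is_derive x v f (G v x)) /\
    (forall x, D x -> continuous_in D (G v) x).
Proof.
move=> [_ H].
have H' v : exists g, W v -> (forall x, U x -> is_derive x v f (g x)) /\
    (forall x, D x -> continuous_in D g x).
  have [Wv|nWv] := pselect (W v); last by exists (fun=> 0).
  have [g [dg [cg _]]] := H v Wv.
  by exists g => _; split => //; apply: within_continuous_in.
by have [G GP] := choice H'; exists G.
Qed.

Lemma classC2_deriv U D f : classC setT U D 2 f ->
  exists G : V -> V -> R, exists G2 : V -> V -> V -> R, forall v,
    [/\ (forall x, U x -> is_derive x v f (G v x)),
        (forall x, D x -> continuous_in D (G v) x) &
        forall w, (forall x, U x -> is_derive x w (G v) (G2 v w x)) /\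
          (forall x, D x -> continuous_in D (G2 v w) x)].
Proof.
move=> [_ H].
have H' v : exists gg : (V -> R) * (V -> V -> R),
    [/\ (forall x, U x -> is_derive x v f (gg.1 x)),
        (forall x, D x -> continuous_in D gg.1 x) &
        forall w, (forall x, U x -> is_derive x w gg.1 (gg.2 w x)) /\
          (forall x, D x -> continuous_in D (gg.2 w) x)].
  have [g [dg cg]] := H v I.
  have [g2 g2P] := classC1_deriv cg; exists (g, g2); split => //=.
  - by case: cg => cg _; apply: within_continuous_in.
  - by move=> w; apply: g2P.
have [G GP] := choice H'.
by exists (fun v => (G v).1), (fun v => (G v).2).
Qed.

Lemma is_derive_shift f x v a l :
  is_derive (x + a) v f l -> is_derive x v (fun y => f (y + a)) l.
Proof.
move=> /is_deriveP H; apply/is_deriveP => e e0.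
have [d d0 dP] := H e e0; exists d => // h hd.
by rewrite /= (addrAC x); apply: dP.
Qed.

(** The mean value theorem is used twice: along [v] for [f (y + h *: w) - f y], then along [w] for
    [gv]. *)
Lemma second_difference f gv gvw U x v w (r : R) : 0 < r ->
  (forall s t, `|s| < r -> `|t| < r -> U (x + s *: v + t *: w)) ->
  (forall y, U y -> is_derive y v f (gv y)) ->
  (forall y, U y -> is_derive y w gv (gvw y)) ->
  continuous_in U gvw x ->
  forall e, 0 < e -> exists2 d, 0 < d & forall h, `|h| < d ->
   `|f (x + h *: v + h *: w) - f (x + h *: v) - (f (x + h *: w) - f x)
      - h ^+ 2 * gvw x| <= e * h ^+ 2.
Proof.
move=> r0 HU dv dvw cg e e0.
have [d2 d20 H2] := cg e e0.
have M0 : 0 < `|v| + `|w| + 1 by rewrite ltr_wpDl // addr_ge0.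
exists (Num.min r (d2 / (`|v| + `|w| + 1))).
  by rewrite !lt_min r0 divr_gt0.
move=> h; rewrite lt_min => /andP[hr hd].
have tr (t : R) : 0 <= t <= 1 -> `|t * h| < r.
  by case/andP=> t0 t1; rewrite normrM (ger0_norm t0) (le_lt_trans _ hr) // ler_piMl.
have Ux (t : R) : 0 <= t <= 1 -> U (x + (t * h) *: v).
  move=> t01; have := HU (t * h) 0 (tr _ t01); rewrite scale0r addr0; apply.
  by rewrite normr0.
have Uxw (t : R) : 0 <= t <= 1 -> U (x + (t * h) *: v + h *: w).
  by move=> t01; apply: HU => //; apply: tr.
have [|t t01 E] := @line_mvt_scale _ _ (fun y => f (y + h *: w) - f y)
  (fun y => gv (y + h *: w) - gv y) x v h.
  move=> t t01.
  have := dv _ (Uxw t t01) => /is_derive_shift D1.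
  exact: (is_deriveB D1 (dv _ (Ux t t01))).
have [|s s01 E2] := @line_mvt_scale _ _ gv gvw (x + (t * h) *: v) w h.
  by move=> s s01; apply/dvw/HU; apply: tr.
have := E; rewrite E2 => ->.
have -> (a b : R) : h * (h * a) - h ^+ 2 * b = h ^+ 2 * (a - b) by ring.
rewrite normrM ger0_norm ?sqr_ge0 // mulrC ler_wpM2r ?sqr_ge0 //.
apply/ltW/H2; first by apply: HU; apply: tr.
rewrite -(addrA x) (addrAC x) subrr add0r; apply: (le_lt_trans (ler_normD _ _)).
rewrite !normrZ; apply: (@le_lt_trans _ _ (`|h| * (`|v| + `|w| + 1)));
  last by rewrite -ltr_pdivlMr.
case/andP: t01 => t0 t1; case/andP: s01 => s0 s1.
rewrite ?normrM (ger0_norm t0) (ger0_norm s0).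
rewrite -addrA !mulrDr mulr1 lerD //; first by rewrite ler_wpM2r // ler_piMl.
by rewrite -[leLHS]addr0 lerD // ler_wpM2r // ler_piMl.
Qed.

(** The second difference does not change when [v] and [w] are exchanged, so both mixed derivatives
    are limits of the same quotient. *)
Lemma schwarz f gv gw gvw gwv U x v w (r : R) : 0 < r ->
  (forall s t, `|s| < r -> `|t| < r -> U (x + s *: v + t *: w)) ->
  (forall y, U y -> is_derive y v f (gv y)) ->
  (forall y, U y -> is_derive y w f (gw y)) ->
  (forall y, U y -> is_derive y w gv (gvw y)) ->
  (forall y, U y -> is_derive y v gw (gwv y)) ->
  continuous_in U gvw x -> continuous_in U gwv x -> gvw x = gwv x.
Proof.
move=> r0 HU dv dw dvw dwv c1 c2; apply/eqP; rewrite -subr_eq0 -normr_le0.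
apply/ler_addgt0Pr => e e0; rewrite add0r.
have [d1 d10 H1] := second_difference r0 HU dv dvw c1
  (e := e / 2) ltac:(by rewrite divr_gt0).
have HU' s t : `|s| < r -> `|t| < r -> U (x + s *: w + t *: v).
  by move=> sr tr; rewrite addrAC; apply: HU.
have [d2 d20 H2] := second_difference r0 HU' dw dwv c2
  (e := e / 2) ltac:(by rewrite divr_gt0).
pose h := Num.min d1 d2 / 2.
have m0 : 0 < Num.min d1 d2 by rewrite lt_min d10.
have h0 : 0 < h by rewrite divr_gt0.
have hm : h < Num.min d1 d2 by rewrite /h ltr_pdivrMr // ltr_pMr // ltr1n.
have hn1 : `|h| < d1 by rewrite gtr0_norm // (lt_le_trans hm) // ge_min lexx.
have hn2 : `|h| < d2 by rewrite gtr0_norm // (lt_le_trans hm) // ge_min lexx orbT.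
have {}H1 := H1 h hn1; have {}H2 := H2 h hn2.
have h20 : 0 < h ^+ 2 by rewrite exprn_gt0.
rewrite -(ler_pM2l h20) -{1}(gtr0_norm h20) -normrM.
set a := f (x + h *: v + h *: w) in H1; set b := f (x + h *: v) in H1.
set c := f (x + h *: w) in H1.
move: H2; rewrite (addrAC x) -/a -/b -/c => H2.
have -> : h ^+ 2 * (gvw x - gwv x) =
  (a - c - (b - f x) - h ^+ 2 * gwv x) - (a - b - (c - f x) - h ^+ 2 * gvw x).
  by ring.
rewrite (le_trans (ler_normB _ _)) //.
have -> : h ^+ 2 * e = e / 2 * h ^+ 2 + e / 2 * h ^+ 2 by field.
exact: lerD.
Qed.

End ClassC.

(** The second derivative is given at 0 only. If [m] were negative, [phi1] would be negative just to
    the right of 0, and the mean value theorem would give a value of [phi] below [phi 0]. *)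
Lemma interior_min_test {R : realType} (phi phi1 : R -> R) (m r : R) : 0 < r ->
  (forall t : R, `|t| < r -> is_derive t (1 : R) phi (phi1 t)) ->
  is_derive (0 : R) (1 : R) phi1 m -> (forall t : R, `|t| < r -> phi 0 <= phi t) ->
  phi1 0 = 0 /\ 0 <= m.
Proof.
move=> r0 d1 d2 pmin.
have z : phi1 0 = 0.
  have := @derive1_at_min R phi (- r) r 0.
  case=> [|t|||_ D0].
  - by rewrite ge0_cp ?ltW.
  - by rewrite in_itv /= => tr; case: (d1 t); rewrite ?ltr_norml.
  - by rewrite in_itv /= oppr_lt0 r0.
  - by move=> t; rewrite in_itv /= => tr; apply: pmin; rewrite ltr_norml.
  - by have [_ <-] := d1 0 (ltac:(by rewrite normr0)).
split=> //; rewrite leNgt; apply/negP => m0.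
have [d d0 H] := (is_deriveP _ _ _ _).1 d2 (- m / 2)
  (ltac:(by rewrite divr_gt0 // oppr_gt0)).
pose h := Num.min r d / 2.
have mi0 : 0 < Num.min r d by rewrite lt_min r0.
have h0 : 0 < h by rewrite divr_gt0.
have : h < Num.min r d by rewrite /h ltr_pdivrMr // ltr_pMr // ltr1n.
rewrite lt_min => /andP[hr hd].
have neg t : 0 < t -> t <= h -> phi1 t < 0.
  move=> t0 th; have td : `|t| < d by rewrite gtr0_norm // (le_lt_trans th).
  have := H t td; rewrite add0r /GRing.scale /= mulr1 z subr0.
  rewrite (gtr0_norm t0) ler_norml => /andP[_].
  rewrite lerBlDr => /le_lt_trans; apply.
  by rewrite mulrC -mulrDr pmulr_rlt0 //; lra.
have [||c] := @MVT R phi phi1 0 h h0.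
- move=> t; rewrite in_itv /= => /andP[t0 th]; apply: d1.
  by rewrite gtr0_norm // (lt_trans th).
- apply/continuous_in_subspaceT => t; rewrite inE /= in_itv /= => /andP[t0 th].
  apply: differentiable_continuous; apply/derivable1_diffP.
  by case: (d1 t); rewrite ?ger0_norm // (le_lt_trans th).
rewrite in_itv /= subr0 => /andP[c0 ch] E.
have := pmin h; rewrite gtr0_norm // => /(_ hr).
rewrite -subr_ge0 E; apply/negP; rewrite -ltNge.
by rewrite pmulr_llt0 // neg // ltW.
Qed.

(** * Euclidean geometry against the sup norm, and reflections *)

Section Euclidean.
Context {R : realType} {n : nat}.
Local Notation T := 'rV[R]_n.+1.
Implicit Types (x y z v w : T) (l r : R).

Lemma dotpC x y : dotp x y = dotp y x.
Proof. by apply: eq_bigr => i _; rewrite mulrC. Qed.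

Lemma dotpDl x y z : dotp (x + y) z = dotp x z + dotp y z.
Proof. by rewrite -big_split; apply: eq_bigr => i _; rewrite mxE mulrDl. Qed.

Lemma dotpZl (a : R) x y : dotp (a *: x) y = a * dotp x y.
Proof. by rewrite mulr_sumr; apply: eq_bigr => i _; rewrite mxE mulrA. Qed.

Lemma dotpDr x y z : dotp z (x + y) = dotp z x + dotp z y.
Proof. by rewrite dotpC dotpDl !(dotpC z). Qed.

Lemma dotpZr (a : R) x y : dotp y (a *: x) = a * dotp y x.
Proof. by rewrite dotpC dotpZl dotpC. Qed.

Lemma dotpNl x y : dotp (- x) y = - dotp x y.
Proof. by rewrite -scaleN1r dotpZl mulN1r. Qed.

Lemma dotpNr x y : dotp x (- y) = - dotp x y.
Proof. by rewrite dotpC dotpNl dotpC. Qed.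

Lemma dotp0l x : dotp 0 x = 0.
Proof. by rewrite -(scale0r x) dotpZl mul0r. Qed.

Lemma dotp0r x : dotp x 0 = 0.
Proof. by rewrite dotpC dotp0l. Qed.

Lemma dotp_ge0 x : 0 <= dotp x x.
Proof. by apply: sumr_ge0 => i _; rewrite -expr2 sqr_ge0. Qed.

Lemma dotp_eq0 x : dotp x x = 0 -> x = 0.
Proof.
move=> /eqP; rewrite psumr_eq0 => [/allP H|i _]; last by rewrite -expr2 sqr_ge0.
apply/rowP => i; rewrite mxE; have := H i (mem_index_enum _).
by rewrite mulf_eq0 orbb => /eqP.
Qed.

Lemma dotp_gt0 x : x != 0 -> 0 < dotp x x.
Proof.
by move=> x0; rewrite lt_def dotp_ge0 andbT; apply: contraNneq x0 => /dotp_eq0 ->.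
Qed.

Lemma coord_le_norm m (x : 'M[R]_(m, n.+1)) i j : `|x i j| <= `|x|.
Proof.
rewrite [leRHS]/Num.norm /= mx_normrE.
by apply: (le_bigmax _ (fun ij => `|x ij.1 ij.2|) (i, j)).
Qed.

Lemma norm_ltP (x : T) e : 0 < e -> (forall i, `|x 0 i| < e) -> `|x| < e.
Proof.
move=> e0 H; rewrite [ltLHS]/Num.norm /= mx_normrE; apply/bigmax_ltP; split=> //.
by move=> [i j] _ /=; rewrite (ord1 i).
Qed.

Lemma norm_leP (y : T) B : 0 <= B -> (forall i, `|y 0 i| <= B) -> `|y| <= B.
Proof.
move=> B0 H; apply/ler_addgt0Pr => e e0; apply/ltW/norm_ltP => [|i].
  by rewrite ltr_wpDl.
by rewrite (le_lt_trans (H i)) // ltrDl.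
Qed.

Lemma norm_delta i : `|delta_mx 0 i : T| <= 1.
Proof.
apply: norm_leP => // k; rewrite mxE eqxx /=.
by case: eqP => _; rewrite ?normr1 ?normr0.
Qed.

Lemma dotp_delta x i : dotp (delta_mx 0 i) x = x 0 i.
Proof.
rewrite /dotp (bigD1 i) //= mxE !eqxx mul1r big1 ?addr0 // => j ji.
by rewrite mxE eqxx (negbTE ji) mul0r.
Qed.

(** Together with [norm_sqr_le] this compares Euclidean balls with the sup-norm radii of the
    library, at the cost of the dimension. *)
Lemma dotp_norm_le x y : `|dotp x y| <= n.+1%:R * (`|x| * `|y|).
Proof.
rewrite (le_trans (ler_norm_sum _ _ _)) //.
rewrite mulr_natl -[X in _ *+ X]card_ord -sumr_const.
by apply: ler_sum => i _; rewrite normrM ler_pM // coord_le_norm.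
Qed.

Lemma norm_sqr_le x : `|x| ^+ 2 <= dotp x x.
Proof.
have [->|x0] := eqVneq x 0; first by rewrite normr0 expr0n dotp_ge0.
have H i : `|x 0 i| ^+ 2 <= dotp x x.
  rewrite /dotp (bigD1 i) //= -normrX ger0_norm ?sqr_ge0 // -expr2 lerDl.
  by apply: sumr_ge0 => j _; rewrite -expr2 sqr_ge0.
rewrite -(@ler_sqrt _ _ _ (dotp_ge0 x)) sqrtr_sqr ger0_norm //.
apply/ler_addgt0Pr => e e0; apply: ltW; apply: norm_ltP => [|i].
  by rewrite ltr_wpDl // sqrtr_ge0.
rewrite (@le_lt_trans _ _ (Num.sqrt (dotp x x))) ?ltrDl //.
by rewrite -[leLHS]ger0_norm // -sqrtr_sqr ler_sqrt ?dotp_ge0.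
Qed.

Lemma oballE r x : 0 < r -> oball r x <-> dotp x x < r ^+ 2.
Proof.
move=> r0; rewrite /oball /enorm /=.
by rewrite -{1}(gtr0_norm r0) -sqrtr_sqr ltr_sqrt // exprn_gt0.
Qed.

Lemma cballE r x : 0 < r -> cball r x <-> dotp x x <= r ^+ 2.
Proof.
move=> r0; rewrite /cball /enorm /=.
by rewrite -{1}(gtr0_norm r0) -sqrtr_sqr ler_sqrt // ltW // exprn_gt0.
Qed.

Lemma esphereE r x : 0 < r -> esphere r x <-> dotp x x = r ^+ 2.
Proof.
move=> r0; rewrite /esphere /enorm /=; split=> [<-|->].
  by rewrite sqr_sqrtr // dotp_ge0.
by rewrite sqrtr_sqr gtr0_norm.
Qed.

Lemma continuous_coord i : continuous (fun x : T => x 0 i).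
Proof. exact: coord_continuous. Qed.

Lemma continuous_sqnorm : continuous (fun x : T => dotp x x).
Proof.
apply: continuous_big => [|i _ x]; first exact: add_continuous.
exact: (continuousM (@continuous_coord i x) (@continuous_coord i x)).
Qed.

Lemma closed_coord_ge i a : closed [set x : T | a <= x 0 i].
Proof.
apply: (@preimage_closed _ _ (fun x : T => x 0 i) [set y | a <= y]).
  by move=> x _; apply: continuous_coord.
exact: closed_ge.
Qed.

Lemma closed_coord_le i a : closed [set x : T | x 0 i <= a].
Proof.
apply: (@preimage_closed _ _ (fun x : T => x 0 i) [set y | y <= a]).
  by move=> x _; apply: continuous_coord.
exact: closed_le.
Qed.

Lemma compact_cball : compact (cball 1 : set T).
Proof.
apply: bounded_closed_compact.
  exists 1; split=> // M M1 x /cballE /= xb; apply: le_trans (ltW M1).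
  rewrite -(@ler_pXn2r _ 2) ?nnegrE //.
  by apply: le_trans (norm_sqr_le x) _; apply: xb.
have -> : cball 1 = (fun x : T => dotp x x) @^-1` [set y | y <= 1].
  by apply/seteqP; split => x; rewrite cballE // expr1n.
apply: preimage_closed; first by move=> x _; apply: continuous_sqnorm.
exact: closed_le.
Qed.

Lemma open_punctured : open (oball 1 `\ (0 : T)).
Proof.
rewrite setDE; apply: openI; last first.
  apply: closed_openC; apply: accessible_closed_set1; apply: hausdorff_accessible.
  exact: norm_hausdorff.
have -> : oball 1 = (fun x : T => dotp x x) @^-1` [set y | y < 1].
  by apply/seteqP; split => x; rewrite oballE // expr1n.
by apply: open_comp; [move=> x _; apply: continuous_sqnorm | exact: open_lt].
Qed.

Lemma open_ballP (A : set T) x : open A -> A x ->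
  exists2 r, 0 < r & forall y, `|y - x| < r -> A y.
Proof.
move=> oA Ax; have /nbhs_ballP[r r0 H] : nbhs x A by exact: open_nbhs_nbhs.
by exists r => // y yx; apply: H; rewrite -ball_normE /= distrC.
Qed.

Lemma oball_cball1 : oball 1 `<=` (cball 1 : set T).
Proof. by move=> x; rewrite /oball /cball /= => /ltW. Qed.

(** Shrinking by [1 - d] with [0 < d <= 1/2] enters the open ball without reaching the origin. *)
Lemma closure_punctured (x : T) : (cball 1 `\ 0) x -> closure (oball 1 `\ 0) x.
Proof.
move=> [/cballE /= xb x0] A /nbhs_ballP[r /= r0 H].
have {}xb := xb ltr01; rewrite expr1n in xb.
have {}x0 : x != 0 by apply/eqP => x0'; apply: x0.
have nx : 0 < `|x| by rewrite normr_gt0.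
pose d := Num.min 2^-1 (r / `|x| / 2).
have rx : 0 < r / `|x| by rewrite divr_gt0.
have d0 : 0 < d by rewrite lt_min invr_gt0 ltr0n divr_gt0.
have d1 : d < 1 by rewrite gt_min invf_lt1 ?ltr1n.
have dr : d < r / `|x|.
  by rewrite gt_min; apply/orP; right; rewrite ltr_pdivrMr // ltr_pMr // ltr1n.
exists ((1 - d) *: x); split.
  split.
    apply/oballE => //; rewrite dotpZl dotpZr expr1n.
    have := dotp_gt0 x0; set q := dotp x x in xb * => q0.
    have : (1 - d) * (1 - d) < 1 by nra.
    nra.
  by move=> /eqP; rewrite scaler_eq0 (negbTE x0) orbF subr_eq0 gt_eqF.
apply: H; rewrite -ball_normE /= scalerBl scale1r opprB addrC subrK.
by rewrite normrZ gtr0_norm // -ltr_pdivlMr.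
Qed.

Definition refl l x : T := set_fstc x (2 * l - fstc x).

Lemma reflE l x i : refl l x 0 i = if i == ord0 then 2 * l - x 0 ord0 else x 0 i.
Proof. by rewrite mxE. Qed.

Lemma hatvE x i : hatv x 0 i = if i == ord0 then - x 0 ord0 else x 0 i.
Proof. by rewrite mxE. Qed.

Lemma reflK l : involutive (refl l).
Proof.
move=> x; apply/rowP => i; rewrite !reflE eqxx.
by case: eqP => [->|//]; ring.
Qed.

Lemma hatvK : involutive (@hatv R n).
Proof.
move=> x; apply/rowP => i; rewrite !hatvE eqxx opprK.
by case: eqP => [->|].
Qed.

Lemma dotp_hatv x y : dotp (hatv x) (hatv y) = dotp x y.
Proof.
apply: eq_bigr => i _; rewrite !hatvE; case: eqP => [->|//].
by rewrite mulrNN.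
Qed.

Lemma hatvD x y : hatv (x + y) = hatv x + hatv y.
Proof. by apply/rowP => i; rewrite [RHS]mxE !hatvE !mxE; case: eqP => // _; rewrite opprD. Qed.

Lemma hatvZ (a : R) x : hatv (a *: x) = a *: hatv x.
Proof. by apply/rowP => i; rewrite [RHS]mxE !hatvE !mxE; case: eqP => // _; rewrite mulrN. Qed.

Lemma reflD l x y : refl l (x + y) = refl l x + hatv y.
Proof.
apply/rowP => i; rewrite [RHS]mxE !reflE !hatvE !mxE.
by case: eqP => // _; ring.
Qed.

Lemma norm_hatv x : `|hatv x| = `|x|.
Proof.
suff H y : `|hatv y| <= `|y| by apply/le_anti; rewrite H -{1}(hatvK x) H.
apply/ler_addgt0Pr => e e0; apply/ltW/norm_ltP => [|i].
  by rewrite ltr_wpDl.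
rewrite hatvE (@le_lt_trans _ _ `|y|) ?ltrDl //.
by case: ifP => _; rewrite ?normrN coord_le_norm.
Qed.

(** For [l > 0] and [x_1 > l] the subtracted term is positive: the reflection brings the cap closer
    to the origin, hence keeps it in the ball. *)
Lemma dotp_refl l x :
  dotp (refl l x) (refl l x) = dotp x x - 4 * l * (x 0 ord0 - l).
Proof.
rewrite /dotp (bigD1 ord0) //= [X in _ = X - _](bigD1 ord0) //= reflE eqxx.
rewrite (eq_bigr (fun i => x 0 i * x 0 i)); first by ring.
by move=> i i0; rewrite reflE (negbTE i0).
Qed.

Definition pole l : T := (2 * l) *: delta_mx 0 ord0.

Lemma poleE l i : pole l 0 i = if i == ord0 then 2 * l else 0.
Proof.
by rewrite !mxE eqxx /=; case: eqP => _; rewrite ?mulr1 ?mulr0.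
Qed.

Lemma refl_pole l : refl l (pole l) = 0.
Proof. by apply/rowP => i; rewrite reflE !poleE eqxx mxE subrr; case: eqP. Qed.

Lemma refl_eq0 l x : (refl l x == 0) = (x == pole l).
Proof.
apply/eqP/eqP => [H|->]; last exact: refl_pole.
have refl0 : refl l 0 = pole l.
  by apply/rowP => i; rewrite reflE poleE mxE subr0; case: eqP; rewrite ?mxE.
by rewrite -(reflK l x) H refl0.
Qed.

Lemma refl_pole_shift l y : refl l (pole l + y) = hatv y.
Proof. by rewrite reflD refl_pole add0r. Qed.

Lemma refl_fix x : refl (x 0 ord0) x = x.
Proof.
by apply/rowP => i; rewrite reflE; case: eqP => [->|//]; ring.
Qed.

(** Plane and point vary together, since continuity of the gap is needed while the plane moves. *)
Lemma refl_dist l l' x x' :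
  `|refl l x - refl l' x'| <= `|x - x'| + 2 * `|l - l'|.
Proof.
apply/ler_addgt0Pr => e e0; apply/ltW/norm_ltP => [|i].
  by rewrite ltr_wpDl // addr_ge0 // mulr_ge0.
have H i0 : `|x 0 i0 - x' 0 i0| <= `|x - x'|.
  by have := coord_le_norm (x - x') 0 i0; rewrite !mxE.
rewrite mxE [X in _ + X]mxE !reflE; case: eqP => _.
  have -> : 2 * l - x 0 ord0 - (2 * l' - x' 0 ord0) =
    2 * (l - l') - (x 0 ord0 - x' 0 ord0) by ring.
  rewrite (le_lt_trans (ler_normB _ _)) // normrM (gtr0_norm (ltr0Sn _ 1)).
  by rewrite addrC -addrA ler_ltD ?H // ltrDl.
by rewrite (le_lt_trans (H i)) // -addrA ltrDl ltr_wpDl // mulr_ge0.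
Qed.

End Euclidean.

(** * Quadratic forms and rank-one decompositions *)

Section QuadraticForms.
Context {R : realType} {n : nat}.
Implicit Types (P M : 'M[R]_n.+1) (v w : 'rV[R]_n.+1).

Definition qf P w : R := \sum_i \sum_j w 0 i * w 0 j * P i j.

Lemma qfE P w : (w *m P *m w^T) 0 0 = qf P w.
Proof.
rewrite mxE /qf exchange_big; apply: eq_bigr => j _.
rewrite mxE mulr_suml; apply: eq_bigr => i _; rewrite mxE; ring.
Qed.

Lemma qfD P M w : qf (P + M) w = qf P w + qf M w.
Proof.
rewrite -big_split; apply: eq_bigr => i _; rewrite -big_split.
by apply: eq_bigr => j _; rewrite mxE mulrDr.
Qed.

Lemma qfN P w : qf (- P) w = - qf P w.
Proof.
rewrite -sumrN; apply: eq_bigr => i _; rewrite -sumrN.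
by apply: eq_bigr => j _; rewrite mxE mulrN.
Qed.

Lemma qfZ c P w : qf (c *: P) w = c * qf P w.
Proof.
rewrite mulr_sumr; apply: eq_bigr => i _; rewrite mulr_sumr.
by apply: eq_bigr => j _; rewrite mxE; ring.
Qed.

Lemma qf_rank1 v w : qf (v^T *m v) w = dotp v w ^+ 2.
Proof.
rewrite expr2 /qf [in RHS]/dotp mulr_suml; apply: eq_bigr => i _.
rewrite mulr_sumr; apply: eq_bigr => j _.
by rewrite mxE big_ord1 mxE; ring.
Qed.

Lemma qf_1 w : qf 1%:M w = dotp w w.
Proof.
apply: eq_bigr => i _; rewrite (bigD1 i) //= big1 ?mxE ?eqxx ?addr0 ?mulr1 //.
by move=> j ji; rewrite mxE eq_sym (negbTE ji) mulr0.
Qed.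

Lemma symmP P : symm P <-> forall i j, P i j = P j i.
Proof.
rewrite /symm /= /symmetricmx qualifE /=; split=> [/eqP E i j|H].
  by rewrite {1}E !mxE expr0 mul1r.
by apply/eqP/matrixP => i j; rewrite !mxE expr0 mul1r.
Qed.

Lemma symmD P M : symm P -> symm M -> symm (P + M).
Proof. by move=> /symmP sP /symmP sM; apply/symmP => i j; rewrite !mxE sP sM. Qed.

Lemma symmZ c P : symm P -> symm (c *: P).
Proof. by move=> /symmP sP; apply/symmP => i j; rewrite !mxE sP. Qed.

Lemma symmN P : symm P -> symm (- P).
Proof. by move=> /symmP sP; apply/symmP => i j; rewrite !mxE sP. Qed.

Lemma symm_rank1 v : symm (v^T *m v).
Proof. by apply/symmP => i j; rewrite !mxE !big_ord1 !mxE mulrC. Qed.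

Lemma symm_1 : symm (1%:M : 'M[R]_n.+1).
Proof. by apply/symmP => i j; rewrite !mxE eq_sym. Qed.

Lemma symm0 : symm (0 : 'M[R]_n.+1).
Proof. by apply/symmP => i j; rewrite !mxE. Qed.

(** A quadratic polynomial in [t]; the elimination below obtains its signs from well-chosen [t]. *)
Lemma qf_shift P w k t : symm P ->
  qf P (w + t *: delta_mx 0 k) =
  qf P w + 2 * t * (\sum_i w 0 i * P i k) + t ^+ 2 * P k k.
Proof.
move=> /symmP sP.
have S (a : 'I_n.+1 -> R) : \sum_i delta_mx (0 : 'I_1) k 0 i * a i = a k.
  rewrite (bigD1 k) //= mxE !eqxx mul1r big1 ?addr0 // => i ik.
  by rewrite mxE eqxx (negbTE ik) mul0r.
transitivity (qf P w + t * (\sum_i w 0 i * \sum_j delta_mx (0:'I_1) k 0 j * P i j)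
  + t * (\sum_j delta_mx (0 : 'I_1) k 0 j * \sum_i w 0 i * P i j)
  + t ^+ 2 * \sum_i delta_mx (0 : 'I_1) k 0 i *
             \sum_j delta_mx (0 : 'I_1) k 0 j * P i j).
  rewrite /qf !mulr_sumr -!big_split; apply: eq_bigr => i _ /=.
  rewrite !mulr_sumr -!big_split; apply: eq_bigr => j _ /=.
  by rewrite !mxE (sP j i); ring.
rewrite !S; under eq_bigr do rewrite S.
by ring.
Qed.

(* Symmetric Gaussian elimination: subtracting the square of the first nonzero
   row clears it and keeps the form nonnegative. *)
Lemma psd_rank1_sum P : symm P -> (forall w, 0 <= qf P w) ->
  exists s : seq 'rV[R]_n.+1, P = \sum_(v <- s) v^T *m v.
Proof.
move=> sP pP.
(* Induction on the number [m] of rows not yet cleared: those of index below [n.+1 - m] vanish. *)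
suff H m : forall P, (m <= n.+1)%N -> symm P -> (forall w, 0 <= qf P w) ->
    (forall i j : 'I_n.+1, (i < n.+1 - m)%N -> P i j = 0) ->
    exists s : seq 'rV[R]_n.+1, P = \sum_(v <- s) v^T *m v.
  by apply: (H n.+1) => // i j; rewrite subnn.
elim: m => {P sP pP} [|m IH] P mn sP pP z.
  exists [::]; rewrite big_nil; apply/matrixP => i j.
  by rewrite z ?mxE // subn0 ltn_ord.
have kn : (n.+1 - m.+1 < n.+1)%N by rewrite subSS ltnS leq_subr.
pose k := Ordinal kn.
have ltk (i : 'I_n.+1) : (i < n.+1 - m)%N -> (i < k)%N \/ i = k.
  rewrite -[(n.+1 - m)%N]/(n.+1 - m)%N -(subnSK mn) ltnS leq_eqVlt.
  by move=> /orP[/eqP ik|]; [right; apply: val_inj|left].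
have c w t := pP (w + t *: delta_mx 0 k).
have {}c w t : 0 <= qf P w + 2 * t * (\sum_i w 0 i * P i k) + t ^+ 2 * P k k.
  by rewrite -qf_shift.
have /symmP sPE := sP.
(* A zero pivot forces its column to vanish: otherwise the polynomial is affine in [t] with nonzero
   slope, and the [t] used below gives it the value -1. *)
have [P0|P0] := eqVneq (P k k) 0.
  have r0 i : P i k = 0.
    have E : \sum_j (delta_mx 0 i : 'rV[R]_n.+1) 0 j * P j k = P i k.
      rewrite (bigD1 i) //= mxE !eqxx mul1r big1 ?addr0 // => j ji.
      by rewrite mxE eqxx (negbTE ji) mul0r.
    have C t := c (delta_mx 0 i) t; move: C; rewrite E P0.
    move: (qf P _) => q C; apply/eqP; apply/negP => /negP Pn.
    have := C (- (q + 1) / (2 * P i k)).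
    have -> : q + 2 * (- (q + 1) / (2 * P i k)) * P i k +
       (- (q + 1) / (2 * P i k)) ^+ 2 * 0 = -1 by field.
    by lra.
  apply: IH => // [|i j /ltk[ik|->]]; first exact: ltnW.
    exact: z.
  by rewrite sPE.
have Pk : 0 < P k k.
  rewrite lt_def P0 /=; have := c 0 1; rewrite big1 => [|i _]; last by rewrite mxE mul0r.
  rewrite /qf big1 ?mulr0 ?add0r ?expr1n ?mul1r // => i _.
  by rewrite big1 // => j _; rewrite mxE !mul0r.
pose v := (Num.sqrt (P k k))^-1 *: row k P.
have vv i j : (v^T *m v) i j = P i k * P j k / P k k.
  rewrite mxE big_ord1 !mxE (sPE k i) (sPE k j) mulrACA -invfM -expr2.
  by rewrite sqr_sqrtr ?ltW // mulrC.
have [||||s E] := IH (P - v^T *m v).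
- exact: ltnW.
- by apply: symmD => //; apply/symmN/symm_rank1.
- move=> w; rewrite qfD qfN qf_rank1.
  have -> : dotp v w ^+ 2 = (\sum_i w 0 i * P i k) ^+ 2 / P k k.
    have -> : dotp v w = (Num.sqrt (P k k))^-1 * \sum_i w 0 i * P i k.
      rewrite dotpZl; congr (_ * _); apply: eq_bigr => i _.
      by rewrite mxE sPE mulrC.
    by rewrite exprMn exprVn sqr_sqrtr ?ltW // mulrC.
  (* This [t] minimises the polynomial, and the minimum is the value of the form after the
     elimination. *)
  have := c w (- (\sum_i w 0 i * P i k) / P k k).
  by move: (\sum_i _) (qf P w) => a q; congr (0 <= _); field.
- move=> i j /ltk[ik|->].
    by rewrite 2!mxE vv (z i k ik) mul0r mul0r subr0 (z i j ik).
  by rewrite 2!mxE vv mulrAC mulfV // mul1r sPE subrr.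
by exists (v :: s); rewrite big_cons -E addrC subrK.
Qed.

(** The matrices on the right are the directions in which [sym_gradient] differentiates. *)
Lemma rank1_sum_basis v : v^T *m v =
  \sum_i \sum_j (v 0 i * v 0 j) *:
    (2^-1 *: (delta_mx i j + delta_mx j i)) :> 'M[R]_n.+1.
Proof.
have D (a b : 'I_n.+1) (f : 'I_n.+1 -> 'I_n.+1 -> R) :
    \sum_i \sum_j f i j * (delta_mx i j : 'M[R]_n.+1) a b = f a b.
  rewrite (bigD1 a) //= (bigD1 b) //= !mxE !eqxx mulr1 big1 => [|j jb].
    rewrite addr0 big1 ?addr0 // => i ia; rewrite big1 // => j _.
    by rewrite mxE eq_sym (negbTE ia) mulr0.
  by rewrite mxE eqxx eq_sym (negbTE jb) mulr0.
apply/matrixP => a b; rewrite mxE big_ord1 mxE summxE.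
transitivity (2^-1 * (\sum_i \sum_j v 0 i * v 0 j * (delta_mx i j : 'M[R]_n.+1) a b)
  + 2^-1 * (\sum_i \sum_j v 0 i * v 0 j * (delta_mx i j : 'M[R]_n.+1) b a)).
  by rewrite !D; field.
rewrite !mulr_sumr -big_split; apply: eq_bigr => i _ /=.
rewrite summxE !mulr_sumr -big_split; apply: eq_bigr => j _ /=.
by rewrite !mxE (andbC (a == j)); ring.
Qed.

End QuadraticForms.

(** * The operator: vertical derivatives and quantitative ellipticity *)

Section Operator.
Context {R : realType} {n : nat}.
Local Notation T := 'rV[R]_n.+1.
Local Notation M := 'M[R]_n.+1.
Local Notation J := (jet R n).
Local Notation Uj := (jets_over (oball 1 `\ (0 : T))).
Local Notation Dj := (jets_over (cball 1 `\ (0 : T))).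

Definition jvec (s : R) (p : T) (N : M) : J := (0, s, p, N).

(** Translation along these directions preserves [jets_over A] for every [A], so segments stay in
    the domain of [F] even over the unit sphere. *)
Definition vertical (v : J) := v.1.1.1 = 0 /\ symm v.2.

Lemma vertical_jvec s p N : symm N -> vertical (jvec s p N).
Proof. by []. Qed.

Lemma verticalD v w : vertical v -> vertical w -> vertical (v + w).
Proof.
move=> [v1 v2] [w1 w2]; split; last exact: symmD.
by rewrite -[LHS]/(v.1.1.1 + w.1.1.1) v1 w1 addr0.
Qed.

Lemma verticalZ c v : vertical v -> vertical (c *: v).
Proof.
move=> [v1 v2]; split; last exact: symmZ.
by rewrite -[LHS]/(c *: v.1.1.1) v1 scaler0.
Qed.

Lemma vertical_sum (I : Type) (r : seq I) (v : I -> J) :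
  (forall i, vertical (v i)) -> vertical (\sum_(i <- r) v i).
Proof.
move=> H; elim/big_ind : _ => //; last exact: verticalD.
by split=> //; apply: symm0.
Qed.

Lemma vertical_symm v : vertical v -> jets_over setT v.
Proof. by case. Qed.

Lemma jets_over_vertical (A : set T) z v t : vertical v ->
  jets_over A z -> jets_over A (z + t *: v).
Proof.
move=> [v1 v2] [z1 z2]; split; last exact/symmD/symmZ.
by rewrite -[X in A X]/(z.1.1.1 + t *: v.1.1.1) v1 scaler0 addr0.
Qed.

Lemma jet_norm_ltP (z : J) e : (`|z| < e) <->
  [/\ `|z.1.1.1| < e, `|z.1.1.2| < e, `|z.1.2| < e & `|z.2| < e].
Proof.
case: z => [[[x s] p] N]; rewrite !prod_normE /= !gt_max.
by split=> [/andP[/andP[/andP[-> ->] ->] ->]|[-> -> -> ->]].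
Qed.

Lemma closure_jets z : Dj z -> closure Uj z.
Proof.
case: z => [[[x s] p] N] [/= Dx sN] A /nbhs_ballP[e /= e0 eA].
have [y [Uy]] := closure_punctured Dx (nbhsx_ballx x e e0).
rewrite -ball_normE /= => xy; exists (y, s, p, N); split=> //; apply: eA.
rewrite -ball_normE /=; apply/jet_norm_ltP => /=.
by split=> //; rewrite subrr normr0.
Qed.

Lemma half_bound (a b : R) : - (a / 2) < b - a -> a / 2 <= b.
Proof. by lra. Qed.

Lemma sum_bound (A B a b c : R) : a + b + c <= A ->
  B - A <= - a + - b + (B + - c).
Proof. by lra. Qed.

Lemma coefficient_bound (s p c a b d : R) : 0 <= s -> 0 <= p -> 0 <= c ->
  0 <= a -> 0 <= b -> 0 <= d ->
  a * s + b * p + c * d <= (s + p + c) * (d + a + b + 1).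
Proof.
move=> s0 p0 c0 a0 b0 d0.
have h1 := mulr_ge0 s0 d0; have h2 := mulr_ge0 s0 b0.
have h3 := mulr_ge0 p0 d0; have h4 := mulr_ge0 p0 a0.
have h5 := mulr_ge0 c0 a0; have h6 := mulr_ge0 c0 b0.
by lra.
Qed.

Section Smooth.
Variables (F : J -> R) (G : J -> J -> R).
Hypothesis cF : forall z, Dj z -> continuous_in Dj F z.
Hypothesis dF : forall v, vertical v -> forall z, Uj z -> is_derive z v F (G v z).
Hypothesis cG : forall v, vertical v -> forall z, Dj z -> continuous_in Dj (G v) z.

Let UD : Uj `<=` Dj.
Proof. by move=> z [[/oball_cball1 z1 z0] z2]. Qed.

(** Over the open punctured ball this is [is_derive_add]; density and continuity carry it to the
    sphere. *)
Lemma derive_vertD v w z : vertical v -> vertical w -> Dj z ->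
  G (v + w) z = G v z + G w z.
Proof.
move=> vv vw Dz; apply: (@continuous_in_eq _ _ Uj Dj (G (v + w))
  (fun z => G v z + G w z)) => //.
- exact: closure_jets.
- by apply: cG => //; apply: verticalD.
- by apply: continuous_inD; apply: cG.
move=> y /set_mem Uy; apply: is_derive_unique (dF (verticalD vv vw) Uy) _.
apply: (@is_derive_add _ _ F (G v) (G w) Uj y v w 1) => //.
- by move=> s t _ _; do 2! apply: jets_over_vertical => //.
- by move=> y' Uy'; apply: dF.
- exact: dF.
- have := cG vw (UD Uy) => C e e0; have [d d0 H] := C e e0.
  by exists d => // y' /UD; apply: H.
Qed.

Lemma derive_vertZ c v z : vertical v -> Dj z -> G (c *: v) z = c * G v z.
Proof.
move=> vv Dz; apply: (@continuous_in_eq _ _ Uj Dj (G (c *: v))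
  (fun z => c * G v z)) => //.
- exact: closure_jets.
- by apply: cG => //; apply: verticalZ.
- by apply: continuous_inZ; apply: cG.
move=> y /set_mem Uy; apply: is_derive_unique (dF (verticalZ c vv) Uy) _.
exact/is_derive_scale/dF.
Qed.

Lemma derive_vert_sum (I : Type) (r : seq I) (c : I -> R) (v : I -> J) z :
  (forall i, vertical (v i)) -> Dj z ->
  G (\sum_(i <- r) c i *: v i) z = \sum_(i <- r) c i * G (v i) z.
Proof.
move=> vv Dz; have vcv i : vertical (c i *: v i) by apply: verticalZ.
elim: r => [|i r IH].
  have v0 : vertical (0 : J) by split=> //; apply: symm0.
  by rewrite !big_nil -[X in G X](scale0r 0) derive_vertZ // mul0r.
rewrite !big_cons derive_vertD // ?derive_vertZ ?IH //.
exact: vertical_sum.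
Qed.

(** Vertical directions leave the base point fixed, so [is_derive_boundary] applies over the sphere
    as well. This connects [G] with the derivatives in [sym_gradient] there. *)
Lemma derive_vert v z : vertical v -> Dj z -> is_derive z v F (G v z).
Proof.
move=> vv Dz; apply: (@is_derive_boundary _ _ F (G v) Uj Dj) => //.
- exact: closure_jets.
- by move=> y t; apply: jets_over_vertical.
- by move=> y t; apply: jets_over_vertical.
- by move=> y Uy; apply: dF.
- exact: cG.
Qed.

Lemma derive_rank1 x s p N (v : T) : Dj (x, s, p, N) ->
  G (jvec 0 0 (v^T *m v)) (x, s, p, N) =
  qf (sym_gradient (fun N => F (x, s, p, N)) N) v.
Proof.
move=> Dz; pose E i j : M := 2^-1 *: (delta_mx i j + delta_mx j i).
have sE i j : symm (E i j).
  by apply/symmP => a b; rewrite !mxE (andbC (a == i)) (andbC (a == j)) addrC.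
have -> : jvec 0 0 (v^T *m v) =
    \sum_i \sum_j (v 0 i * v 0 j) *: jvec 0 0 (E i j).
  rewrite rank1_sum_basis.
  have jl (I : Type) (r : seq I) (a : I -> M) :
      jvec 0 0 (\sum_(i <- r) a i) = \sum_(i <- r) jvec 0 0 (a i).
    elim: r => [|i r IH]; first by rewrite !big_nil.
    by rewrite !big_cons -IH /jvec; congr (_, _, _, _); rewrite /= addr0.
  rewrite jl; apply: eq_bigr => i _; rewrite jl; apply: eq_bigr => j _.
  by rewrite /jvec; congr (_, _, _, _); rewrite /= scaler0.
have Gs (I : Type) (r : seq I) (w : I -> J) : (forall i, vertical (w i)) ->
    G (\sum_(i <- r) w i) (x, s, p, N) = \sum_(i <- r) G (w i) (x, s, p, N).
  move=> vw; have := derive_vert_sum r (fun=> 1) vw Dz.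
  by under eq_bigr do rewrite scale1r; under [RHS]eq_bigr do rewrite mul1r.
rewrite Gs => [|i]; last by apply: vertical_sum => j; apply/verticalZ/vertical_jvec.
apply: eq_bigr => i _; rewrite derive_vert_sum // => [|j]; last exact: vertical_jvec.
apply: eq_bigr => j _; rewrite mxE; congr (_ * _).
suff : is_derive N (E i j) (fun N => F (x, s, p, N))
    (G (jvec 0 0 (E i j)) (x, s, p, N)) by case=> _ ->.
have /is_deriveP H := derive_vert (vertical_jvec 0 0 (sE i j)) Dz.
apply/is_deriveP => e e0; have [d d0 Hd] := H e e0; exists d => // h hd.
have := Hd h hd; suff -> : (x, s, p, N) + h *: jvec 0 0 (E i j) =
  (x, s, p, N + h *: E i j) by [].
by rewrite /jvec; congr (_, _, _, _); rewrite /= ?scaler0 addr0.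
Qed.

Hypothesis ell : forall (x : T) (s : R) (p : T) (N : M),
  (cball 1 `\ (0 : T)) x -> symm N ->
  posdefmx (sym_gradient (fun N => F (x, s, p, N)) N).

Lemma derive_rank1_gt0 z (v : T) : Dj z -> v != 0 ->
  0 < G (jvec 0 0 (v^T *m v)) z.
Proof.
case: z => [[[x s] p] N] Dz v0; rewrite derive_rank1 // -qfE.
by case: (Dz) => Dx sN; apply: ell.
Qed.

(** [P] is a sum of rank-one squares, which are added one at a time; by the mean value theorem each
    increment is a derivative in an elliptic direction. No smallness of [P] is involved. *)
Lemma operator_mono x s p N P : Uj (x, s, p, N) -> symm P ->
  (forall w, 0 <= qf P w) -> F (x, s, p, N) <= F (x, s, p, N + P).
Proof.
move=> Uz sP pP; have [r ->] := psd_rank1_sum sP pP.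
elim: r N Uz => [|v r IH] N Uz; first by rewrite big_nil addr0.
rewrite big_cons addrA.
have vv := vertical_jvec 0 0 (symm_rank1 v).
have E : (x, s, p, N + v^T *m v) = (x, s, p, N) + jvec 0 0 (v^T *m v).
  by rewrite /jvec; congr (_, _, _, _); rewrite /= addr0.
have Uz' : Uj (x, s, p, N + v^T *m v).
  by rewrite E -[X in _ + X]scale1r; apply: jets_over_vertical.
apply: le_trans (IH _ Uz').
have [v0|v0] := eqVneq v 0; first by rewrite v0 mulmx0 addr0.
have [|t _] := @line_mvt _ _ F (G (jvec 0 0 (v^T *m v))) (x, s, p, N)
   (jvec 0 0 (v^T *m v)).
  by move=> t _; apply: dF => //; apply: jets_over_vertical.
rewrite -E => Et; rewrite -subr_ge0 Et; apply/ltW/derive_rank1_gt0 => //.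
exact/UD/jets_over_vertical.
Qed.

Lemma continuous_in_bounded v z : vertical v -> Dj z ->
  exists B, exists2 d, 0 < d &
    0 <= B /\ forall y, Dj y -> `|y - z| < d -> `|G v y| <= B.
Proof.
move=> vv Dz; have [d d0 H] := cG vv Dz ltr01.
exists (`|G v z| + 1), d => //; split; first by rewrite addr_ge0.
move=> y Dy yz; rewrite -[G v y](subrK (G v z)) addrC.
by rewrite (le_trans (ler_normD _ _)) // lerD2l ltW // H.
Qed.

(** The increment is a derivative at an intermediate jet. Near [z] the derivative along [xi^T *m xi]
    is bounded below and the other ones are bounded. The single number [tau] serves as radius, as
    ellipticity constant and as inverse of the bound for the remaining derivatives. *)
Lemma ellipticity_local z (xi : T) : Dj z -> xi != 0 ->
  exists2 tau, 0 < tau & forall y s p (k c : R), Uj y -> `|y - z| < tau ->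
    `|s| < tau -> `|p| < tau -> 0 <= k < tau -> 0 <= c < tau ->
    tau * k - (`|s| + `|p| + c) / tau <=
    F (y + jvec s p (k *: (xi^T *m xi) - c *: 1%:M)) - F y.
Proof.
move=> Dz xi0.
pose vX := jvec 0 0 (xi^T *m xi); pose vI := jvec 0 0 1%:M.
pose vS := jvec 1 0 0; pose vP i := jvec 0 (delta_mx 0 i) 0.
have VX : vertical vX by apply/vertical_jvec/symm_rank1.
have VI : vertical vI by apply/vertical_jvec/symm_1.
have VS : vertical vS by apply/vertical_jvec/symm0.
have VP i : vertical (vP i) by apply/vertical_jvec/symm0.
have th0 := derive_rank1_gt0 Dz xi0; rewrite -/vX in th0.
have [dX dX0 HX] := cG VX Dz (e := G vX z / 2) (ltac:(by rewrite divr_gt0)).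
have [BI [dI dI0 [BI0 HI]]] := continuous_in_bounded VI Dz.
have [BS [dS dS0 [BS0 HS]]] := continuous_in_bounded VS Dz.
have HP i : exists Bd : R * R, [/\ 0 < Bd.2, 0 <= Bd.1 &
    forall y, Dj y -> `|y - z| < Bd.2 -> `|G (vP i) y| <= Bd.1].
  by have [B [d d0 [B0 H]]] := continuous_in_bounded (VP i) Dz; exists (B, d).
have [BP BPP] := choice HP.
pose d := Num.min (Num.min dX dI) (Num.min dS (\big[Num.min/1]_i (BP i).2)).
have d0 : 0 < d.
  rewrite !lt_min dX0 dI0 dS0 /=; elim/big_ind: _ => // [a b a0 b0|i _].
    by rewrite lt_min a0.
  by case: (BPP i).
have [L LE] : exists L, L = BI + BS + \sum_i (BP i).1 + 1 by eexists.
have sBP : 0 <= \sum_i (BP i).1 by apply: sumr_ge0 => i _; case: (BPP i).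
have L0 : 0 < L by rewrite LE ltr_wpDl // !addr_ge0.
(* [Q] accounts for the norms of the two matrices: [tau * Q <= d / 2] keeps the whole segment within
   distance [d] of [z]. *)
pose Q := `|xi^T *m xi| + `|1%:M : M| + 2.
have Q1 : 1 <= Q.
  have := normr_ge0 (xi^T *m xi); have := normr_ge0 (1%:M : M); rewrite /Q; lra.
have Q0 : 0 < Q by apply: lt_le_trans Q1.
pose tau := Num.min (Num.min (G vX z / 2) L^-1) (d / (2 * Q)).
have tau0 : 0 < tau by rewrite !lt_min invr_gt0 L0 !divr_gt0 // mulr_gt0.
have tauX : tau <= G vX z / 2 by rewrite /tau !ge_min lexx.
have tauL : tau <= L^-1 by rewrite /tau !ge_min lexx ?orbT.
have taud : tau * Q <= d / 2.
  have : tau <= d / (2 * Q) by rewrite /tau !ge_min lexx ?orbT.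
  by rewrite ler_pdivlMr ?mulr_gt0 // => H; rewrite ler_pdivlMr //; lra.
clearbody tau.
have Ltau : L <= tau^-1 by rewrite -(invrK L) lef_pV2 // posrE ?invr_gt0.
exists tau => // y s p k c Uy yz sT pT /andP[k0 kT] /andP[c0 cT].
pose h := jvec s p (k *: (xi^T *m xi) - c *: 1%:M).
have hE : h = s *: vS + \sum_i p 0 i *: vP i + (k *: vX + (- c) *: vI).
  have -> : \sum_i p 0 i *: vP i = jvec 0 p 0.
    rewrite {2}(row_sum_delta p).
    rewrite -[RHS]/(jvec 0 (\sum_(i <- index_enum _) p 0 i *: delta_mx 0 i) 0).
    elim: (index_enum _) => [|i r IH]; first by rewrite !big_nil.
    rewrite !big_cons IH /jvec /vP /jvec.
    by congr (_, _, _, _); rewrite /= ?scaler0 ?add0r.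
  rewrite /h /vS /vX /vI /jvec; congr (_, _, _, _).
  - by rewrite /= !scaler0 !addr0.
  - by rewrite /= !scaler0 !addr0 /GRing.scale /= mulr1.
  - by rewrite /= !scaler0 !addr0 add0r.
  - by rewrite /= scaler0 !add0r scaleNr.
have Vh : vertical h.
  apply: vertical_jvec; apply/symmD; last exact/symmN/symmZ/symm_1.
  exact/symmZ/symm_rank1.
have hn : `|h| < d / 2.
  apply: lt_le_trans taud; apply/jet_norm_ltP; rewrite /h /jvec /=.
  have tQ : tau <= tau * Q by rewrite ler_peMr // ltW.
  split; [by rewrite normr0 mulr_gt0| exact: lt_le_trans tQ|exact: lt_le_trans tQ|].
  rewrite (le_lt_trans (ler_normB _ _)) // !normrZ !ger0_norm //.
  rewrite /Q; have := normr_ge0 (xi^T *m xi); have := normr_ge0 (1%:M : M).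
  set a := `|xi^T *m xi|; set b := `|1%:M : M| => b0 a0.
  have ka : k * a <= tau * a by rewrite ler_wpM2r // ltW.
  have cb : c * b <= tau * b by rewrite ler_wpM2r // ltW.
  rewrite 2!mulrDr; apply: ltr_pwDr; last exact: lerD.
  by rewrite mulr_gt0.
have [|t /andP[t0 t1] ->] := @line_mvt _ _ F (G h) y h.
  by move=> t _; apply: dF => //; apply: jets_over_vertical.
have Dyt : Dj (y + t *: h) by apply/UD/jets_over_vertical.
have yt : `|y + t *: h - z| < d.
  rewrite addrAC (le_lt_trans (ler_normD _ _)) // normrZ ger0_norm //.
  rewrite (splitr d) ltrD //.
    apply: (lt_le_trans yz); apply: le_trans taud; rewrite ler_peMr // ltW //.
  by apply: le_lt_trans hn; rewrite ler_piMl.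
move: Dyt yt; move: (y + t *: h) => y' Dyt yt; rewrite hE.
have Vs : vertical (\sum_i p 0 i *: vP i) by apply: vertical_sum => i; exact: verticalZ.
have Vk : vertical (k *: vX) by apply: verticalZ.
have Vc : vertical (- c *: vI) by apply: verticalZ.
have Vss : vertical (s *: vS) by apply: verticalZ.
rewrite !derive_vertD ?derive_vertZ ?derive_vert_sum //; try exact: verticalD.
move: (yt); rewrite /d !lt_min => /andP[/andP[yX yI] /andP[yS yP]].
have {HX} := HX _ Dyt yX; rewrite ltr_norml => /andP[HX _].
have {}HI := HI _ Dyt yI; have {}HS := HS _ Dyt yS.
have {}HP i : `|G (vP i) y'| <= (BP i).1.
  have [_ _ H] := BPP i; apply: H => //; apply: lt_le_trans yP _.
  by rewrite (bigD1 i) //= ge_min lexx.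
have e1 : - (BS * `|s|) <= s * G vS y'.
  suff : `|s * G vS y'| <= BS * `|s| by rewrite ler_norml => /andP[].
  by rewrite normrM mulrC ler_wpM2r.
have e2 : - (c * BI) <= - c * G vI y'.
  rewrite mulNr lerN2 ler_wpM2l //; exact: le_trans (ler_norm _) HI.
have e3 : - ((\sum_i (BP i).1) * `|p|) <= \sum_i p 0 i * G (vP i) y'.
  rewrite mulr_suml -sumrN; apply: ler_sum => i _.
  suff : `|p 0 i * G (vP i) y'| <= (BP i).1 * `|p| by rewrite ler_norml => /andP[].
  by rewrite normrM mulrC ler_pM // coord_le_norm.
have e4 : tau * k <= k * G vX y'.
  have tX : tau <= G vX y'.
    by apply: le_trans tauX _; apply: half_bound HX.
  by rewrite mulrC; apply: ler_wpM2l.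
have A0 : 0 <= `|s| + `|p| + c by rewrite !addr_ge0.
have e5 : (`|s| + `|p| + c) * L <= (`|s| + `|p| + c) / tau by rewrite ler_wpM2l.
have s0 := normr_ge0 s; have p0 := normr_ge0 p.
have e6 : BS * `|s| + (\sum_i (BP i).1) * `|p| + c * BI <= (`|s| + `|p| + c) * L.
  by rewrite LE; apply: coefficient_bound.
have E := lerD (lerD e1 e3) (lerD e4 e2).
apply: (le_trans _ E).
move: (le_trans e6 e5); set A := (_ / tau); set B := tau * k.
exact: sum_bound.
Qed.

(** Decreasing [tau] only weakens the estimate, so the local constants over the compact [K] have a
    common positive value. *)
Lemma ellipticity_uniform (K : set T) (j : T -> J) (xi : T) : compact K ->
  K `<=` (cball 1 `\ (0 : T)) ->
  (forall x, (cball 1 `\ (0 : T)) x -> Dj (j x)) ->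
  (forall x, (oball 1 `\ (0 : T)) x -> Uj (j x)) ->
  (forall x, (cball 1 `\ (0 : T)) x -> forall e, 0 < e -> exists2 d, 0 < d &
     forall y, (cball 1 `\ (0 : T)) y -> `|y - x| < d -> `|j y - j x| < e) ->
  xi != 0 ->
  exists2 tau, 0 < tau & forall x s p (k c : R), K x -> (oball 1 `\ (0 : T)) x ->
    `|s| < tau -> `|p| < tau -> 0 <= k < tau -> 0 <= c < tau ->
    tau * k - (`|s| + `|p| + c) / tau <=
    F (j x + jvec s p (k *: (xi^T *m xi) - c *: 1%:M)) - F (j x).
Proof.
move=> /compact_near_coveringP cK KD jD jU cj xi0.
pose P (tau : R) (x : T) := forall s p (k c : R), (oball 1 `\ (0 : T)) x ->
    `|s| < tau -> `|p| < tau -> 0 <= k < tau -> 0 <= c < tau ->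
    tau * k - (`|s| + `|p| + c) / tau <=
    F (j x + jvec s p (k *: (xi^T *m xi) - c *: 1%:M)) - F (j x).
have : \forall tau \near (0 : R)^'+, K `<=` P tau.
  apply: cK => x Kx.
  have [tau tau0 H] := ellipticity_local (jD _ (KD _ Kx)) xi0.
  have [d d0 Hd] := cj _ (KD _ Kx) tau tau0.
  exists (ball x d, [set t | 0 < t < tau]) => /=.
    split; first exact: nbhsx_ballx.
    by near=> t => /=; apply/andP; split; near: t;
      [exact: nbhs_right_gt | exact: nbhs_right_lt].
  move=> [x' t] /= [xx' /andP[t0 tt]] s p k c Ux' sT pT /andP[k0 kT] /andP[c0 cT].
  have lt a : a < t -> a < tau by move=> /lt_trans; apply.
  have jx : `|j x' - j x| < tau.
    apply: Hd; first by case: Ux' => /oball_cball1.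
    by move: xx'; rewrite -ball_normE /= distrC.
  apply: le_trans (H (j x') s p k c (jU _ Ux') jx _ _ _ _); try by rewrite lt.
  - apply: lerB; first by rewrite ler_wpM2r // ltW.
    by rewrite ler_wpM2l ?addr_ge0 // lef_pV2 ?posrE // ltW.
  - by rewrite k0 lt.
  - by rewrite c0 lt.
move=> H; have : \forall tau \near (0 : R)^'+, 0 < tau /\ K `<=` P tau.
  by near=> t; split; near: t => //; exact: nbhs_right_gt.
move=> /filter_ex[tau [tau0 HP]].
by exists tau => // x s p k c Kx; apply: HP.
Unshelve. all: by end_near. Qed.

End Smooth.
End Operator.

(** * Jets of the solution and touching paraboloids *)

Section Solution.
Context {R : realType} {n : nat}.
Local Notation T := 'rV[R]_n.+1.
Local Notation M := 'M[R]_n.+1.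
Local Notation J := (jet R n).
Local Notation U := (oball 1 `\ (0 : T)).
Local Notation D := (cball 1 `\ (0 : T)).
Local Notation Uj := (jets_over U).
Local Notation Dj := (jets_over D).
Local Notation e_ i := (delta_mx 0 i : T).

Lemma punctured_sub : U `<=` D.
Proof. by move=> x [/oball_cball1]. Qed.

Lemma punctured_radius x : U x -> exists2 r, 0 < r &
  forall y, `|y - x| < r -> U y.
Proof. exact: (open_ballP open_punctured). Qed.

Lemma continuous_in_fin (V : normedModType R) (A : set V) (I : finType)
    (g : I -> V -> R) x :
  (forall i, continuous_in A (g i) x) -> forall e, 0 < e ->
  exists2 d, 0 < d & forall y, A y -> `|y - x| < d -> forall i, `|g i y - g i x| < e.
Proof.
move=> cg e e0.
have H i : exists d, 0 < d /\ forall y, A y -> `|y - x| < d -> `|g i y - g i x| < e.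
  by have [d d0 H] := cg i e e0; exists d.
have [d dP] := choice H.
exists (\big[Num.min/1]_i d i).
  elim/big_ind: _ => // [a b a0 b0|i _]; first by rewrite lt_min a0.
  by case: (dP i).
move=> y Ay yx i; have [_ H'] := dP i; apply: H' => //.
by apply: lt_le_trans yx _; rewrite (bigD1 i) //= ge_min lexx.
Qed.

Lemma C1_expand (f : T -> R) (g : T -> T -> R) :
  (forall v x, U x -> is_derive x v f (g v x)) ->
  (forall v x, D x -> continuous_in D (g v) x) ->
  forall v x, U x -> g v x = \sum_i v 0 i * g (e_ i) x.
Proof.
move=> dg cg v x Ux.
have gD a b : g (a + b) x = g a x + g b x.
  apply: is_derive_unique (dg _ _ Ux) _.
  have [r r0 rU] := punctured_radius Ux.
  have m0 : 0 < `|a| + `|b| + 1 by rewrite ltr_wpDl // addr_ge0.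
  apply: (@is_derive_add _ _ f (g a) (g b) U x a b (r / (`|a| + `|b| + 1))
    _ _ (fun y => dg b y) (dg a x Ux)).
  - by rewrite divr_gt0.
  - move=> s t sr tr; apply: rU.
    rewrite -(addrA x) (addrAC x) subrr add0r (le_lt_trans (ler_normD _ _)) //.
    move: sr tr; rewrite !ltr_pdivlMr // => sr tr; rewrite !normrZ.
    have [st|st] := leP `|s| `|t|.
      apply: le_lt_trans tr; rewrite !mulrDr mulr1 -addrA lerD //.
        by rewrite ler_wpM2r.
      by rewrite lerDl.
    apply: le_lt_trans sr; rewrite !mulrDr mulr1 -addrA lerD //.
    by rewrite -[leLHS]addr0 lerD // ler_wpM2r // ltW.
  - have C := cg b x (punctured_sub Ux).
    move=> e e0; have [d d0 H] := C e e0.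
    by exists d => // y /punctured_sub; apply: H.
have gZ c a : g (c *: a) x = c * g a x.
  by apply: is_derive_unique (dg _ _ Ux) _; apply/is_derive_scale/dg.
rewrite {1}(row_sum_delta v).
elim: (index_enum _) => [|i r IH].
  by rewrite !big_nil -(scale0r 0) gZ mul0r.
by rewrite !big_cons gD gZ IH.
Qed.

Variables (u : T -> R) (D1 : T -> T -> R) (D2 : T -> T -> T -> R).
Hypothesis cu : forall x, D x -> continuous_in D u x.
Hypothesis du : forall v x, U x -> is_derive x v u (D1 v x).
Hypothesis cD1 : forall v x, D x -> continuous_in D (D1 v) x.
Hypothesis dD1 : forall v w x, U x -> is_derive x w (D1 v) (D2 v w x).
Hypothesis cD2 : forall v w x, D x -> continuous_in D (D2 v w) x.

Definition grad x : T := \row_i D1 (e_ i) x.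
Definition hess x : M := \matrix_(i, j) D2 (e_ j) (e_ i) x.
(** The derivatives are those supplied by the class C^2, continuous up to the sphere;
    [jetof_gradient] identifies them with [gradient] and [hessian] in the open punctured ball. *)
Definition jetof x : J := (x, u x, grad x, hess x).

Lemma D1E v x : U x -> D1 v x = dotp v (grad x).
Proof.
by move=> Ux; rewrite (C1_expand du cD1) //; apply: eq_bigr => i _; rewrite mxE.
Qed.

Lemma D2E v x : U x -> D2 v v x = qf (hess x) v.
Proof.
move=> Ux.
have -> : D2 v v x = \sum_i v 0 i * D2 (e_ i) v x.
  apply: is_derive_unique (dD1 _ _ Ux) _.
  have [r r0 rU] := punctured_radius Ux.
  apply: (@is_derive_ext_near _ _ (\sum_i v 0 i \*: D1 (e_ i)) _ _ _ _
    (r / (`|v| + 1))).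
  - by rewrite divr_gt0 // ltr_wpDl.
  - move=> t; rewrite ltr_pdivlMr ?ltr_wpDl // => tr.
    rewrite fct_sumE (C1_expand du cD1) //; apply: rU.
    rewrite (addrAC x) subrr add0r normrZ; apply: le_lt_trans tr.
    by rewrite ler_wpM2l // lerDl.
  by apply: is_derive_sum => i; apply/is_deriveZ/dD1.
rewrite /qf exchange_big; apply: eq_bigr => i _.
rewrite (C1_expand (dD1 _) (cD2 _)) // mulr_sumr; apply: eq_bigr => j _.
by rewrite mxE; ring.
Qed.

Lemma hess_symm x : D x -> symm (hess x).
Proof.
move=> Dx; apply/symmP => i j; rewrite !mxE.
apply: (@continuous_in_eq _ _ U D) => //; [exact: punctured_sub|
  exact: closure_punctured|exact: cD2|exact: cD2|].
move=> y /set_mem Uy.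
have [r r0 rU] := punctured_radius Uy.
have cU v w z : U z -> continuous_in U (D2 v w) z.
  move=> Uz e e0; have [d d0 H] := cD2 v w (punctured_sub Uz) e0.
  by exists d => // y' /punctured_sub; apply: H.
apply: (@schwarz _ _ u (D1 (e_ j)) (D1 (e_ i)) _ _ U y (e_ j) (e_ i) (r / 2) _ _
  (@du _) (@du _) (@dD1 _ _) (@dD1 _ _) (cU _ _ _ Uy) (cU _ _ _ Uy)).
- by rewrite divr_gt0.
- move=> s t sr tr; apply: rU; rewrite -(addrA y) (addrAC y) subrr add0r.
  rewrite (le_lt_trans (ler_normD _ _)) // !normrZ (splitr r) ltrD //.
    by apply: le_lt_trans sr; rewrite ler_piMr ?norm_delta.
  by apply: le_lt_trans tr; rewrite ler_piMr ?norm_delta.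
Qed.

Lemma jetofD x : D x -> Dj (jetof x).
Proof. by move=> Dx; split=> //; apply: hess_symm. Qed.

Lemma jetofU x : U x -> Uj (jetof x).
Proof. by move=> Ux; split=> //; apply/hess_symm/punctured_sub. Qed.

Lemma jetof_continuous x : D x -> forall e, 0 < e -> exists2 d, 0 < d &
  forall y, D y -> `|y - x| < d -> `|jetof y - jetof x| < e.
Proof.
move=> Dx e e0; have [d1 d10 H1] := cu Dx e0.
have [d2 d20 H2] := continuous_in_fin (fun i => cD1 (e_ i) Dx) e0.
have [d3 d30 H3] := continuous_in_fin
  (fun ij : 'I_n.+1 * 'I_n.+1 => cD2 (e_ ij.2) (e_ ij.1) Dx) e0.
exists (Num.min (Num.min e d1) (Num.min d2 d3)).
  by rewrite !lt_min e0 d10 d20.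
move=> y Dy; rewrite !lt_min => /andP[/andP[ye y1] /andP[y2 y3]].
apply/jet_norm_ltP; split=> //=.
- exact: H1.
- by apply: norm_ltP => // i; rewrite !mxE; apply: H2.
- rewrite [ltLHS]/Num.norm /= mx_normrE; apply/bigmax_ltP; split=> //.
  by move=> [i j] _ /=; rewrite !mxE; apply: (H3 y Dy y3 (i, j)).
Qed.

Variables (F : J -> R) (G : J -> J -> R).
Hypothesis cF : forall z, Dj z -> continuous_in Dj F z.
Hypothesis dF : forall v, vertical v -> forall z, Uj z -> is_derive z v F (G v z).
Hypothesis cG : forall v, vertical v -> forall z, Dj z -> continuous_in Dj (G v) z.
Hypothesis ell : forall (x : T) (s : R) (p : T) (N : M), D x -> symm N ->
  posdefmx (sym_gradient (fun N => F (x, s, p, N)) N).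
Hypothesis F_mono : forall (x : T) (t s : R) (p : T) (N : M),
  oball 1 x -> 0 < fstc x < 1 ->
  -1 < t -> t <= fstc x -> 0 < fstc x + t -> set_fstc x t != 0 ->
  symm N -> F (x, s, p, N) <= F (set_fstc x t, s, hatv p, hatm N).
Hypothesis ueq : forall x, U x -> F (jetof x) = 0.

Lemma hatmE (N : M) i j :
  hatm N i j = if (i == ord0) != (j == ord0) then - N i j else N i j.
Proof. by rewrite mxE. Qed.

Lemma hatmK : involutive (@hatm R n).
Proof.
move=> N; apply/matrixP => i j; rewrite !hatmE.
by case: (_ != _) => //; rewrite opprK.
Qed.

Lemma hatm_symm (N : M) : symm N -> symm (hatm N).
Proof. by move=> /symmP sN; apply/symmP => i j; rewrite !hatmE sN eq_sym. Qed.

Lemma qf_hatm (N : M) (v : T) : qf (hatm N) v = qf N (hatv v).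
Proof.
apply: eq_bigr => i _; apply: eq_bigr => j _; rewrite hatmE !hatvE.
by have [->|_] := eqVneq i ord0; have [->|_] := eqVneq j ord0; rewrite /=; ring.
Qed.

Definition gap l x := u (refl l x) - u x.

Lemma reflU l p : 0 < l -> U p -> l < p 0 ord0 -> p <> pole l -> U (refl l p).
Proof.
move=> l0 [/oballE Up p0] lp npole; split; last first.
  by move/eqP; rewrite refl_eq0 => /eqP.
apply/oballE => //; rewrite dotp_refl; apply: lt_trans (Up ltr01).
by rewrite ltrBlDl ltrDr; apply: mulr_gt0; [exact: mulr_gt0|rewrite subr_gt0].
Qed.

Lemma coord_sqr_le (x : T) i : x 0 i ^+ 2 <= dotp x x.
Proof.
rewrite /dotp (bigD1 i) //= -expr2 lerDl.
by apply: sumr_ge0 => j _; rewrite -expr2 sqr_ge0.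
Qed.

Lemma is_derive_quadratic (a m t : R) :
  is_derive t (1 : R) (fun t : R => t * a + t ^+ 2 * (m / 2)) (a + t * m).
Proof.
apply/is_deriveP => e e0; have m1 : 0 < `|m| + 1 by rewrite ltr_wpDl.
exists (e / (`|m| + 1)); first by rewrite divr_gt0.
move=> h; rewrite ltr_pdivlMr // => he.
have -> : (t + h *: 1) * a + (t + h *: 1) ^+ 2 * (m / 2) -
  (t * a + t ^+ 2 * (m / 2)) - h * (a + t * m) = h * m / 2 * h.
  by rewrite /GRing.scale /=; field.
rewrite normrM ler_wpM2r // !normrM normfV [`|2|]gtr0_norm //.
rewrite ler_pdivrMr //; apply: le_trans (_ : e <= _); last first.
  by rewrite ler_peMr // ?ler1n // ltW.
by apply: le_trans (ltW he); rewrite ler_wpM2l // lerDl.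
Qed.

Lemma touch_arith (q p q' p' a k c t x y : R) :
  q - p + t * a + k / 2 * (t * x) ^+ 2 - c / 2 * (t * (t * y)) <= q' - p' ->
  q - p - (0 * a + 0 ^+ 2 * ((k * x ^+ 2 - c * y) / 2)) <=
  q' - p' - (t * a + t ^+ 2 * ((k * x ^+ 2 - c * y) / 2)).
Proof. by lra. Qed.

(** On every line through [p] the gap minus the paraboloid has a local minimum, and
    [interior_min_test] gives the first and second order conditions along that line. Reflected
    directions account for [hatv] and [hatm]. *)
Lemma touching_jet l p (b xi : T) (k c r : R) :
  0 < l -> U p -> l < p 0 ord0 -> p <> pole l -> 0 < r ->
  (forall y, `|y - p| < r -> gap l p + dotp b (y - p) +
     k / 2 * dotp xi (y - p) ^+ 2 - c / 2 * dotp (y - p) (y - p) <= gap l y) ->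
  hatv (grad (refl l p)) = grad p + b /\
  forall w, 0 <= qf (hatm (hess (refl l p)) -
     (hess p + (k *: (xi^T *m xi) - c *: 1%:M))) w.
Proof.
move=> l0 Up lp npole r0 touch; set q := refl l p.
have Uq : U q := reflU l0 Up lp npole.
have [r1 r10 rU] := punctured_radius Up; have [r2 r20 rU2] := punctured_radius Uq.
have key (w : T) : dotp (hatv w) (grad q) - dotp w (grad p) - dotp b w = 0 /\
  0 <= qf (hess q) (hatv w) - qf (hess p) w -
    (k * dotp xi w ^+ 2 - c * dotp w w).
  set A := k * dotp xi w ^+ 2 - c * dotp w w.
  have w1 : 0 < `|w| + 1 by rewrite ltr_wpDl.
  pose rho := Num.min r (Num.min r1 r2) / (`|w| + 1).
  have rho0 : 0 < rho by rewrite divr_gt0 // !lt_min r0 r10.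
  have rhoP t : `|t| < rho -> [/\ `|t *: w| < r, U (p + t *: w) &
      U (q + t *: hatv w)].
    rewrite ltr_pdivlMr // => tr.
    have : `|t *: w| < Num.min r (Num.min r1 r2).
      by apply: le_lt_trans tr; rewrite normrZ ler_wpM2l // lerDl.
    rewrite !lt_min => /and3P[h1 h2 h3]; split=> //.
      by apply: rU; rewrite (addrAC p) subrr add0r.
    by apply: rU2; rewrite (addrAC q) subrr add0r -hatvZ norm_hatv.
  have U0 : U (p + 0 *: w) by rewrite scale0r addr0.
  have Uq0 : U (q + 0 *: hatv w) by rewrite scale0r addr0.
  pose phi (t : R) := u (q + t *: hatv w) - u (p + t *: w) -
       (t * dotp b w + t ^+ 2 * (A / 2)).
  pose phi1 (t : R) := D1 (hatv w) (q + t *: hatv w) - D1 w (p + t *: w) -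
       (dotp b w + t * A).
  have dphi : forall s : R, `|s| < rho -> is_derive s (1 : R) phi (phi1 s).
    move=> s /rhoP[_ Upt Uqt].
    exact: (is_deriveB (is_deriveB ((is_derive_line _ _ _ _ _).1 (du (hatv w) Uqt))
      ((is_derive_line _ _ _ _ _).1 (du w Upt))) (is_derive_quadratic _ _ _)).
  have dphi1 : is_derive (0 : R) (1 : R) phi1 (D2 (hatv w) (hatv w) q - D2 w w p - A).
    have h1 := dD1 (hatv w) (hatv w) Uq0; rewrite {2}scale0r addr0 in h1.
    have h2 := dD1 w w U0; rewrite {2}scale0r addr0 in h2.
    have h3 : is_derive (0 : R) (1 : R) (fun t : R => dotp b w + t * A) A.
      by apply/is_deriveP => e e0; exists 1 => // h _;
        rewrite (_ : _ - _ = 0) ?normr0 ?mulr_ge0 ?(ltW e0) // /GRing.scale /=; ring.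
    exact: (is_deriveB (is_deriveB ((is_derive_line _ _ _ _ _).1 h1)
      ((is_derive_line _ _ _ _ _).1 h2)) h3).
  have phi_min : forall s : R, `|s| < rho -> phi 0 <= phi s.
    move=> s /rhoP[tr _ _].
    have := touch (p + s *: w); rewrite (addrAC p) subrr add0r => /(_ tr).
    rewrite /phi /gap reflD hatvZ -/q !dotpZr dotpZl !scale0r !addr0.
    rewrite /A; exact: touch_arith.
  have := interior_min_test rho0 dphi dphi1 phi_min.
  rewrite /phi1.
  rewrite !scale0r !addr0 mul0r addr0 (D1E _ Uq) (D1E _ Up) (D2E _ Uq) (D2E _ Up).
  by case.
split.
  apply/rowP => i; have [/eqP + _] := key (e_ i).
  rewrite -[X in X = _]dotp_delta -[X in _ = X]dotp_delta dotpDr.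
  rewrite -{1}[grad q]hatvK dotp_hatv (dotpC b) subr_eq0 subr_eq addrC => /eqP ->.
  by rewrite addrC.
move=> w; have [_] := key w.
rewrite qfD qfN !qfD qfN !qfZ qf_rank1 qf_1 qf_hatm.
move: (qf _ _) (qf _ _) (k * _) (c * _) => a1 a2 a3 a4.
by rewrite !opprD !opprK !addrA.
Qed.

(** Let [q] be the reflection of [p]. Adding the paraboloid to the jet of [u] at [p] raises [F] from
    0 by at least the elliptic estimate. The value reached is at most that of [F] at [p] with the
    reflected jet, by [operator_mono], and this is at most 0 by [F_mono] and the equation at [q].
    The constant [tau] is chosen before [l] and [p], so it does not deteriorate near the pole. *)
Lemma no_touching a (xi : T) : 0 < a -> xi != 0 -> exists2 tau, 0 < tau &
  forall l p (b : T) (k c r : R),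
  0 < l -> U p -> a <= p 0 ord0 -> l < p 0 ord0 -> p <> pole l -> 0 < r ->
  `|gap l p| < tau -> `|b| < tau -> 0 <= k < tau -> 0 <= c < tau ->
  (forall y, `|y - p| < r -> gap l p + dotp b (y - p) +
     k / 2 * dotp xi (y - p) ^+ 2 - c / 2 * dotp (y - p) (y - p) <= gap l y) ->
  tau * k <= (`|gap l p| + `|b| + c) / tau.
Proof.
move=> a0 xi0; pose K := cball 1 `&` [set x : T | a <= x 0 ord0].
have cK : compact K.
  apply: (subclosed_compact _ compact_cball) => [|x []//].
  by apply: closedI; [exact: (compact_closed (@norm_hausdorff _ _) compact_cball)
    |exact: closed_coord_ge].
have KD : K `<=` D.
  move=> x [Kx /= ax]; split=> // x0; move: ax.
  by rewrite x0 mxE leNgt a0.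
have [tau tau0 H] := ellipticity_uniform cF dF cG ell cK KD jetofD jetofU
  jetof_continuous xi0.
exists tau => // l p b k c r l0 Up ap lp npole r0 gT bT kT cT touch.
have [gE psd] := touching_jet l0 Up lp npole r0 touch.
have Kp : K p by split=> //; apply: oball_cball1; case: Up.
have {}H := H p (gap l p) b k c Kp Up gT bT kT cT.
rewrite -subr_le0.
set q := refl l p in gE psd *.
have Uq : U q := reflU l0 Up lp npole.
apply: le_trans H _; rewrite ueq // subr0.
set B := k *: (xi^T *m xi) - c *: 1%:M in psd *.
have sB : symm B.
  by apply: symmD; [exact/symmZ/symm_rank1|exact/symmN/symmZ/symm_1].
have sp : symm (hess p) by apply/hess_symm/punctured_sub.
have sq : symm (hatm (hess q)) by apply/hatm_symm/hess_symm/punctured_sub.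
have -> : jetof p + jvec (gap l p) b B = (p, u q, hatv (grad q), hess p + B).
  rewrite /jetof /jvec /gap gE; congr (_, _, _, _); rewrite /= ?addr0 //.
  by rewrite addrC subrK.
have Uz : Uj (p, u q, hatv (grad q), hess p + B) by split=> //; apply: symmD.
apply: le_trans (operator_mono cF dF cG ell Uz _ psd) _.
  by apply: symmD => //; apply/symmN/symmD.
rewrite addrC subrK.
have [/oballE Up1 _] := Up; have {}Up1 := Up1 ltr01.
have p1 : p 0 ord0 < 1.
  have p0 : 0 < p 0 ord0 by apply: lt_trans lp.
  rewrite -(@ltr_pXn2r _ 2) ?nnegrE ?ltW //.
  exact: le_lt_trans (coord_sqr_le p ord0) Up1.
(* The hypothesis is applied to the reflected gradient and Hessian; reflecting them again gives the
   jet of [u] at [q]. *)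
have := @F_mono p (2 * l - fstc p) (u q) (hatv (grad q)) (hatm (hess q)).
rewrite hatvK hatmK -[set_fstc _ _]/q -/(jetof q) ueq // /fstc; apply => //.
- by case: Up.
- by rewrite p1 (lt_trans l0).
- by lra.
- by lra.
- by lra.
- by case: Uq => _ /eqP.
Qed.

End Solution.

(** * Closed and compact sets in the closed ball *)

Section Topology.
Context {R : realType} {n : nat}.
Local Notation T := 'rV[R]_n.+1.
Local Notation N := (n.+1%:R : R).

Lemma continuous_continuous_in (A : set T) (f : T -> R) x :
  continuous f -> A x -> continuous_in A f x.
Proof. by move=> cf; apply/within_continuous_in/continuous_subspaceT. Qed.

Lemma continuous_dotp (b : T) : continuous (dotp b).
Proof.
apply: continuous_big => [|i _ x]; first exact: add_continuous.
exact: (continuousM (@cst_continuous _ _ _ x) (@continuous_coord _ _ i x)).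
Qed.

Lemma continuous_shift (z : T) : continuous (fun x : T => x - z).
Proof.
move=> x.
exact: (@continuousB _ _ _ id (cst z) x (@cvg_id _ _) (@cst_continuous _ _ z x)).
Qed.

Lemma continuous_dist (z : T) : continuous (fun x : T => `|x - z|).
Proof.
by move=> x; apply: continuous_comp (@continuous_shift z x) (@norm_continuous _ _ _).
Qed.

Lemma continuous_dotp_shift (b z : T) : continuous (fun x : T => dotp b (x - z)).
Proof.
by move=> x; apply: continuous_comp (@continuous_shift z x) (@continuous_dotp b _).
Qed.

Lemma continuous_sqdist (z : T) : continuous (fun x : T => dotp (x - z) (x - z)).
Proof.
by move=> x; apply: continuous_comp (@continuous_shift z x) (@continuous_sqnorm _ _ _).
Qed.

Lemma closed_le_preimage (f : T -> R) c : continuous f -> closed [set x | f x <= c].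
Proof.
by move=> cf; apply: (@preimage_closed _ _ f [set y | y <= c]) => //; exact: closed_le.
Qed.

Lemma closed_ge_preimage (f : T -> R) c : continuous f -> closed [set x | c <= f x].
Proof.
by move=> cf; apply: (@preimage_closed _ _ f [set y | c <= y]) => //; exact: closed_ge.
Qed.

Lemma closed_dist_le (z : T) r : closed [set x : T | `|x - z| <= r].
Proof. exact/closed_le_preimage/continuous_dist. Qed.

Lemma closed_dist_ge (z : T) r : closed [set x : T | r <= `|x - z|].
Proof. exact/closed_ge_preimage/continuous_dist. Qed.

Lemma closed_zeros (A : set T) (f : T -> R) : closed A ->
  (forall x, A x -> continuous_in A f x) -> closed [set x | A x /\ f x = 0].
Proof.
move=> cA cf x clx.
have Ax : A x by apply: cA; apply: closureS clx => y [].
split=> //; apply/eqP; apply: contraPT clx => fx0.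
have [d d0 H] := cf _ Ax `|f x| (ltac:(by rewrite normr_gt0)).
move=> /(_ _ (nbhsx_ballx x d d0))[y [[Ay fy0]]].
rewrite -ball_normE /= distrC => /(H y Ay).
by rewrite fy0 sub0r normrN ltxx.
Qed.

Lemma closed_cball : closed (cball 1 : set T).
Proof. exact: (compact_closed (@norm_hausdorff _ _) compact_cball). Qed.

Lemma compact_in_cball (A : set T) : closed A -> A `<=` cball 1 -> compact A.
Proof. by move=> cA AB; apply: subclosed_compact cA compact_cball AB. Qed.

Lemma dotp_cball (x : T) : cball 1 x <-> dotp x x <= 1.
Proof. by rewrite cballE // expr1n. Qed.

Lemma dotp_oball (x : T) : oball 1 x <-> dotp x x < 1.
Proof. by rewrite oballE // expr1n. Qed.

Lemma cball_coord (x : T) i : cball 1 x -> x 0 i <= 1.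
Proof.
move=> /dotp_cball xb; have [x0|/ltW x0] := leP (x 0 i) 0; first by lra.
rewrite -(@ler_pXn2r _ 2) ?nnegrE // expr1n.
exact: le_trans (coord_sqr_le _ _) xb.
Qed.

Lemma dotp_le_sqnorm (x : T) : dotp x x <= N * `|x| ^+ 2.
Proof. by rewrite expr2; apply: le_trans (ler_norm _) (dotp_norm_le _ _). Qed.

End Topology.

(** * Moving planes, with the equation entering through the touching estimate [NT] *)

Section MovingPlanes.
Context {R : realType} {n : nat}.
Local Notation T := 'rV[R]_n.+1.
Local Notation U := (oball 1 `\ (0 : T)).
Local Notation D := (cball 1 `\ (0 : T)).
Local Notation e_ i := (delta_mx 0 i : T).
Local Notation N := (n.+1%:R : R).
Variables (u : T -> R) (D1 : T -> T -> R) (rbar : R).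
Hypothesis cu : forall x, D x -> continuous_in D u x.
Hypothesis du : forall v x, U x -> is_derive x v u (D1 v x).
Hypothesis cD1 : forall v x, D x -> continuous_in D (D1 v) x.
Hypothesis upos : forall x, U x -> 0 < u x.
Hypothesis ubd : forall x, esphere 1 x -> u x = 0.
Hypothesis rbar0 : 0 < rbar.
Hypothesis uinf : forall (V : T) (r : R), 0 < r < rbar ->
  exists m, (exists2 x, esphere r x & u x + dotp V x = m) /\
    forall y, (oball r `\ (0 : T)) y -> m <= u y + dotp V y.
Local Notation gap := (gap u).
Hypothesis NT : forall a (xi : T), 0 < a -> xi != 0 -> exists2 tau, 0 < tau &
  forall l p (b : T) (k c r : R),
  0 < l -> U p -> a <= p 0 ord0 -> l < p 0 ord0 -> p <> pole l -> 0 < r ->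
  `|gap l p| < tau -> `|b| < tau -> 0 <= k < tau -> 0 <= c < tau ->
  (forall y, `|y - p| < r -> gap l p + dotp b (y - p) +
     k / 2 * dotp xi (y - p) ^+ 2 - c / 2 * dotp (y - p) (y - p) <= gap l y) ->
  tau * k <= (`|gap l p| + `|b| + c) / tau.

Definition domin l := forall x, cball 1 x -> l <= x 0 ord0 -> x <> pole l ->
  0 <= gap l x.

Lemma refl_punctured l x : 0 < l -> cball 1 x -> l <= x 0 ord0 ->
  x <> pole l -> D (refl l x).
Proof.
move=> l0 /dotp_cball xb lx np; split; last first.
  by move/eqP; rewrite refl_eq0 => /eqP.
apply/dotp_cball; rewrite dotp_refl; apply: le_trans xb.
by rewrite lerBlDl lerDr mulr_ge0 // ?subr_ge0 // mulr_ge0 // ltW.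
Qed.

Lemma pos_coord_neq0 (x : T) : 0 < x 0 ord0 -> x <> 0.
Proof. by move=> x0 xE; move: x0; rewrite xE mxE ltxx. Qed.

Lemma gap_continuous l x e : D x -> D (refl l x) -> 0 < e ->
  exists2 d, 0 < d & forall l' x', `|l' - l| < d -> `|x' - x| < d ->
    D x' -> D (refl l' x') -> `|gap l' x' - gap l x| < e.
Proof.
move=> Dx Dr e0.
have [d1 d10 H1] := cu Dx (e := e / 2) ltac:(by rewrite divr_gt0).
have [d2 d20 H2] := cu Dr (e := e / 2) ltac:(by rewrite divr_gt0).
exists (Num.min d1 (d2 / 3)) => [|l' x']; first by rewrite lt_min d10 divr_gt0.
rewrite !lt_min => /andP[_ ld] /andP[xd1 xd2] Dx' Dr'.
rewrite /gap opprD addrACA -opprD (splitr e).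
rewrite (le_lt_trans (ler_normB _ _)) // ltrD ?H1 //; apply: H2 => //.
apply: (le_lt_trans (refl_dist _ _ _ _)).
move: ld xd2; set A := `|_ - _|; set B := `|_ - _|; clearbody A B.
lra.
Qed.

Lemma gap_continuous_in l (A : set T) : 0 < l ->
  (forall x, A x -> [/\ cball 1 x, l <= x 0 ord0 & x <> pole l]) ->
  forall x, A x -> continuous_in A (gap l) x.
Proof.
move=> l0 HA x Ax e e0.
have HD y : A y -> D y /\ D (refl l y).
  move=> /HA[yb ly yp]; split; last exact: refl_punctured.
  by split=> //; apply/pos_coord_neq0/(lt_le_trans l0).
have [Dx Dr] := HD _ Ax.
have [d d0 H] := gap_continuous Dx Dr e0.
exists d => // y Ay yx; have [Dy Dry] := HD _ Ay.
by apply: H => //; rewrite subrr normr0.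
Qed.

Lemma gap_sphere_gt0 l x : 0 < l -> esphere 1 x -> l < x 0 ord0 ->
  x <> pole l -> 0 < gap l x.
Proof.
move=> l0 xs lx np; rewrite /gap (ubd xs) subr0; apply: upos.
split; last by move/eqP; rewrite refl_eq0 => /eqP.
move/esphereE: (xs) => /(_ ltr01); rewrite expr1n => xE.
apply/dotp_oball; rewrite dotp_refl xE ltrBlDl ltrDr.
by apply: mulr_gt0; [exact: mulr_gt0|rewrite subr_gt0].
Qed.

Lemma is_derive_gap l p v : U p -> U (refl l p) ->
  is_derive p v (gap l) (D1 (hatv v) (refl l p) - D1 v p).
Proof.
move=> Up Uq; apply: (is_deriveB _ (du v Up)).
have /is_deriveP H := du (hatv v) Uq; apply/is_deriveP => e e0.
have [d d0 Hd] := H e e0; exists d => // h hd.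
by rewrite reflD hatvZ; apply: Hd.
Qed.

(** * Barriers and the strong maximum principle *)

(** Here [s = b.y] and [q = |y|^2]. The conclusion places [y] in the open ball of centre [b] whose
    boundary contains the origin, which is where [barrier] assumes a positive gap. *)
Lemma barrier_region (s q K : R) : 0 < q -> `|2 * K * s| <= 1 ->
  0 <= s - q + K * s ^+ 2 -> q / 2 < s.
Proof.
rewrite ler_norml => q0 /andP[h1 h2] h.
have {}h : q <= s * (1 + K * s) by lra.
have s0 : 0 < s.
  rewrite ltNge; apply/negP => s0; have : s * (1 + K * s) <= 0.
    by apply: mulr_le0_ge0 => //; lra.
  lra.
have : s * (1 + K * s) <= s * (3 / 2) by rewrite ler_pM2l //; lra.
lra.
Qed.

(** The alternative [x = z] allows the centre to be the pole. *)
Lemma regular_radius l z : 0 < l -> U z -> l < z 0 ord0 -> exists2 r, 0 < r &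
  forall x, `|x - z| < r ->
    [/\ U x, l < x 0 ord0 & x = z \/ x <> pole l].
Proof.
move=> l0 Uz lz.
have [r1 r10 H1] := punctured_radius Uz.
pose r3 := if z == pole l then 1 else `|pole l - z|.
have r30 : 0 < r3.
  by rewrite /r3; case: ifPn => // zp; rewrite normr_gt0 subr_eq0 eq_sym.
exists (Num.min r1 (Num.min (z 0 ord0 - l) r3)).
  by rewrite !lt_min r10 subr_gt0 lz.
move=> x; rewrite !lt_min => /and3P[x1 x2 x3]; split; first exact: H1.
  have := le_lt_trans (coord_le_norm (x - z) 0 ord0) x2.
  rewrite !mxE ltr_norml => /andP[+ _]; lra.
have [->|xz] := eqVneq x z; [by left|right=> xp].
move: x3; rewrite /r3 xp; case: eqP => [zp|_]; last by rewrite ltxx.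
by move: xz; rewrite xp zp eqxx.
Qed.

(* Comparison with [h y = b.y - |y|^2 + K (b.y)^2]: a large [K] makes [h] a
   strict subsolution. The point [z] may be the pole, where [gap l] is singular:
   [h] vanishes there, so the sets [h >= const > 0] avoid it. *)
Lemma barrier l z (b : T) rho0 : 0 < l -> U z -> l < z 0 ord0 -> b != 0 ->
  0 < rho0 ->
  (forall x, `|x - z| < rho0 -> x <> z -> 0 <= gap l x) ->
  (forall x, `|x - z| < rho0 -> dotp (x - z) (x - z) / 2 < dotp b (x - z) ->
     0 < gap l x) ->
  exists2 eps, 0 < eps & exists2 rho, 0 < rho &
    forall x, `|x - z| < rho -> x <> z ->
    eps * (dotp b (x - z) - dotp (x - z) (x - z)) <= gap l x.
Proof.
move=> l0 Uz lz b0 rho00 gap_ge0 gap_gt0.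
have [tau tau0 nt] := NT l0 b0.
have [r1 r10 H1] := regular_radius l0 Uz lz.
have nb := normr_ge0 b.
(* In units of [eps], the terms to be dominated are 1 for the gap, [2 + |b|] for the gradient of the
   barrier and 2 for its negative curvature. *)
have [K [K1 KP]] : exists K, 1 <= K /\ (5 + `|b|) / tau < tau * (2 * K).
  exists ((5 + `|b|) / tau / tau + 1); split.
    by rewrite lerDr !divr_ge0 // ?addr_ge0 // ltW.
  have -> (A : R) : tau * (2 * (A / tau + 1)) = 2 * A + 2 * tau.
    by field; apply: lt0r_neq0.
  have : 0 < (5 + `|b|) / tau by rewrite divr_gt0 // ltr_pwDl.
  by move: (_ / tau) => A A0; lra.
have K0 : 0 < K by apply: lt_le_trans K1.
have N1 : 1 <= N by rewrite ler1n.
(* A radius [rho] with [rho * Q <= 1] makes all the quantities in [small] at most 1. *)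
pose Q := 2 * K * (N * (`|b| + 1)) * (`|b| + 1).
have b1 : 1 <= `|b| + 1 by rewrite lerDr.
have N0 : 0 <= N by rewrite ler0n.
have Q2 : 2 * N <= Q.
  have K20 : 0 <= 2 * K by rewrite mulr_ge0 // ltW.
  apply: (@le_trans _ _ (2 * K * (N * 1) * 1)).
    by rewrite !mulr1 ler_wpM2r // ler_peMr.
  apply: ler_pM => //; first by rewrite mulr_ge0 // mulr1.
  by rewrite ler_wpM2l // ler_wpM2l.
have Q0 : 0 < Q by apply: lt_le_trans Q2; rewrite mulr_gt0 // (lt_le_trans ltr01).
have [rho [rhoL rho1 rhoQ]] : exists rho, [/\ 0 < rho, rho < Num.min rho0 r1 &
    rho * Q <= 1].
  exists (Num.min (Num.min rho0 r1 / 2) Q^-1).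
  have m0 : 0 < Num.min rho0 r1 by rewrite lt_min rho00.
  rewrite lt_min divr_gt0 // invr_gt0 Q0; split=> //.
    by rewrite gt_min ltr_pdivrMr // ltr_pMr // ltr1n.
  by rewrite -ler_pdivlMr // div1r ge_min lexx orbT.
have {H1} Hball x : `|x - z| <= rho -> [/\ `|x - z| < rho0, U x, l < x 0 ord0
    & x = z \/ x <> pole l].
  move=> xr; have := le_lt_trans xr rho1; rewrite lt_min => /andP[x1 x2].
  by have [] := H1 _ x2.
pose h (x : T) := dotp b (x - z) - dotp (x - z) (x - z) + K * dotp b (x - z) ^+ 2.
have small x : `|x - z| <= rho -> [/\ `|2 * K * dotp b (x - z)| * (`|b| + 1) <= 1,
    `|2 *: (x - z)| <= 1, `|2 * K * dotp b (x - z)| <= 1 & h x <= 1].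
  move=> xr; set y := x - z in xr *.
  have yN : `|y| * Q <= 1 by apply: le_trans rhoQ; rewrite ler_wpM2r // ltW.
  have yNN : `|y| * (2 * N) <= 1.
    by apply: le_trans yN; rewrite ler_wpM2l.
  have s1 : `|dotp b y| <= N * (`|b| + 1) * `|y|.
    apply: le_trans (dotp_norm_le _ _) _; rewrite mulrA; apply: ler_wpM2r => //.
    by apply: ler_wpM2l => //; rewrite lerDl.
  have A1 : `|2 * K * dotp b y| * (`|b| + 1) <= 1.
    apply: le_trans yN; rewrite normrM gtr0_norm ?mulr_gt0 // /Q.
    rewrite mulrA ler_wpM2r ?(le_trans ler01) //.
    rewrite [leRHS](_ : _ = 2 * K * (N * (`|b| + 1) * `|y|)); last by ring.
    by rewrite ler_wpM2l // mulr_ge0 // ltW.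
  have A2 : `|2 * K * dotp b y| <= 1.
    by apply: le_trans A1; rewrite ler_peMr.
  have A3 : `|2 *: y| <= 1.
    rewrite normrZ gtr0_norm // mulrC; apply: le_trans yNN.
    by rewrite ler_wpM2l // ler_peMr.
  split=> //; rewrite /h -/y.
  have q0 := dotp_ge0 y.
  move: A2; rewrite ler_norml => /andP[A4 A5].
  have sK : dotp b y <= K * dotp b y \/ dotp b y <= 0.
    have [s0|/ltW s0] := leP (dotp b y) 0; [by right|left].
    by rewrite ler_peMl.
  have : K * dotp b y ^+ 2 <= `|dotp b y| / 2.
    rewrite expr2 mulrA (le_trans (ler_norm _)) // normrM mulrC ler_wpM2l //.
    by rewrite ler_norml; apply/andP; split; lra.
  have : `|dotp b y| <= 1 / 2.
    rewrite ler_pdivlMr // mulrC; apply: le_trans (_ : `|2 * K * dotp b y| <= _).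
      rewrite !normrM (gtr0_norm K0) (gtr0_norm (ltr0Sn _ 1)) -mulrA.
      by rewrite ler_wpM2l // ler_peMl.
    by rewrite ler_norml A4 A5.
  by have := ler_norm (dotp b y); lra.
have ch : continuous h.
  move=> x; have cb := @continuous_dotp_shift _ _ b z x.
  exact: (continuousD (continuousB cb (@continuous_sqdist _ _ z x))
    (continuousM (@cst_continuous _ _ K x) (continuousM cb cb))).
have hz : h z = 0.
  by rewrite /h subrr !dotp0r subrr add0r expr0n mulr0.
have gap_cont A : A `<=` [set x | `|x - z| <= rho] -> (~ A z) ->
    forall x, A x -> continuous_in A (gap l) x.
  move=> Ar Az; apply: gap_continuous_in => // x Ax.
  have [_ Ux lx xp] := Hball x (Ar _ Ax); split; [|exact: ltW|].
    by apply: oball_cball1; case: Ux.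
  by case: xp => // xz; case: Az; rewrite -xz.
have comp A : closed A -> A `<=` [set x | `|x - z| <= rho] -> compact A.
  move=> cA Ar; apply: compact_in_cball => // x /Ar /Hball[_ [Ux _] _ _].
  exact: oball_cball1.
(* Where [h >= 0] on the sphere of radius [rho], the gap is positive by [barrier_region], hence
   bounded below by compactness; [mu = 1] covers the case that there is no such point. *)
have [mu [mu0 muP]] : exists mu, 0 < mu /\
    forall x, `|x - z| = rho -> 0 <= h x -> mu <= gap l x.
  pose A := [set x : T | `|x - z| <= rho] `&` [set x | rho <= `|x - z|]
            `&` [set x | 0 <= h x].
  have Ar : A `<=` [set x | `|x - z| <= rho] by move=> x [[]].
  have Az : ~ A z by move=> [[_ /=]]; rewrite subrr normr0 leNgt rhoL.
  have cA : closed A.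
    apply: closedI; first by
      apply: closedI; [exact: closed_dist_le|exact: closed_dist_ge].
    exact: closed_ge_preimage.
  have [A0|A0] := pselect (A !=set0); last first.
    exists 1; split=> // x xr hx; exfalso; apply: A0; exists x.
    by split=> //; split=> /=; rewrite xr.
  have [p /set_mem Ap pmin] := compact_EVT_min A0 (comp A cA Ar)
    (continuous_in_within (gap_cont A Ar Az)).
  exists (gap l p); split; last first.
    by move=> x xr hx; apply: pmin; apply/mem_set; split=> //; split=> /=; rewrite xr.
  have pr := Ar _ Ap; have [p1 _ _ _] := Hball _ pr.
  apply: gap_gt0 => //; have [_ _ sm _] := small _ pr.
  apply: barrier_region sm _; last by case: Ap.
  apply: dotp_gt0; rewrite subr_eq0; apply/eqP => pz; apply: Az.
  by rewrite -pz.
have [eps [eps0 epsmu e1 e2 e3]] : exists eps, [/\ 0 < eps, eps <= mu,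
    eps * (2 + `|b|) < tau, eps * (2 * K) < tau & eps * 2 < tau].
  have S0 : 0 < 3 + `|b| + 2 * K by rewrite ltr_wpDr ?mulr_ge0 ?(ltW K0) // ltr_wpDr.
  have e0 : 0 < Num.min mu (tau / (3 + `|b| + 2 * K)) by rewrite lt_min mu0 divr_gt0.
  exists (Num.min mu (tau / (3 + `|b| + 2 * K))); split=> //.
  - by rewrite ge_min lexx.
  - apply: (@lt_le_trans _ _ (Num.min mu (tau / (3 + `|b| + 2 * K)) * (3 + `|b| + 2 * K))).
      by rewrite ltr_pM2l //; lra.
    by rewrite -ler_pdivlMr // ge_min lexx orbT.
  - apply: (@lt_le_trans _ _ (Num.min mu (tau / (3 + `|b| + 2 * K)) * (3 + `|b| + 2 * K))).
      by rewrite ltr_pM2l //; lra.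
    by rewrite -ler_pdivlMr // ge_min lexx orbT.
  - apply: (@lt_le_trans _ _ (Num.min mu (tau / (3 + `|b| + 2 * K)) * (3 + `|b| + 2 * K))).
      by rewrite ltr_pM2l //; lra.
    by rewrite -ler_pdivlMr // ge_min lexx orbT.
exists eps => //; exists rho => // x xr xz.
apply: (@le_trans _ _ (eps * h x)).
  by rewrite ler_pM2l // lerDl mulr_ge0 ?sqr_ge0 // ltW.
rewrite leNgt; apply/negP => xneg.
pose m := eps * h x - gap l x.
have m0 : 0 < m by rewrite subr_gt0.
(* [S] is compact and avoids [z], where [h] vanishes. At a minimum of [gap l - eps * h] the value is
   at most [- m], so [eps * h >= m] there and the constraint [m / 2] is not active. *)
pose S := [set x : T | `|x - z| <= rho] `&` [set x | m / 2 <= eps * h x].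
have Sr : S `<=` [set x | `|x - z| <= rho] by move=> ? [].
have Sz : ~ S z.
  by move=> [_ /=]; rewrite hz mulr0 leNgt divr_gt0.
have ceh : continuous (fun x : T => eps * h x).
  by move=> y; exact: (continuousM (@cst_continuous _ _ eps y) (ch y)).
have cS : closed S.
  apply: closedI; first exact: closed_dist_le.
  exact: closed_ge_preimage.
have gx0 : 0 <= gap l x.
  by have [x1 _ _ _] := Hball x (ltW xr); apply: gap_ge0.
have Sx : S x.
  by split; [exact: ltW|rewrite /= /m; move: (eps * h x) xneg gx0 => *; lra].
have [p /set_mem Sp pmin] := compact_EVT_min (ex_intro _ _ Sx) (comp S cS Sr)
  (continuous_in_within (fun x Sx => continuous_inD (gap_cont S Sr Sz x Sx)
    (continuous_inZ (-1) (continuous_continuous_in ceh Sx)))).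
have fp : gap l p - eps * h p <= - m.
  by have := pmin x (mem_set Sx); rewrite /m !mulN1r opprB.
have pz : p <> z by move=> pz; apply: Sz; rewrite -pz.
have pr := Sr _ Sp; have [p1 Up lp pp] := Hball _ pr.
have {}pp : p <> pole l by case: pp.
have gp0 : 0 <= gap l p := gap_ge0 _ p1 pz.
have hp0 : 0 < h p by rewrite -(pmulr_rgt0 _ eps0); move: (eps * h p) fp => *; lra.
have [sm1 sm2 _ hp1] := small _ pr.
have ehp : eps * h p <= eps by rewrite ler_piMr // ltW.
have gpe : gap l p < eps by move: (eps * h p) fp ehp => *; lra.
have prs : `|p - z| < rho.
  rewrite lt_neqAle pr andbT; apply/eqP => pE.
  by have := muP _ pE (ltW hp0); rewrite leNgt (lt_le_trans gpe).
have [r r0 rS] : exists2 r, 0 < r & forall y, `|y - p| < r -> S y.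
  have [d d0 Hd] := continuous_continuous_in ceh (I : setT p)
    (e := m / 2) (ltac:(by rewrite divr_gt0)).
  exists (Num.min d (rho - `|p - z|)); first by rewrite lt_min d0 subr_gt0.
  move=> y; rewrite lt_min => /andP[y1 y2]; split.
    rewrite /= -(subrK p y) -addrA (le_trans (ler_normD _ _)) // ltW //.
    by rewrite -ltrBrDr.
  have := Hd y I y1; rewrite ltr_norml /= => /andP[+ _].
  by move: (eps * h y) (eps * h p) fp => *; lra.
set y0 := p - z in sm1 sm2 *.
(* The gradient of [eps * h] at [p]. Being quadratic, [eps * h] equals its expansion at [p], whose
   curvatures are [k = eps * (2 * K)] along [b] and [c = eps * 2]. *)
pose b' := eps *: (b - 2 *: y0 + (2 * K * dotp b y0) *: b).
have b'n : `|b'| <= eps * (2 + `|b|).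
  rewrite normrZ (gtr0_norm eps0) ler_pM2l // (le_trans (ler_normD _ _)) //.
  rewrite (_ : 2 + `|b| = `|b| + 1 + 1); last by ring.
  apply: lerD; first by rewrite (le_trans (ler_normB _ _)) // lerD2l.
  by rewrite normrZ; apply: le_trans sm1; rewrite ler_wpM2l // lerDl.
suff : tau * (eps * (2 * K)) <= (`|gap l p| + `|b'| + eps * 2) / tau.
  apply/negP; rewrite -ltNge (ger0_norm gp0).
  apply: (@le_lt_trans _ _ (eps * ((5 + `|b|) / tau))).
    rewrite mulrA ler_pM2r ?invr_gt0 // (_ : eps * (5 + `|b|) =
      eps + eps * (2 + `|b|) + eps * 2); last by ring.
    by apply: lerD => //; apply: lerD => //; exact: ltW.
  by rewrite [ltRHS]mulrCA ltr_pM2l.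
apply: (nt l p b' (eps * (2 * K)) (eps * 2) r l0 Up (ltW lp) lp pp r0).
- rewrite (ger0_norm gp0); by rewrite (lt_trans gpe) // (le_lt_trans _ e3) // ler_peMr ?ler1n // ltW.
- exact: le_lt_trans e1.
- by rewrite e2 mulr_ge0 ?(ltW eps0) // mulr_ge0 // ltW.
- by rewrite e3 mulr_ge0 // ltW.
- move=> y yr; have := pmin y (mem_set (rS y yr)).
  rewrite !mulN1r.
  have -> : eps * h y = eps * h p + dotp b' (y - p) + eps * (2 * K) / 2 *
      dotp b (y - p) ^+ 2 - eps * 2 / 2 * dotp (y - p) (y - p).
    have E : y - z = (p - z) + (y - p) by rewrite [RHS]addrC addrA subrK.
    rewrite /h E /b' /y0; move: (p - z) (y - p) => v w.
    by rewrite !(dotpZl, dotpDl, dotpNl, dotpDr) (dotpC w v); field.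
  by move: (eps * h p) (dotp _ _) (_ * _ ^+ 2) (_ * dotp _ _) => *; lra.
Qed.

Lemma domin_near l z r : 0 < l -> domin l -> (forall x, `|x - z| < r ->
    [/\ U x, l < x 0 ord0 & x = z \/ x <> pole l]) ->
  forall x, `|x - z| < r -> x <> z -> 0 <= gap l x.
Proof.
move=> l0 dl H x xr xz; have [[Ux _] lx xp] := H x xr.
by apply: dl; [exact: oball_cball1|exact: ltW|case: xp].
Qed.

(* Hopf's lemma at the point of the zero set nearest to [a]. *)
Lemma interior_touching l z (a : T) : 0 < l -> domin l -> U z ->
  l < z 0 ord0 -> z <> pole l -> gap l z = 0 -> a <> z ->
  exists2 rho, 0 < rho & exists x, `|x - z| < rho /\
    dotp (x - a) (x - a) < dotp (z - a) (z - a) /\ gap l x = 0.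
Proof.
move=> l0 dl Uz lz zp gz az.
have [r1 r10 H1] := regular_radius l0 Uz lz.
exists r1 => //; apply: contrapT => nex.
(* Without nearer zeros the gap is positive near [z] in the ball of centre [a] through [z]; this is
   the region of the barrier with [b = a - z]. *)
have b0 : a - z != 0 by rewrite subr_eq0; apply/eqP.
have [|x xr xb|eps eps0 [rho rho0 B]] := barrier l0 Uz lz b0 r10.
- exact: domin_near H1.
- have xz : x <> z.
    by move=> xz; move: xb; rewrite xz subrr !dotp0r mul0r ltxx.
  rewrite lt_def (domin_near l0 dl H1) // andbT; apply/eqP => gx.
  apply: nex; exists x; split=> //; split=> //.
  have -> : x - a = (x - z) - (a - z) by rewrite opprB addrA subrK.
  rewrite -(opprB a z) [ltRHS]dotpNl dotpNr opprK.
  move: xb; move: (x - z) (a - z) => y w.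
  by rewrite !(dotpDl, dotpDr, dotpNl, dotpNr) (dotpC w y); lra.
set b := a - z in b0 B.
have q0 := dotp_gt0 b0; set q := dotp b b in q0.
have Uq := reflU l0 Uz lz zp.
(* The barrier bounds the gap from below at [z + t b], and the gap is nonnegative at [z - t b]. With
   [t <= 1/2], the quadratic term and the two first-order errors cost [1/2 + 1/8 + 1/8 = 3/4] of
   [eps * q * t], which is less than all of it. *)
have e0 : 0 < eps * q / 8 by rewrite divr_gt0 // mulr_gt0.
have /is_deriveP /(_ _ e0) [d d0 Hd] := is_derive_gap b Uz Uq.
set m := D1 _ _ - _ in Hd.
have nb : 0 < `|b| by rewrite normr_gt0.
pose t := Num.min (Num.min d 1) (Num.min r1 rho / `|b|) / 2.
have mi0 : 0 < Num.min (Num.min d 1) (Num.min r1 rho / `|b|).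
  by rewrite !lt_min d0 ltr01 /= divr_gt0 // lt_min r10.
have t0 : 0 < t by rewrite divr_gt0.
have : t < Num.min (Num.min d 1) (Num.min r1 rho / `|b|).
  by rewrite ltr_pdivrMr // ltr_pMr // ltr1n.
rewrite !lt_min => /andP[/andP[td t1] tb].
have t12 : t <= 1 / 2 by rewrite ler_pM2r ?invr_gt0 // !ge_min lexx orbT.
have tbr : `|t *: b| < Num.min r1 rho by rewrite normrZ gtr0_norm // -ltr_pdivlMr.
move: tbr; rewrite lt_min => /andP[tbr1 tbr2].
have shift s : z + s *: b - z = s *: b by rewrite addrAC subrr add0r.
have tb0 (s : R) : s != 0 -> z + s *: b <> z.
  move=> s0 /eqP; rewrite -subr_eq0 shift scaler_eq0 (negbTE s0) (negbTE b0) //.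
have := B (z + t *: b); rewrite shift dotpZr dotpZl -/q => /(_ tbr2).
rewrite dotpZr -/q => /(_ (tb0 _ (lt0r_neq0 t0))) Bt.
have gm : 0 <= gap l (z + (- t) *: b).
  apply: (domin_near l0 dl H1).
    by rewrite shift scaleNr normrN.
  by apply: tb0; rewrite oppr_eq0 lt0r_neq0.
have := Hd t; rewrite gtr0_norm // => /(_ td); rewrite gz subr0 ler_norml => /andP[_ A1].
have := Hd (- t); rewrite normrN gtr0_norm // => /(_ td).
rewrite gz subr0 ler_norml => /andP[_ A2].
suff : eps * q * t <= eps * q * t * (3 / 4).
  by apply/negP; rewrite -ltNge gtr_pMr ?mulr_gt0 //; lra.
have eqt : 0 < eps * q * t by rewrite !mulr_gt0.
have C : eps * q * t * t <= eps * q * t * (1 / 2) by rewrite ler_pM2l.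
have Bt' : eps * q * t - eps * q * t * t <= gap l (z + t *: b).
  by apply: le_trans Bt; rewrite le_eqVlt; apply/orP; left; apply/eqP; ring.
move: (gap l _) (gap l _) gm A1 A2 Bt' => g1 g2 gm A1 A2 Bt'.
have A3 : eps * q / 8 * t = eps * q * t / 8 by ring.
rewrite A3 in A1 A2; rewrite mulNr in A2.
move: (eps * q * t) (eps * q * t * t) (t * m) C Bt' A1 A2 gm => x1 x2 x3; lra.
Qed.

Lemma sqdist_double (x a z : T) :
  dotp (x - z) (x - z) <= 2 * dotp (x - a) (x - a) + 2 * dotp (a - z) (a - z).
Proof.
have -> : x - z = (x - a) + (a - z) by rewrite addrA subrK.
move: (x - a) (a - z) => v w.
have := dotp_ge0 (v - w).
by rewrite !(dotpDl, dotpDr, dotpNl, dotpNr) (dotpC w v); lra.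
Qed.

(** Strong maximum principle: for [a] close to [z], let [z'] be a zero nearest to [a]. If [z'] were
    not [a], [interior_touching] would give a zero still nearer. *)
Lemma zero_set_open l z : 0 < l -> domin l -> U z -> l < z 0 ord0 ->
  z <> pole l -> gap l z = 0 -> exists2 r, 0 < r & forall x, `|x - z| < r ->
  [/\ U x, x <> pole l & gap l x = 0].
Proof.
move=> l0 dl Uz lz zp gz.
have [r1 r10 H1] := regular_radius l0 Uz lz.
have N0 : 0 < N by rewrite ltr0n.
have HU x : `|x - z| < r1 -> [/\ U x, l < x 0 ord0 & x <> pole l].
  by move=> /H1[Ux lx [->|xp]].
(* By [sqdist_double] the nearer zero satisfies [|x - z|^2 <= 4 * q], and [4 * q = r1^2 / 2] stays
   within the regular radius. *)
pose q := r1 ^+ 2 / 8.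
have q0 : 0 < q by rewrite divr_gt0 // exprn_gt0.
have qr (x : T) : dotp (x - z) (x - z) <= 4 * q -> `|x - z| < r1.
  move=> xq; rewrite -(@ltr_pXn2r _ 2) ?nnegrE ?(ltW r10) //.
  apply: le_lt_trans (le_trans (norm_sqr_le _) xq) _.
  rewrite /q; have : 0 < r1 ^+ 2 by rewrite exprn_gt0.
  by move: (r1 ^+ 2) => A A0; lra.
pose r := Num.min r1 (Num.min 1 (q / N)).
have r0 : 0 < r by rewrite !lt_min r10 ltr01 /= divr_gt0.
exists r => // a ar.
have ar1 : `|a - z| < r1 by apply: lt_le_trans ar _; rewrite ge_min lexx.
have [Ua la pa] := HU _ ar1; split=> //.
have aq : dotp (a - z) (a - z) < q.
  apply: le_lt_trans (dotp_le_sqnorm _) _; rewrite mulrC -ltr_pdivlMr //.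
  have : `|a - z| < q / N by apply: lt_le_trans ar _; rewrite !ge_min lexx !orbT.
  apply: le_lt_trans; rewrite expr2 ler_piMr // ltW //.
  by apply: lt_le_trans ar _; rewrite !ge_min lexx !orbT.
pose A := [set x : T | dotp (x - z) (x - z) <= 4 * q].
have AU x : A x -> [/\ U x, l < x 0 ord0 & x <> pole l] by move=> /qr /HU.
have cA : closed A := @closed_le_preimage _ _ _ (4 * q) (@continuous_sqdist _ _ z).
pose Z := [set x | A x /\ gap l x = 0].
have cZ : compact Z.
  apply: compact_in_cball.
    apply: closed_zeros => //; apply: gap_continuous_in => // x /AU[[Ux _] lx xp].
    by split=> //; [exact: oball_cball1|exact: ltW].
  by move=> x [/AU[[Ux _] _ _] _]; apply: oball_cball1.
have Zz : Z z by split=> //; rewrite /A /= subrr dotp0l mulr_ge0 // ltW.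
have [z' /set_mem Zz' zmin] := compact_EVT_min (ex_intro _ _ Zz) cZ
  (continuous_subspaceT (@continuous_sqdist _ _ a)).
have [Az' gz'] := Zz'; have [Uz' lz' pz'] := AU _ Az'.
have [az|/eqP az] := eqVneq a z'; first by rewrite az.
exfalso; have [rho rho0 [x [xr [xa gx]]]] := interior_touching l0 dl Uz' lz' pz' gz' az.
have za : dotp (z' - a) (z' - a) <= dotp (z - a) (z - a) by apply: zmin; apply/mem_set.
have Zx : Z x.
  split=> //; rewrite /A /=; apply: le_trans (sqdist_double x a z) _.
  have : dotp (z - a) (z - a) = dotp (a - z) (a - z).
    by rewrite -(opprB a z) dotpNl dotpNr opprK.
  lra.
by have := zmin x (mem_set Zx); rewrite leNgt xa.
Qed.

(* The zero set cannot be continued in the direction of the first axis, because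
   it would reach the sphere, where the gap is positive. *)
Lemma gap_gt0_half (l : R) (b z : T) : 0 < l -> domin l -> 0 <= b 0 ord0 ->
  cball 1 z -> l < z 0 ord0 -> z <> pole l ->
  (exists2 rho, 0 < rho & forall x, cball 1 x -> dotp b z <= dotp b x ->
     x <> pole l -> `|x - pole l| < rho -> 0 < gap l x) ->
  0 < gap l z.
Proof.
move=> l0 dl b1 bz lz pz [rho rho0 Hrho].
rewrite lt_def dl ?(ltW lz) // andbT; apply/eqP => gz.
(* Removing the ball around the pole makes this set compact. Since [b_1 >= 0], a step along [e_1]
   does not leave the half-space, and by hypothesis no zero in the half-space lies in the removed
   ball. *)
pose A := cball 1 `&` [set x : T | z 0 ord0 <= x 0 ord0]
  `&` [set x | dotp b z <= dotp b x] `&` [set x | rho <= `|x - pole l|].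
have AP x : A x -> [/\ cball 1 x, l <= x 0 ord0 & x <> pole l].
  move=> [[[bx lx] _] /= xp]; split=> //; first exact: le_trans (ltW lz) lx.
  by move=> xE; move: xp; rewrite xE subrr normr0 leNgt rho0.
have cA : closed A.
  apply: closedI; last exact: closed_dist_ge.
  apply: closedI; last exact/closed_ge_preimage/continuous_dotp.
  by apply: closedI; [exact: closed_cball|exact: closed_coord_ge].
pose Z := [set x | A x /\ gap l x = 0].
have cZ : compact Z.
  apply: compact_in_cball; last by move=> x [/AP[]].
  by apply: closed_zeros => //; apply: gap_continuous_in.
have far x : cball 1 x -> dotp b z <= dotp b x -> x <> pole l -> gap l x = 0 ->
    rho <= `|x - pole l|.
  move=> bx bzx xp gx; rewrite leNgt; apply/negP => xr.
  by have := Hrho x bx bzx xp xr; rewrite gx ltxx.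
have Zz : Z z by split=> //; split; [split=> //=|exact: far].
have [x /set_mem [Ax gx] xmax] := compact_EVT_max (ex_intro _ _ Zz) cZ
  (continuous_subspaceT (@continuous_coord _ _ ord0)).
have [bx lx px] := AP _ Ax.
have [[[_ /= zx] bzx] _] := Ax.
have lx' : l < x 0 ord0 by apply: lt_le_trans zx.
have Ux : U x.
  split; last by apply: pos_coord_neq0; apply: lt_trans lx'.
  rewrite /oball /= lt_neqAle; apply/andP; split=> //; apply/eqP => xs.
  by have := gap_sphere_gt0 l0 xs lx' px; rewrite gx ltxx.
have [r r0 Hr] := zero_set_open l0 dl Ux lx' px gx.
pose y := x + (r / 2) *: e_ ord0.
have yx : `|y - x| < r.
  rewrite /y addrAC subrr add0r normrZ gtr0_norm ?divr_gt0 //.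
  apply: (@le_lt_trans _ _ (r / 2)); last by rewrite ltr_pdivrMr // ltr_pMr // ltr1n.
  by rewrite ler_piMr ?norm_delta // ltW // divr_gt0.
have [[Uy _] py gy] := Hr y yx.
have y1 : y 0 ord0 = x 0 ord0 + r / 2 by rewrite !mxE !eqxx mulr1.
have by_ : dotp b z <= dotp b y.
  rewrite (le_trans bzx) // /y dotpDr dotpZr (dotpC b (e_ ord0)) dotp_delta lerDl.
  by rewrite mulr_ge0 // divr_ge0 // ltW.
have byl : cball 1 y by apply: oball_cball1.
have Zy : Z y.
  split=> //; split; last exact: far.
  split=> //; split=> //=; rewrite y1 (le_trans zx) // lerDl divr_ge0 // ltW //.
have := xmax y (mem_set Zy); rewrite y1 leNgt.
by rewrite ltrDl divr_gt0.
Qed.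

(** The half-space [b.x >= b.z] is at positive distance from the pole, so the local hypothesis of
    [gap_gt0_half] is vacuous. This gives positivity before the behaviour at the pole is known. *)
Lemma gap_gt0_away (l : R) (b z : T) : 0 < l -> domin l -> 0 <= b 0 ord0 ->
  cball 1 z -> l < z 0 ord0 -> 0 < dotp b (z - pole l) -> 0 < gap l z.
Proof.
move=> l0 dl b1 bz lz zb.
apply: (gap_gt0_half l0 dl b1 bz lz).
  by move=> zp; move: zb; rewrite zp subrr dotp0r ltxx.
have M0 : 0 < N * (`|b| + 1) by rewrite mulr_gt0 ?ltr0n // ltr_wpDl.
exists (dotp b (z - pole l) / (N * (`|b| + 1))); first by rewrite divr_gt0.
move=> x bx bzx _; rewrite ltr_pdivlMr // => H; exfalso; move: H.
apply/negP; rewrite -leNgt.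
apply: (@le_trans _ _ (dotp b (x - pole l))).
  by rewrite !dotpDr lerD2r.
apply: le_trans (ler_norm _) (le_trans (dotp_norm_le _ _) _).
rewrite [leRHS]mulrC -mulrA ler_wpM2l ?ler0n // ler_wpM2r //.
by rewrite lerDl.
Qed.

(** * Behaviour of the gap at the pole *)

Lemma first_order_expansion z kappa : U z -> 0 < kappa ->
  exists2 d, 0 < d & forall y, `|y| < d ->
    `|u (z + y) - u z - dotp y (\row_i D1 (e_ i) z)| <= kappa * `|y|.
Proof.
move=> Uz k0; have [r r0 rU] := punctured_radius Uz.
have N0 : 0 < N by rewrite ltr0n.
have [d d0 H] := continuous_in_fin (fun i => cD1 (e_ i) (punctured_sub Uz))
  (e := kappa / N) (ltac:(by rewrite divr_gt0)).
exists (Num.min r d) => [|y]; first by rewrite lt_min r0.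
rewrite lt_min => /andP[yr yd].
have near (t : R) : 0 <= t <= 1 -> `|t *: y| <= `|y|.
  by move=> /andP[t0 t1]; rewrite normrZ ger0_norm // ler_piMl.
have Ut (t : R) : 0 <= t <= 1 -> U (z + t *: y).
  move=> t01; apply: rU; rewrite (addrAC z) subrr add0r.
  exact: le_lt_trans (near _ t01) yr.
have [|t t01 ->] := @line_mvt _ _ u (D1 y) z y.
  by move=> t t01; apply/du/Ut.
rewrite (C1_expand du cD1) //; last exact: Ut.
rewrite -sumrB (le_trans (ler_norm_sum _ _ _)) //.
rewrite [leRHS](_ : _ = \sum_(i < n.+1) kappa / N * `|y|); last first.
  by rewrite sumr_const card_ord -mulr_natl; field; rewrite gt_eqF.
apply: ler_sum => i _; rewrite mxE -mulrBr normrM mulrC ler_pM //.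
  apply/ltW/H; first exact/punctured_sub/Ut.
  by rewrite (addrAC z) subrr add0r; apply: le_lt_trans (near _ t01) yd.
exact: coord_le_norm.
Qed.

Lemma dotp_pole (l : R) : dotp (pole l : T) (pole l) = (2 * l) ^+ 2.
Proof. by rewrite /pole dotpZl dotp_delta !mxE !eqxx mulr1 expr2. Qed.

Lemma pole_coord (l : R) : (pole l : T) 0 ord0 = 2 * l.
Proof. by rewrite poleE eqxx. Qed.

(** Half of the bound along [e_1] plus half of the bound for one coordinate; for the first
    coordinate itself the two halves add up or cancel, according to its sign. *)
Lemma growth_average (e y1 a X : R) : 0 < e -> 0 <= X -> e * y1 <= X ->
  (a = `|y1| \/ e * a <= X) -> e / 2 * a <= X - e / 2 * y1.
Proof.
move=> e0 X0 Xy [->|Xa]; last by lra.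
by have [y0|y0] := ger0P y1; lra.
Qed.

Lemma scale_bound (e e' s g : R) : 0 < e -> e <= e' -> 0 <= g -> e' * s <= g ->
  e * s <= g.
Proof.
move=> e0 ee g0 H; have [s0|/ltW s0] := leP s 0.
  by apply: le_trans g0; rewrite mulr_ge0_le0 // ltW.
by apply: le_trans H; rewrite ler_wpM2r.
Qed.

(* The barriers for [e_1] and for [+-e_i] with [i > 1] need no information on
   the part of the axis between the plane and the pole; this is why dimension
   one, where that part is a component of its own, needs no separate treatment. *)
Lemma gap_growth_pole l : 0 < l -> l < 1 / 2 -> domin l ->
  exists2 eps, 0 < eps & exists2 rho, 0 < rho & forall y : T, y <> 0 -> `|y| < rho ->
    eps / 2 * y 0 ord0 + eps / 2 * `|y| <= gap l (pole l + y) + eps * dotp y y.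
Proof.
move=> l0 l12 dl.
have po1 := pole_coord l.
have lp : l < (pole l : T) 0 ord0 by rewrite po1; lra.
have Up : U (pole l).
  split; last by apply: pos_coord_neq0; apply: lt_trans lp.
  apply/dotp_oball; rewrite dotp_pole -[ltRHS](expr1n _ 2).
  by rewrite ltr_pXn2r ?nnegrE //; lra.
have [r1 r10 H1] := regular_radius l0 Up lp.
(* All these directions have a nonnegative first coordinate, as [gap_gt0_away] requires. The
   direction [- e_1] is excluded, and [growth_average] compensates for it. *)
pose w (j : bool * 'I_n.+1) : T :=
  if j.2 == ord0 then e_ ord0 else (-1) ^+ j.1 *: e_ j.2.
have Hj j : exists p : R * R, [/\ 0 < p.1, 0 < p.2 &
    forall x, `|x - pole l| < p.2 -> x <> pole l ->
    p.1 * (dotp (w j) (x - pole l) - dotp (x - pole l) (x - pole l)) <= gap l x].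
  have w1 : 0 <= w j 0 ord0.
    rewrite /w; case: ifPn => j0; rewrite !mxE ?eqxx //=.
    by rewrite eq_sym (negbTE j0) mulr0.
  have wj0 : w j != 0.
    apply/eqP => /rowP /(_ j.2); rewrite /w; case: ifPn => [/eqP ->|j0].
      by rewrite !mxE !eqxx; apply/eqP; exact: oner_neq0.
    rewrite !mxE !eqxx mulr1; apply/eqP; rewrite signr_eq0 //.
  have [|x xr xb|eps eps0 [rho rho0 B]] := barrier l0 Up lp wj0 r10.
  - exact: domin_near H1.
  - have [[Ux _] lx _] := H1 x xr.
    apply: (gap_gt0_away l0 dl w1 _ lx); first exact: oball_cball1.
    by apply: le_lt_trans xb; rewrite divr_ge0 // dotp_ge0.
  by exists (eps, rho).
have [f fP] := choice Hj.
pose eps := \big[Num.min/1]_j (f j).1.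
pose rho := Num.min r1 (\big[Num.min/1]_j (f j).2).
have eps0 : 0 < eps.
  rewrite /eps; elim/big_ind: _ => // [a b a0 b0|j _]; first by rewrite lt_min a0.
  by case: (fP j).
have rho0 : 0 < rho.
  rewrite lt_min r10 /=; elim/big_ind: _ => // [a b a0 b0|j _].
    by rewrite lt_min a0.
  by case: (fP j).
exists eps => //; exists rho => // y y0 yr.
have yE : pole l + y - pole l = y by rewrite addrAC subrr add0r.
have yp : pole l + y <> pole l.
  by move=> /eqP; rewrite -subr_eq0 yE => /eqP.
have g0 : 0 <= gap l (pole l + y).
  apply: (domin_near l0 dl H1) => //; rewrite yE.
  by apply: lt_le_trans yr _; rewrite ge_min lexx.
set X := _ + eps * _; have X0 : 0 <= X.
  by rewrite addr_ge0 // mulr_ge0 ?dotp_ge0 // ltW.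
have Xj j : eps * dotp (w j) y <= X.
  have [_ _ B] := fP j; rewrite -lerBlDr -mulrBr.
  apply: (scale_bound eps0 _ g0 (e' := (f j).1)).
    by rewrite /eps (bigD1 j) //= ge_min lexx.
  have := B (pole l + y); rewrite yE => /(_ _ yp); apply.
  apply: lt_le_trans yr _; rewrite ge_min; apply/orP; right.
  by rewrite (bigD1 j) //= ge_min lexx.
have X1 : eps * y 0 ord0 <= X.
  by have := Xj (true, ord0); rewrite /w eqxx dotp_delta.
have H i : eps / 2 * `|y 0 i| <= X - eps / 2 * y 0 ord0.
  apply: growth_average => //; have [->|i0] := eqVneq i ord0; [by left|right].
  have := Xj (false, i); have := Xj (true, i); rewrite /w /= (negbTE i0).
  rewrite !dotpZl dotp_delta expr0 expr1 mul1r mulN1r.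
  by case: (ger0P (y 0 i)).
rewrite -lerBrDl -ler_pdivlMl ?divr_gt0 //.
apply: norm_leP => [|i]; last by rewrite ler_pdivlMl ?divr_gt0.
have e2 : 0 <= eps / 2 by rewrite divr_ge0 // ltW.
by apply: mulr_ge0; [rewrite invr_ge0|apply: le_trans (H ord0); rewrite mulr_ge0].
Qed.

(* Tilting [u] by a suitable linear function turns the growth of the gap at the
   pole into a gap between [u (pole l)] and the values of [u] near the origin. *)
Lemma pole_bound l : 0 < l -> l <= 1 / 2 -> domin l -> exists2 c, 0 < c &
  exists2 rho, 0 < rho & forall y : T, y <> 0 -> `|y| < rho -> u (pole l) + c <= u y.
Proof.
move=> l0 l12 dl; have N0 : 0 < N by rewrite ltr0n.
have N1 : 1 <= N by rewrite ler1n.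
have ob r y : 0 < r -> y <> 0 -> `|y| < r / N -> (oball r `\ (0 : T)) y.
  move=> r0 y0; rewrite ltr_pdivlMr // => yr; split=> //; apply/oballE => //.
  apply: le_lt_trans (dotp_le_sqnorm y) _.
  apply: (@le_lt_trans _ _ ((`|y| * N) ^+ 2)).
    by rewrite exprMn mulrC ler_wpM2l ?sqr_ge0 // expr2 ler_peMl // ltW.
  by rewrite ltr_pXn2r ?nnegrE // ?mulr_ge0 // ltW.
(* At [l = 1/2] the pole lies on the sphere, where [u = 0]; then a positive lower bound for [u] near
   the origin, obtained with [V = 0], is enough. *)
case: (ltgtP l (1 / 2)) l12 => // [l12 _|lE _]; last first.
  have r2 : 0 < rbar / 2 < rbar.
    by rewrite divr_gt0 //= ltr_pdivrMr // ltr_pMr // ltr1n.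
  have rr : 0 < Num.min (rbar / 2) (1 / 2).
    by rewrite lt_min !divr_gt0.
  have [|m [[x xs mE] H]] := uinf 0 (r := Num.min (rbar / 2) (1 / 2)).
    by rewrite rr /= gt_min; case/andP: r2 => _ ->.
  exists m.
    rewrite -mE dotp0l addr0; apply: upos.
    move/(esphereE _ rr): xs => xs; split.
      apply/dotp_oball; rewrite xs -[ltRHS](expr1n _ 2) ltr_pXn2r ?nnegrE ?(ltW rr) //.
      by rewrite gt_min; apply/orP; right; lra.
    by move=> x0; move: xs; rewrite x0 dotp0l => /esym/eqP; rewrite expf_eq0 gt_eqF.
  exists (Num.min (rbar / 2) (1 / 2) / N); first by rewrite divr_gt0.
  move=> y y0 yr; rewrite ubd ?add0r.
    by have := H y (ob _ _ rr y0 yr); rewrite dotp0l addr0.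
  apply/esphereE => //; rewrite dotp_pole lE; congr (_ ^+ 2); by field.
have [eps eps0 [rho rho0 grow]] := gap_growth_pole l0 l12 dl.
have Up : U (pole l).
  split; last by apply: pos_coord_neq0; rewrite pole_coord mulr_gt0.
  apply/dotp_oball; rewrite dotp_pole -[ltRHS](expr1n _ 2).
  by rewrite ltr_pXn2r ?nnegrE //; lra.
(* This error and the quadratic term of the growth take [eps / 8] each, which leaves [eps / 4] of
   the slope [eps / 2]. *)
have [d d0 Hd] := first_order_expansion Up (kappa := eps / 8) (ltac:(by rewrite divr_gt0)).
(* The second term absorbs the part of the growth that is linear in [y_1]. The reflection carries
   points near the pole to points near the origin, hence the tilt [V = - hatv g]. *)
pose g : T := \row_i D1 (e_ i) (pole l) + (eps / 2) *: e_ ord0.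
pose rho1 := Num.min (Num.min rho d) (1 / (8 * N)).
have rho10 : 0 < rho1 by rewrite !lt_min rho0 d0 /= divr_gt0 // mulr_gt0.
have lower Y : Y <> 0 -> `|Y| < rho1 ->
    u (pole l) + eps / 4 * `|Y| <= u Y + dotp (- hatv g) Y.
  move=> Y0; rewrite -(norm_hatv Y); set y := hatv Y; rewrite !lt_min.
  have YE : Y = hatv y by rewrite hatvK.
  move=> /andP[/andP[yr yd] y8].
  have y0 : y <> 0.
    by move=> yE; apply: Y0; rewrite YE yE; apply/rowP => i; rewrite hatvE !mxE oppr0 if_same.
  have G1 := grow y y0 yr; have := Hd y yd; rewrite ler_norml => /andP[G2 _].
  have -> : dotp (- hatv g) Y = - dotp y (\row_i D1 (e_ i) (pole l)) - eps / 2 * y 0 ord0.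
    rewrite YE dotpNl dotp_hatv dotpC /g dotpDr dotpZr (dotpC y (e_ _)) dotp_delta.
    by rewrite opprD.
  have q8 : eps * dotp y y <= eps / 8 * `|y|.
    rewrite -mulrA ler_pM2l //; apply: le_trans (dotp_le_sqnorm y) _.
    rewrite expr2 mulrA ler_wpM2r //; move: y8; rewrite ltr_pdivlMr ?mulr_gt0 //.
    by move=> h; rewrite -div1r ler_pdivlMr //; lra.
  have gE : gap l (pole l + y) = u Y - u (pole l + y).
    by rewrite /gap refl_pole_shift -YE.
  rewrite gE in G1; move: (dotp y _) (dotp y y) G1 G2 q8 => a q.
  move: (u (pole l + y)) (eps * q) => v q' *.
  by lra.
pose r := Num.min (rbar / 2) (rho1 / 2).
have r0 : 0 < r by rewrite lt_min !divr_gt0.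
have rr : r < rbar by rewrite gt_min ltr_pdivrMr // ltr_pMr // ltr1n.
have r1 : r < rho1.
  by rewrite gt_min; apply/orP; right; rewrite ltr_pdivrMr // ltr_pMr // ltr1n.
have [|m [[x xs mE] H]] := uinf (- hatv g) (r := r); first by rewrite r0.
(* Half of the excess of the tilted minimum over [u (pole l)]; the other half pays for [V.y] near
   the origin. The factor [N] bounds the sup norm from below on the Euclidean sphere. *)
pose c := eps / 8 * (r / N).
have c0 : 0 < c by rewrite mulr_gt0 // divr_gt0.
have m2 : u (pole l) + 2 * c <= m.
  move/(esphereE _ r0): xs => xs.
  have x0 : x <> 0.
    by move=> xE; move: xs; rewrite xE dotp0l => /esym/eqP; rewrite expf_eq0 gt_eqF.
  have xr : `|x| <= r.
    rewrite -(@ler_pXn2r _ 2) ?nnegrE ?(ltW r0) // -xs; exact: norm_sqr_le.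
  have xN : r / N <= `|x|.
    rewrite ler_pdivrMr // -(@ler_pXn2r _ 2) ?nnegrE ?mulr_ge0 ?(ltW r0) // -xs.
    apply: le_trans (dotp_le_sqnorm x) _.
    by rewrite exprMn mulrC ler_wpM2l ?sqr_ge0 // expr2 ler_peMl // ltW.
  rewrite -mE; apply: le_trans (lower x x0 (le_lt_trans xr r1)).
  rewrite lerD2l /c (_ : 2 * _ = eps / 4 * (r / N)); last by field; rewrite gt_eqF.
  by rewrite ler_wpM2l // divr_ge0 // ltW.
exists c => //; pose V := - hatv g.
have V1 : 0 < N * (`|V| + 1) by rewrite mulr_gt0 // ltr_wpDl.
exists (Num.min (r / N) (c / (N * (`|V| + 1)))); first by rewrite lt_min !divr_gt0.
move=> y y0; rewrite lt_min => /andP[y1]; rewrite ltr_pdivlMr // => y2.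
have my := H y (ob _ _ r0 y0 y1).
have : dotp V y <= c.
  apply: le_trans (ler_norm _) (le_trans (dotp_norm_le _ _) _).
  apply: le_trans (ltW y2); rewrite [leRHS]mulrC -mulrA ler_wpM2l ?ler0n //.
  by rewrite ler_wpM2r // lerDl.
rewrite /V; move: (dotp _ y) my => a my h; lra.
Qed.

(** For [l > 1/2] the pole is outside the closed ball, at a distance that leaves nothing to prove.
    Otherwise [pole_bound] exceeds the values of [u] near the pole by continuity. *)
Lemma gap_gt0_near_pole l : 0 < l -> domin l -> exists2 rho, 0 < rho &
  forall x, cball 1 x -> x <> pole l -> `|x - pole l| < rho -> 0 < gap l x.
Proof.
move=> l0 dl; have [l12|l12] := leP l (1 / 2); last first.
  exists (2 * l - 1); first lra.
  move=> x /(cball_coord ord0) x1 _ /(le_lt_trans (coord_le_norm _ 0 ord0)).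
  rewrite 2!mxE pole_coord ltr_norml => /andP[h _]; exfalso; lra.
have [c c0 [rho rho0 H]] := pole_bound l0 l12 dl.
have Dp : D (pole l).
  split; last by apply: pos_coord_neq0; rewrite pole_coord mulr_gt0.
  apply/dotp_cball; rewrite dotp_pole -[leRHS](expr1n _ 2).
  by rewrite ler_pXn2r ?nnegrE //; lra.
have [d d0 Hd] := cu Dp c0.
have p1 : 0 < Num.min d (2 * l) by rewrite lt_min d0 mulr_gt0.
exists (Num.min rho (Num.min d (2 * l))); first by rewrite lt_min rho0.
move=> x bx xp; rewrite !lt_min => /and3P[x1 x2 x3].
have Dx : D x.
  split=> // x0; move: x3; rewrite x0 sub0r normrN.
  apply/negP; rewrite -leNgt; have := coord_le_norm (pole l : T) 0 ord0.
  by rewrite pole_coord gtr0_norm // mulr_gt0.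
have := Hd x Dx x2; rewrite ltr_norml => /andP[_ ux].
have xE : x = pole l + (x - pole l) by rewrite addrC subrK.
have := H (refl l x); rewrite {2}xE refl_pole_shift norm_hatv => /(_ _ x1) Hx.
rewrite /gap subr_gt0; apply: lt_le_trans (Hx _).
  by rewrite -ltrBlDl.
by move/eqP; rewrite refl_eq0 => /eqP.
Qed.

(** With [b = 0] the half-space is everything, and the pole is now under control. *)
Lemma gap_gt0 l x : 0 < l -> domin l -> cball 1 x -> l < x 0 ord0 ->
  x <> pole l -> 0 < gap l x.
Proof.
move=> l0 dl bx lx xp; apply: (gap_gt0_half (b := 0) l0 dl _ bx lx xp).
  by rewrite mxE.
have [rho rho0 H] := gap_gt0_near_pole l0 dl.
by exists rho => // y yb _ yp yr; apply: H.
Qed.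

(** * Continuation in the position of the plane *)

(** Compactness reduces this to a neighbourhood of each point: [pole_bound] serves at the pole of
    [l0], joint continuity of the gap elsewhere on the cap, and left of the plane [l0] the nearby
    planes leave nothing to prove. *)
Lemma planes_near l0 w mu : 0 < l0 -> l0 <= 1 -> domin l0 -> 0 < w ->
  w <= l0 / 8 -> 0 < mu ->
  exists2 delta, 0 < delta & forall l x, l0 - delta < l -> l <= l0 ->
    cball 1 x -> l <= x 0 ord0 -> x <> pole l ->
    (x 0 ord0 <= l0 + w -> - mu <= gap l x) /\
    (l0 + w <= x 0 ord0 -> 0 <= gap l x).
Proof.
move=> l00 l01 dl w0 wl mu0.
(* The margin [w] makes one compact set contain the caps of all nearby planes. *)
pose K := cball 1 `&` [set x : T | l0 - w <= x 0 ord0].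
pose P (l : R) (x : T) := l <= l0 -> cball 1 x -> l <= x 0 ord0 -> x <> pole l ->
    (x 0 ord0 <= l0 + w -> - mu <= gap l x) /\
    (l0 + w <= x 0 ord0 -> 0 <= gap l x).
have cK : compact K.
  apply: compact_in_cball; last by move=> x [].
  by apply: closedI; [exact: closed_cball|exact: closed_coord_ge].
have coordP (x' x : T) d : `|x' - x| < d -> - d < x' 0 ord0 - x 0 ord0 < d.
  move=> xd; have := le_lt_trans (coord_le_norm (x' - x) 0 ord0) xd.
  by rewrite 2!mxE ltr_norml.
have ptwise (x : T) : K x -> exists2 d, 0 < d & forall l x', `|l - l0| < d ->
    `|x' - x| < d -> P l x'.
  move=> [bx /= wx].
  have [xp|xp] := eqVneq x (pole l0).
    have x1 : x 0 ord0 = 2 * l0 by rewrite xp pole_coord.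
    have l12 : l0 <= 1 / 2 by have := cball_coord ord0 bx; rewrite x1; lra.
    have [c c0 [rho rho0 Hc]] := pole_bound l00 l12 dl.
    have Dx : D x by split=> //; apply: pos_coord_neq0; rewrite x1 mulr_gt0.
    have [d d0 Hd] := cu Dx c0.
    exists (Num.min d (Num.min (l0 / 2) (rho / 3))).
      by rewrite !lt_min d0 !divr_gt0.
    move=> l x'; rewrite !lt_min => /and3P[_ l1 l2] /and3P[x2 x3 x4] ll0 bx' lx' xp'.
    have := coordP _ _ _ x3; rewrite x1 => /andP[h1 _].
    move: (l1); rewrite ltr_norml => /andP[l3 _].
    have lp : 0 < l by lra.
    split=> [h|_]; first by exfalso; lra.
    have Dx' : D x' by split=> //; apply: pos_coord_neq0; lra.
    have := Hd x' Dx' x2; rewrite ltr_norml => /andP[_ h2].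
    rewrite /gap subr_ge0; apply: le_trans (_ : u x + c <= _).
      by rewrite -lerBlDl ltW.
    rewrite xp; apply: Hc; first by move/eqP; rewrite refl_eq0 => /eqP.
    have := refl_dist l l0 x' x; rewrite {1}xp refl_pole subr0 => h3.
    by apply: le_lt_trans h3 _; move: x4 l2; set A := `|_ - _|; set B := `|_ - _|; clearbody A B; lra.
  have [xl|xl] := ltP (x 0 ord0) l0.
    exists ((l0 - x 0 ord0) / 2); first by rewrite divr_gt0 // subr_gt0.
    move=> l x'; rewrite ltr_norml => /andP[l1 _] /coordP/andP[_ h] _ _ lx' _.
    by exfalso; move: (x 0 ord0) (x' 0 ord0) l1 h lx' => *; lra.
  move/eqP: xp => xp.
  have Dx : D x by split=> //; apply: pos_coord_neq0; lra.
  have Dr : D (refl l0 x) := refl_punctured l00 bx xl xp.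
  have g0 : 0 <= gap l0 x by apply: dl.
  (* Beyond the plane the gap is positive and its value is the allowed loss; on the plane it
     vanishes and only the loss [mu] can be afforded. *)
  pose e0 := if l0 < x 0 ord0 then Num.min mu (gap l0 x) else mu.
  have e00 : 0 < e0.
    by rewrite /e0; case: ifP => // lx; rewrite lt_min mu0 /=; apply: gap_gt0.
  have emu : e0 <= mu by rewrite /e0; case: ifP => // _; rewrite ge_min lexx.
  have [d d0 Hd] := gap_continuous Dx Dr e00.
  exists (Num.min d (Num.min (l0 / 2) w)); first by rewrite !lt_min d0 divr_gt0.
  move=> l x'; rewrite !lt_min => /and3P[l1 l2 _] /and3P[x1 _ x3] ll0 bx' lx' xp'.
  move: (l2); rewrite ltr_norml => /andP[l3 _].
  have lp : 0 < l by lra.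
  have Dx' : D x' by split=> //; apply: pos_coord_neq0; lra.
  have := Hd l x' l1 x1 Dx' (refl_punctured lp bx' lx' xp').
  rewrite ltr_norml => /andP[h1 _]; split=> [_|h]; first by lra.
  move: h1; rewrite /e0; case: ifPn => [_|/negP/negP].
    by rewrite ltrNl lt_min => /andP[_]; lra.
  rewrite -leNgt => xl0; have /andP[_ h2] := coordP _ _ _ x3.
  by exfalso; lra.
have : \forall l \near l0, K `<=` P l.
  apply: ((compact_near_coveringP K).1 cK R (nbhs l0) P _) => x Kx.
  have [d d0 Hd] := ptwise x Kx.
  exists (ball x d, ball l0 d) => /=.
    by split; exact: nbhsx_ballx.
  move=> [x' l] /= [xx' ll0]; apply: Hd.
    by move: ll0; rewrite /ball /= distrC.
  by move: xx'; rewrite -ball_normE /= distrC.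
move=> /nbhs_ballP[d /= d0 Hd].
exists (Num.min d w) => [|l x]; first by rewrite lt_min d0.
rewrite ltrBlDr -ltrBlDl lt_min => /andP[ld lw] ll0 bx lx xp.
apply: (Hd l) => //; first by rewrite /ball /= ger0_norm ?subr_ge0.
by split=> //=; lra.
Qed.

(** With [k = m / w ^+ 2] this contradicts the touching estimate: the lower order terms [m + m / w]
    are [w^2 + w] times [k]. *)
Lemma strip_arith (tau w m A B : R) : 0 < tau -> 0 < w -> w <= 1 / 4 ->
  2 * w < tau ^+ 2 -> 0 < m -> A <= m -> B <= m / w ->
  (A + B + 0) / tau < tau * (m / w ^+ 2).
Proof.
move=> tau0 w0 w4 wt m0 c0m Bm.
have w20 : 0 < w ^+ 2 by rewrite exprn_gt0.
rewrite ltr_pdivrMr // addr0; apply: le_lt_trans (lerD c0m Bm) _.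
have -> : m + m / w = (w ^+ 2 + w) * (m / w ^+ 2).
  by field; rewrite gt_eqF.
have -> : tau * (m / w ^+ 2) * tau = tau ^+ 2 * (m / w ^+ 2) by ring.
rewrite ltr_pM2r ?divr_gt0 //; apply: le_lt_trans wt.
have : w * w <= w * (1 / 4) by rewrite ler_pM2l.
by rewrite expr2; lra.
Qed.

Lemma strip_square (w t : R) : 0 < w -> - w <= t -> t <= w ->
  t ^+ 2 / w ^+ 2 <= 1.
Proof.
move=> w0 t1 t2; rewrite ler_pdivrMr ?exprn_gt0 // mul1r.
by rewrite -ler_sqrt ?sqr_ge0 // !sqrtr_sqr (gtr0_norm w0) ler_norml t1.
Qed.

(* Maximum principle in a narrow strip: subtracting a multiple of
   [((x_1 - l0) / w)^2] from the gap keeps a negative minimum away from the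
   boundary, and the second derivative [1 / w^2] dominates the lower order terms. *)
Lemma strip l0 : 0 < l0 -> l0 <= 1 -> exists2 w, 0 < w /\ w <= l0 / 8 &
  exists2 mu, 0 < mu & forall l, l0 - w < l -> l <= l0 ->
  (forall x, cball 1 x -> l <= x 0 ord0 -> x <> pole l ->
    (x 0 ord0 <= l0 + w -> - mu <= gap l x) /\
    (l0 + w <= x 0 ord0 -> 0 <= gap l x)) -> domin l.
Proof.
move=> l00 l01; have a0 : 0 < l0 / 2 by rewrite divr_gt0.
have e10 : e_ ord0 != 0.
  by apply/eqP => /rowP /(_ ord0); rewrite !mxE !eqxx; apply/eqP; exact: oner_neq0.
have [tau tau0 nt] := NT a0 e10.
have t20 : 0 < tau ^+ 2 by rewrite exprn_gt0.
(* The bound [l0 / 8] keeps the pole out of the strip, and [2 * w < tau^2] yields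
   [w^2 + w < tau^2]. *)
have [w [w0 wl wt]] : exists w, [/\ 0 < w, w <= l0 / 8 & 2 * w < tau ^+ 2].
  exists (Num.min (l0 / 8) (tau ^+ 2 / 3)).
  have h : Num.min (l0 / 8) (tau ^+ 2 / 3) <= tau ^+ 2 / 3 by rewrite ge_min lexx orbT.
  split; [by rewrite lt_min !divr_gt0|by rewrite ge_min lexx|].
  by move: (tau ^+ 2) (Num.min _ _) h t20 => *; lra.
have w4 : w <= 1 / 4 by lra.
have w20 : 0 < w ^+ 2 by rewrite exprn_gt0.
have w2w : w ^+ 2 <= w * (1 / 4) by rewrite expr2 ler_pM2l.
(* This [mu] bounds the depth [m] of a negative minimum, so that the curvature [m / w ^+ 2] is at
   most [tau / 2], within the range of the touching estimate. *)
exists w => //; exists (tau * w ^+ 2 / 2); first by rewrite divr_gt0 // mulr_gt0.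
move=> l lw ll0 H x bx lx xp.
have [xw|/ltW xw] := leP (x 0 ord0) (l0 + w); last by have [_] := H x bx lx xp; apply.
rewrite leNgt; apply/negP => gx.
have l0' : 0 < l by lra.
pose S := cball 1 `&` [set x : T | l <= x 0 ord0] `&` [set x : T | x 0 ord0 <= l0 + w].
have SP y : S y -> [/\ cball 1 y, l <= y 0 ord0 & y <> pole l].
  move=> [[yb /= ly] yw]; split=> // yE.
  by move: yw; rewrite /= yE pole_coord; lra.
pose q (y : T) := (y 0 ord0 - l0) ^+ 2 / w ^+ 2.
have q0 y : 0 <= q y by rewrite divr_ge0 ?sqr_ge0 // ltW.
have q1 y : S y -> q y <= 1.
  by move=> [[_ /= ly] /= yw]; apply: strip_square => //; lra.
have cS : compact S.
  apply: compact_in_cball; last by move=> y [[]].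
  apply: closedI; last exact: closed_coord_le.
  by apply: closedI; [exact: closed_cball|exact: closed_coord_ge].
have cg := gap_continuous_in l0' SP.
have Sx : S x by [].
have [p0 /set_mem Sp0 p0min] := compact_EVT_min (ex_intro _ _ Sx) cS
  (continuous_in_within cg).
pose m := - gap l p0.
have m0 : 0 < m by rewrite oppr_gt0 (le_lt_trans _ gx) // p0min //; apply/mem_set.
have mmu : m <= tau * w ^+ 2 / 2.
  have [b0 lp0 np0] := SP _ Sp0; have [+ _] := H p0 b0 lp0 np0.
  by rewrite /m lerNl; apply; case: Sp0.
have gm y : S y -> - m <= gap l y by move=> Sy; rewrite opprK; apply/p0min/mem_set.
have cq : continuous (fun y : T => - (m / 2) * q y).
  move=> y; have c1 : {for y, continuous (fun y : T => y 0 ord0 - l0)}.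
    exact: (continuousB (@continuous_coord _ _ ord0 y) (@cst_continuous _ _ l0 y)).
  exact: (continuousM (@cst_continuous _ _ (- (m / 2)) y)
    (continuousM (continuousM c1 c1) (@cst_continuous _ _ (w ^+ 2)^-1 y))).
have [p /set_mem Sp pmin] := compact_EVT_min (ex_intro _ _ Sx) cS
  (continuous_in_within (fun y Sy => continuous_inD (cg y Sy)
    (continuous_continuous_in cq Sy))).
have m2 : 0 < m / 2 by rewrite divr_gt0.
(* As [q <= 1] on the strip, the gap at [p] is at most [- m / 2]. This excludes the plane, the far
   face and the sphere, where the gap is nonnegative. *)
have pm : gap l p <= - m + m / 2 * q p.
  have := pmin p0 (mem_set Sp0); have : 0 <= m / 2 * q p0 by rewrite mulr_ge0 // ltW.
  have -> : gap l p0 = - m by rewrite opprK.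
  by rewrite !mulNr; lra.
have qp2 : m / 2 * q p <= m / 2 by rewrite ler_piMr ?q1 // ltW.
have gp : gap l p < 0.
  by move: (m / 2 * q p) pm qp2 => *; lra.
have [bp lp np] := SP _ Sp.
have lp' : l < p 0 ord0.
  rewrite lt_neqAle lp andbT; apply/eqP => lE; move: gp.
  by rewrite /gap lE refl_fix subrr ltxx.
have wp' : p 0 ord0 < l0 + w.
  rewrite ltNge; apply/negP => pw; have [_ /(_ pw)] := H p bp lp np.
  by rewrite leNgt gp.
have Up : U p.
  split; last by apply: pos_coord_neq0; apply: lt_trans lp'.
  rewrite /oball /= lt_neqAle; apply/andP; split; last exact: bp.
  apply/eqP => ps; have := gap_sphere_gt0 l0' ps lp' np.
  by rewrite ltNge (ltW gp).
have [r1 r10 H1] := punctured_radius Up.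
pose r := Num.min r1 (Num.min (p 0 ord0 - l) (l0 + w - p 0 ord0)).
have r0 : 0 < r by rewrite !lt_min r10 !subr_gt0 lp' wp'.
have rS y : `|y - p| < r -> S y.
  rewrite !lt_min => /and3P[y1 y2 y3]; have [yb _] := H1 y y1.
  move: y2 => /(le_lt_trans (coord_le_norm (y - p) 0 ord0)).
  move: y3 => /(le_lt_trans (coord_le_norm (y - p) 0 ord0)).
  rewrite 2!mxE !ltr_norml => /andP[_ h1] /andP[h2 _].
  by split; [split; [exact: oball_cball1|rewrite /=; lra]|rewrite /=; lra].
pose b : T := (m * (p 0 ord0 - l0) / w ^+ 2) *: e_ ord0.
have bn : `|b| <= m / w.
  rewrite normrZ; apply: (@le_trans _ _ (`|m * (p 0 ord0 - l0) / w ^+ 2| * 1)).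
    by rewrite ler_wpM2l // norm_delta.
  rewrite mulr1 !normrM (gtr0_norm m0) normfV (gtr0_norm w20) -mulrA ler_pM2l //.
  rewrite ler_pdivrMr // expr2 mulrA mulVf ?gt_eqF // mul1r ler_norml.
  by apply/andP; split; lra.
have gpn : `|gap l p| <= m.
  by rewrite ltr0_norm // lerNl; apply: gm.
have mw : m / w ^+ 2 <= tau / 2 by rewrite ler_pdivrMr // mulrAC.
have mw1 : m / w <= m / w ^+ 2.
  rewrite ler_pM2l // lef_pV2 ?posrE //; lra.
have mm : m <= m / w ^+ 2.
  rewrite ler_pdivlMr // ler_piMr ?(ltW m0) //; lra.
have := strip_arith tau0 w0 w4 wt m0 gpn bn; apply/negP; rewrite -leNgt.
apply: (nt l p b (m / w ^+ 2) 0 r l0' Up _ lp' np r0).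
- by lra.
- by lra.
- by lra.
- by apply/andP; split; [rewrite divr_ge0 // ltW|lra].
- by rewrite lexx.
move=> y yr; have := pmin y (mem_set (rS y yr)).
rewrite mul0r mul0r subr0 dotpZl !dotp_delta !mxE.
have -> : - (m / 2) * q y = - (m / 2) * q p
  - m * (p 0 ord0 - l0) / w ^+ 2 * (y 0 ord0 - p 0 ord0)
  - m / w ^+ 2 / 2 * (y 0 ord0 - p 0 ord0) ^+ 2.
  by rewrite /q; field; rewrite gt_eqF.
by move: (- (m / 2) * q p) (_ / _ * _) (_ / 2 * _) => *; lra.
Qed.

Lemma domin1 : domin 1.
Proof.
move=> x bx x1 _; suff <- : x 0 ord0 = 1 by rewrite /gap refl_fix subrr.
by apply: le_anti; rewrite x1 cball_coord.
Qed.

Lemma domin_step l0 : 0 < l0 -> l0 <= 1 -> domin l0 ->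
  exists2 delta, 0 < delta & forall l, l0 - delta < l -> l <= l0 -> domin l.
Proof.
move=> l00 l01 dl; have [w [w0 wl] [mu mu0 H]] := strip l00 l01.
have [d d0 Hd] := planes_near l00 l01 dl w0 wl mu0.
exists (Num.min d w) => [|l]; first by rewrite lt_min d0.
rewrite ltrBlDr -ltrBlDl lt_min => /andP[ld lw] ll0.
by apply: H => [||x bx lx xp] //; [lra|apply: Hd => //; lra].
Qed.

(** A negative gap at a point persists for slightly larger planes, which is impossible unless the
    point is their pole. No point is the pole of two planes, and two are tested. *)
Lemma domin_closed s : 0 < s -> (forall l, s < l -> l <= 1 -> domin l) ->
  s < 1 -> domin s.
Proof.
move=> s0 H s1 x bx sx xp.
have [xs|sx'] := eqVneq (x 0 ord0) s; first by rewrite -xs /gap refl_fix subrr.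
have {sx'} lx : s < x 0 ord0 by rewrite lt_neqAle eq_sym sx'.
have Dx : D x by split=> //; apply: pos_coord_neq0; lra.
rewrite leNgt; apply/negP => gx.
have [d d0 Hd] := gap_continuous Dx (refl_punctured s0 bx sx xp)
  (e := - gap s x) (ltac:(by rewrite oppr_gt0)).
pose e := Num.min d (Num.min (1 - s) (x 0 ord0 - s)).
have e0 : 0 < e by rewrite !lt_min d0 !subr_gt0 s1.
have far l : s < l -> l < s + e -> x = pole l.
  move=> sl; rewrite -ltrBlDl !lt_min => /and3P[l1 l2 l3].
  apply: contrapT => xpl; have lx' : l <= x 0 ord0 by lra.
  have l0 : 0 < l by lra.
  have l11 : l <= 1 by lra.
  have ls : `|l - s| < d by rewrite ger0_norm // subr_ge0 ltW.
  have := Hd l x ls; rewrite subrr normr0 => /(_ d0 Dx).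
  move=> /(_ (refl_punctured l0 bx lx' xpl)); rewrite ltr_norml => /andP[_].
  by have := H l sl l11 x bx lx' xpl; lra.
have x2 : x = pole (s + e / 2) by apply: far; lra.
have x3 : x = pole (s + e / 3) by apply: far; lra.
by have := congr1 (fun y : T => y 0 ord0) x3; rewrite x2 !pole_coord; lra.
Qed.

(** Consider the supremum of the planes that fail. The property holds above it, at it by closedness,
    and slightly below it by [domin_step], which contradicts the choice of the supremum. *)
Lemma domin_all l : 0 < l -> l <= 1 -> domin l.
Proof.
move=> l0 l1; apply: contrapT => ndl.
pose S := [set l | 0 < l <= 1 /\ ~ domin l].
have Sl : S l by split=> //; rewrite l0.
have hS : has_sup S by split; [exists l|exists 1 => y [/andP[]]].
have sl : l <= sup S by apply: sup_upper_bound.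
have s1 : sup S <= 1 by apply: ge_sup => [|y [/andP[]]] //; exists l.
have s0 : 0 < sup S by apply: lt_le_trans sl.
have above y : sup S < y -> y <= 1 -> domin y.
  move=> sy y1; apply: contrapT => ny.
  suff : y <= sup S by rewrite leNgt sy.
  by apply: sup_upper_bound => //; split=> //; rewrite y1 (lt_trans s0).
have ds : domin (sup S).
  move: s1; rewrite le_eqVlt => /orP[/eqP ->|s1]; first exact: domin1.
  exact: domin_closed.
have [d d0 Hd] := domin_step s0 s1 ds.
have [y Sy yd] := sup_adherent d0 hS.
by case: (Sy) => _; apply; apply: Hd => //; exact: sup_upper_bound.
Qed.

Lemma reflection_le x : D x -> 0 < x 0 ord0 -> u x <= u (hatv x).
Proof.
move=> [bx x0] x1; have Dx : D x by [].
have refl0 y : refl 0 y = hatv y.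
  by apply/rowP => i; rewrite reflE hatvE mulr0 sub0r.
have Dh : D (refl 0 x).
  rewrite refl0; split; first by apply/dotp_cball; rewrite dotp_hatv; apply/dotp_cball.
  move=> h; apply: x0; rewrite -(hatvK x) h.
  by apply/rowP => i; rewrite hatvE !mxE oppr0 if_same.
have x11 := cball_coord ord0 bx.
rewrite -subr_ge0 -refl0 -/(gap 0 x) leNgt; apply/negP => gx.
have [d d0 Hd] := gap_continuous Dx Dh (e := - gap 0 x) (ltac:(by rewrite oppr_gt0)).
(* The limit [l -> 0] at a fixed point; the factor 3 gives [2 * l < x_1], so that [x] lies beyond
   the pole. *)
pose l := Num.min d (x 0 ord0) / 3.
have m0 : 0 < Num.min d (x 0 ord0) by rewrite lt_min d0.
have l0 : 0 < l by rewrite divr_gt0.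
have : l * 3 = Num.min d (x 0 ord0) by rewrite /l divfK.
move=> lE; have : l * 3 <= d by rewrite lE ge_min lexx.
have : l * 3 <= x 0 ord0 by rewrite lE ge_min lexx orbT.
move=> lx ld.
have xp : x <> pole l by move=> xE; move: lx; rewrite xE pole_coord; lra.
have lx' : l <= x 0 ord0 by lra.
have l1 : l <= 1 by lra.
have := Hd l x; rewrite subr0 gtr0_norm // subrr normr0 => /(_ _ d0 Dx).
have ld' : l < d by lra.
move=> /(_ ld' (refl_punctured l0 bx lx' xp)); rewrite ltr_norml => /andP[_].
by have := domin_all l0 l1 bx lx' xp; lra.
Qed.

End MovingPlanes.

(** * The reflected solution and the conclusion *)

Section Assembly.
Context {R : realType} {n : nat}.
Local Notation T := 'rV[R]_n.+1.
Local Notation M := 'M[R]_n.+1.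
Local Notation J := (jet R n).
Local Notation U := (oball 1 `\ (0 : T)).
Local Notation D := (cball 1 `\ (0 : T)).
Local Notation Uj := (jets_over U).
Local Notation Dj := (jets_over D).
Local Notation e_ i := (delta_mx 0 i : T).

Lemma hatv0 : hatv (0 : T) = 0.
Proof. by apply/rowP => i; rewrite hatvE !mxE oppr0 if_same. Qed.

Lemma hatv_neq0 (x : T) : x <> 0 -> hatv x <> 0.
Proof. by move=> x0 h; apply: x0; rewrite -(hatvK x) h hatv0. Qed.

Lemma oball_hatv r (x : T) : oball r x -> oball r (hatv x).
Proof. by rewrite /oball /enorm /= dotp_hatv. Qed.

Lemma esphere_hatv r (x : T) : esphere r x -> esphere r (hatv x).
Proof. by rewrite /esphere /enorm /= dotp_hatv. Qed.

Lemma hatvU (x : T) : U x -> U (hatv x).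
Proof. by move=> [bx x0]; split; [exact: oball_hatv|exact: hatv_neq0]. Qed.

Lemma hatvD_punctured (x : T) : D x -> D (hatv x).
Proof.
move=> [bx x0]; split; last exact: hatv_neq0.
by move: bx; rewrite /cball /enorm /= dotp_hatv.
Qed.

Lemma hatv_delta i : hatv (e_ i) = (if i == ord0 then -1 else 1) *: e_ i.
Proof.
apply/rowP => j; rewrite hatvE !mxE !eqxx /=.
have [->|j0] := eqVneq j ord0.
  by rewrite (eq_sym ord0); case: ifP => _; rewrite ?mulN1r ?mulr0 ?oppr0.
case: (eqVneq i ord0) => [->|_]; last by rewrite mul1r.
by rewrite (negbTE j0) mulr0.
Qed.

Lemma continuous_in_hatv (g : T -> R) x : continuous_in D g (hatv x) ->
  continuous_in D (g \o hatv) x.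
Proof.
move=> cg e e0; have [d d0 H] := cg e e0; exists d => // y Dy yx.
apply: H; first exact: hatvD_punctured.
by rewrite -[- hatv x]scaleN1r -hatvZ -hatvD scaleN1r norm_hatv.
Qed.

Lemma is_derive_hatv (g : T -> R) x v l : is_derive (hatv x) (hatv v) g l ->
  is_derive x v (g \o hatv) l.
Proof.
move=> /is_deriveP H; apply/is_deriveP => e e0.
have [d d0 Hd] := H e e0; exists d => // h hd.
by rewrite /= hatvD hatvZ; apply: Hd.
Qed.

Section HalfSpace.
Variables (u : T -> R) (D1 : T -> T -> R) (D2 : T -> T -> T -> R).
Hypothesis cu : forall x, D x -> continuous_in D u x.
Hypothesis du : forall v x, U x -> is_derive x v u (D1 v x).
Hypothesis cD1 : forall v x, D x -> continuous_in D (D1 v) x.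
Hypothesis dD1 : forall v w x, U x -> is_derive x w (D1 v) (D2 v w x).
Hypothesis cD2 : forall v w x, D x -> continuous_in D (D2 v w) x.
Let D1h v x := D1 (hatv v) (hatv x).
Let D2h v w x := D2 (hatv v) (hatv w) (hatv x).

Lemma reflected_du v x : U x -> is_derive x v (u \o hatv) (D1h v x).
Proof. by move=> Ux; apply/is_derive_hatv/du/hatvU. Qed.

Lemma reflected_dD1 v w x : U x -> is_derive x w (D1h v) (D2h v w x).
Proof.
by move=> Ux; apply: (is_derive_hatv (g := D1 (hatv v))); apply/dD1/hatvU.
Qed.

Lemma reflected_cD1 v x : D x -> continuous_in D (D1h v) x.
Proof. by move=> Dx; apply: continuous_in_hatv; apply/cD1/hatvD_punctured. Qed.

Lemma reflected_cD2 v w x : D x -> continuous_in D (D2h v w) x.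
Proof. by move=> Dx; apply: continuous_in_hatv; apply/cD2/hatvD_punctured. Qed.

Lemma D1Z c v x : U x -> D1 (c *: v) x = c * D1 v x.
Proof.
by move=> Ux; apply: is_derive_unique (du _ Ux) _; apply/is_derive_scale/du.
Qed.

Lemma D2Z a c v w x : U x -> D2 (a *: v) (c *: w) x = a * c * D2 v w x.
Proof.
move=> Ux; rewrite (_ : a * c * _ = c * (a * D2 v w x)); last by ring.
apply: is_derive_unique (dD1 _ _ Ux) _; apply: is_derive_scale.
have [r r0 rU] := punctured_radius Ux.
apply: (@is_derive_ext_near _ _ (a \*: D1 v) _ _ _ _ (r / (`|w| + 1))).
- by rewrite divr_gt0 // ltr_wpDl.
- move=> t; rewrite ltr_pdivlMr ?ltr_wpDl // => tr; rewrite D1Z //; apply: rU.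
  rewrite (addrAC x) subrr add0r normrZ; apply: le_lt_trans tr.
  by rewrite ler_wpM2l // lerDl.
exact/is_deriveZ/dD1.
Qed.

Lemma reflected_jet x : U x -> jetof (u \o hatv) D1h D2h x =
  (x, u (hatv x), hatv (grad D1 (hatv x)), hatm (hess D2 (hatv x))).
Proof.
move=> Ux; have Uh := hatvU Ux; congr (_, _, _, _).
  apply/rowP => i; rewrite hatvE !mxE /D1h hatv_delta D1Z //.
  by case: eqP => [->|_]; rewrite ?mulN1r ?mul1r.
apply/matrixP => i j; rewrite hatmE !mxE /D2h !hatv_delta D2Z //.
by case: (i == ord0); case: (j == ord0); rewrite /= ?mulrNN ?mulr1 ?mul1r ?mulN1r.
Qed.

(** The second derivatives agree because the first ones agree on a whole neighbourhood of [x]. *)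
Lemma jetof_gradient x : U x -> jetof u D1 D2 x = (x, u x, gradient u x, hessian u x).
Proof.
move=> Ux; congr (_, _, _, _).
  by apply/rowP => i; rewrite !mxE; have [_ ->] := du (e_ i) Ux.
apply/matrixP => i j; rewrite !mxE.
suff [_ ->] : is_derive x (e_ i) (fun y => 'D_(e_ j) u y) (D2 (e_ j) (e_ i) x) by [].
have [r r0 rU] := punctured_radius Ux.
apply: (@is_derive_ext_near _ _ (D1 (e_ j)) _ _ _ _ (r / (`|e_ i| + 1))).
- by rewrite divr_gt0 // ltr_wpDl.
- move=> t; rewrite ltr_pdivlMr ?ltr_wpDl // => tr.
  suff Ut : U (x + t *: e_ i) by have [_ ->] := du (e_ j) Ut.
  apply: rU; rewrite (addrAC x) subrr add0r normrZ; apply: le_lt_trans tr.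
  by rewrite ler_wpM2l // lerDl.
exact: dD1.
Qed.

Variables (F : J -> R) (G : J -> J -> R) (rbar : R).
Hypothesis cF : forall z, Dj z -> continuous_in Dj F z.
Hypothesis dF : forall v, vertical v -> forall z, Uj z -> is_derive z v F (G v z).
Hypothesis cG : forall v, vertical v -> forall z, Dj z -> continuous_in Dj (G v) z.
Hypothesis ell : forall (x : T) (s : R) (p : T) (N : M), D x -> symm N ->
  posdefmx (sym_gradient (fun N => F (x, s, p, N)) N).
Hypothesis F_mono : forall (x : T) (t s : R) (p : T) (N : M),
  oball 1 x -> 0 < fstc x < 1 ->
  -1 < t -> t <= fstc x -> 0 < fstc x + t -> set_fstc x t != 0 ->
  symm N -> F (x, s, p, N) <= F (set_fstc x t, s, hatv p, hatm N).
Hypothesis ueq : forall x, U x -> F (jetof u D1 D2 x) = 0.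
Hypothesis upos : forall x, U x -> 0 < u x.
Hypothesis ubd : forall x, esphere 1 x -> u x = 0.
Hypothesis rbar0 : 0 < rbar.
Hypothesis uinf : forall (V : T) (r : R), 0 < r < rbar ->
  exists m, (exists2 x, esphere r x & u x + dotp V x = m) /\
    forall y, (oball r `\ (0 : T)) y -> m <= u y + dotp V y.

Lemma solution_reflection_le x : D x -> 0 < x 0 ord0 -> u x <= u (hatv x).
Proof.
apply: (reflection_le cu du cD1 upos ubd rbar0 uinf).
exact: (no_touching cu du cD1 dD1 cD2 cF dF cG ell F_mono ueq).
Qed.

End HalfSpace.
End Assembly.

Theorem corollary1p1 (R : realType) (n : nat)
  (F : jet R n -> R) (u : 'rV[R]_n.+1 -> R) (rbar : R)
  (F_C1 : classC (jets_over setT) (jets_over (oball 1 `\ 0))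
            (jets_over (cball 1 `\ 0)) 1 F)
  (F_elliptic : forall (x : 'rV[R]_n.+1) (s : R) (p : 'rV[R]_n.+1) (M : 'M[R]_n.+1),
     (cball 1 `\ 0) x -> symm M ->
     posdefmx (sym_gradient (fun N => F (x, s, p, N)) M))
  (F_mono : forall (x : 'rV[R]_n.+1) (t s : R) (p : 'rV[R]_n.+1) (M : 'M[R]_n.+1),
     oball 1 x -> 0 < fstc x < 1 ->
     -1 < t -> t <= fstc x -> 0 < fstc x + t -> set_fstc x t != 0 ->
     symm M ->
     F (x, s, p, M) <= F (set_fstc x t, s, hatv p, hatm M))
  (F_sym : forall (x : 'rV[R]_n.+1) (s : R) (p : 'rV[R]_n.+1) (M : 'M[R]_n.+1),
     (cball 1 `\ 0) x -> symm M ->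
     F (hatv x, s, hatv p, hatm M) = F (x, s, p, M))
  (u_C2 : classC setT (oball 1 `\ 0) (cball 1 `\ 0) 2 u)
  (rbar_bounds : 0 < rbar <= 1)
  (u_inf : forall (V : 'rV[R]_n.+1) (r : R), 0 < r < rbar ->
     exists m : R,
       is_min_on (esphere r) (fun x => u x + dotp V x) m /\
       ereal_inf [set (u x + dotp V x)%:E | x in oball r `\ 0] = m%:E)
  (u_eq : forall x, (oball 1 `\ 0) x ->
     F (x, u x, gradient u x, hessian u x) = 0)
  (u_pos : forall x, (oball 1 `\ 0) x -> 0 < u x)
  (u_bd : forall x, esphere 1 x -> u x = 0) :
  forall x, (cball 1 `\ 0) x -> u (hatv x) = u x.
Proof.
have cF := within_continuous_in F_C1.1.
have [G GP] := classC1_deriv F_C1.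
have dF v : vertical v -> forall z, (jets_over (oball 1 `\ 0)) z ->
    is_derive z v F (G v z).
  by move=> /vertical_symm /GP[].
have cG v : vertical v -> forall z, (jets_over (cball 1 `\ 0)) z ->
    continuous_in (jets_over (cball 1 `\ 0)) (G v) z.
  by move=> /vertical_symm /GP[].
have cu := within_continuous_in u_C2.1.
have [D1 [D2 DP]] := classC2_deriv u_C2.
have du v x : (oball 1 `\ 0) x -> is_derive x v u (D1 v x).
  by move=> Ux; have [H _ _] := DP v; apply: H.
have cD1 v x : (cball 1 `\ 0) x -> continuous_in (cball 1 `\ 0) (D1 v) x.
  by move=> Dx; have [_ H _] := DP v; apply: H.
have dD1 v w x : (oball 1 `\ 0) x -> is_derive x w (D1 v) (D2 v w x).
  by move=> Ux; have [_ _ /(_ w)[H _]] := DP v; apply: H.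
have cD2 v w x : (cball 1 `\ 0) x -> continuous_in (cball 1 `\ 0) (D2 v w) x.
  by move=> Dx; have [_ _ /(_ w)[_ H]] := DP v; apply: H.
have ueq x : (oball 1 `\ 0) x -> F (jetof u D1 D2 x) = 0.
  by move=> Ux; rewrite (jetof_gradient du dD1 Ux); apply: u_eq.
have rbar0 : 0 < rbar by case/andP: rbar_bounds.
have uinf V r : 0 < r < rbar ->
    exists m, (exists2 x, esphere r x & u x + dotp V x = m) /\
    forall y, (oball r `\ 0) y -> m <= u y + dotp V y.
  move=> /(u_inf V)[m [[mx _] mE]]; exists m; split=> // y yr.
  by rewrite -lee_fin -mE; apply: ereal_inf_lbound; exists y.
have le1 x : (cball 1 `\ 0) x -> 0 < x 0 ord0 -> u x <= u (hatv x).
  exact: (solution_reflection_le cu du cD1 dD1 cD2 cF dF cG F_elliptic F_mono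
    ueq u_pos u_bd rbar0 uinf).
(* The reflected function solves the same equation by [F_sym], and its infimum condition for [V] is
   that of [u] for [hatv V]. The inequality obtained for it is the reverse one for [u]. *)
have le2 x : (cball 1 `\ 0) x -> 0 < x 0 ord0 -> u (hatv x) <= u x.
  move=> Dx x1; rewrite -{2}(hatvK x).
  apply: (solution_reflection_le (u := u \o hatv) _ (reflected_du du)
    (reflected_cD1 cD1) (reflected_dD1 dD1) (reflected_cD2 cD2) cF dF cG
    F_elliptic F_mono _ _ _ rbar0 _ Dx x1).
  - by move=> y Dy; apply: continuous_in_hatv; apply/cu/hatvD_punctured.
  - move=> y Uy; rewrite (reflected_jet du dD1 Uy).
    have Uh := hatvU Uy.
    have sh := hess_symm du dD1 cD2 (punctured_sub Uh).
    have := ueq _ Uh; rewrite /jetof -{1}(hatvK (grad _ _)) -{1}(hatmK (hess _ _)).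
    by rewrite F_sym //; [exact: punctured_sub|exact: hatm_symm].
  - by move=> y /hatvU; apply: u_pos.
  - by move=> y /esphere_hatv; apply: u_bd.
  - move=> V r /(uinf (hatv V))[m [[y ys mE] H]]; exists m; split.
      exists (hatv y); first exact: esphere_hatv.
      by rewrite /= hatvK -mE -[dotp (hatv V) y]dotp_hatv hatvK.
    move=> z [zr z0]; have := H (hatv z); rewrite dotp_hatv; apply.
    by split; [exact: oball_hatv|exact: hatv_neq0].
have eq_pos x : (cball 1 `\ 0) x -> 0 < x 0 ord0 -> u (hatv x) = u x.
  by move=> Dx x1; apply: le_anti; rewrite le1 // le2.
move=> x Dx; case: (ltgtP (x 0 ord0) 0) => [x1|x1|x1].
- have := eq_pos (hatv x) (hatvD_punctured Dx).
  by rewrite hatvK hatvE eqxx oppr_gt0 => /(_ x1) ->.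
- exact: eq_pos.
- congr u; apply/rowP => i; rewrite hatvE; case: eqP => [->|//].
  by rewrite x1 oppr0.
Qed.
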